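(* Let $0<\delta<1$, $\lambda>0$, $q>\frac1{1-s}$, and let $f,g$ be two continuous functions on $\Omega$ with $0\le f<g$ pointwise. Suppose $u,v\in C^{1,\alpha}(\overline\Omega)$ solve $$-\Delta_p u+(-\Delta)_q^s u-\frac{\lambda}{u^\delta}=f,\quad u>0\ \text{ in }\Omega,\quad u|_{\Omega^c}=0,$$ $$-\Delta_p v+(-\Delta)_q^s v-\frac{\lambda}{v^\delta}=g,\quad v>0\ \text{ in }\Omega,\quad v|_{\Omega^c}=0.$$ Then $0<u<v$ in $\Omega$.
   Context: Setting: $\Omega\subset\mathbb R^N$ is a bounded domain with smooth boundary, $0<s<1$, $p,q>1$, $p>sq$, $\alpha\in(0,1)$, $\Omega^c=\mathbb R^N\setminus\Omega$. $-\Delta_p u=-\nabla\cdot(|\nabla u|^{p-2}\nabla u)$ and $(-\Delta)_q^s u(x)=2\,\mathrm{P.V.}\int_{\mathbb R^N}\frac{|u(x)-u(y)|^{q-2}(u(x)-u(y))}{|x-y|^{N+sq}}\,dy$. $W_0^{1,p}(\Omega)$ is the closure of $C_c^\infty(\Omega)$ in $W^{1,p}(\Omega)$ (functions extended by $0$ outside $\Omega$), $W_0^{s,q}(\Omega)$ is the set of $u\in W^{s,q}(\mathbb R^N)$ with $u=0$ in $\Omega^c$. $\mathcal X(\Omega)=W^{1,p}_{\mathrm{loc}}(\Omega)\cap W^{s,q}_{\mathrm{loc}}(\Omega)\cap L^q_{sq}(\mathbb R^N)$, where $L^q_{sq}(\mathbb R^N)$ is the set of $u\in L^q_{\mathrm{loc}}(\mathbb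 R^N)$ with $\int_{\mathbb R^N}\frac{|u(x)|^q}{(1+|x|)^{N+sq}}dx<\infty$. ''Solves'' is in the weak sense: $u\in\mathcal X(\Omega)$, there is $\theta\ge1$ with $u^\theta\in W_0^{1,p}(\Omega)\cap W_0^{s,q}(\Omega)$, $\operatorname{ess\,inf}_K u>0$ for all $K\subset\subset\Omega$, and for every $\varphi\in W_0^{1,p}(\Omega)\cap W_0^{s,q}(\Omega)$ with $\varphi\ge0$, $$\int_\Omega|\nabla u|^{p-2}\nabla u\cdot\nabla\varphi+\int_{\mathbb R^{2N}}\frac{|u(x)-u(y)|^{q-2}(u(x)-u(y))(\varphi(x)-\varphi(y))}{|x-y|^{N+sq}}dxdy=\int_\Omega\Big(\frac{\lambda}{u^\delta}+f\Big)\varphi,$$ and similarly for $v$ with $g$ in place of $f$. *)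

(* Defs.v *)
From HB Require Import structures.
From mathcomp Require Import all_boot all_order all_algebra.
From mathcomp Require Import all_classical all_reals all_analysis.
From mathcomp Require Import ess_sup_inf.

Set Implicit Arguments.
Unset Strict Implicit.
Unset Printing Implicit Defensive.

Import Order.TTheory GRing.Theory Num.Theory.
Import numFieldNormedType.Exports.

Local Open Scope classical_set_scope.
Local Open Scope ring_scope.

(* R^N is 'rV[R]_N, with the product sigma-algebra (which is the Borel one).
   Every Lebesgue measurable function agrees almost everywhere with a
   measurable function in this sense.  *)
Definition rV_display : measure_display. Proof. exact: default_measure_display. Qed.

Section measurable_rV.
Variables (R : realType) (n : nat).

Let coord (i : 'I_n) (x : 'rV[R]_n) : R := x ord0 i.

Let rV_set0 : g_sigma_preimage coord set0.
Proof. exact: sigma_algebra0. Qed.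

Let rV_setC A : g_sigma_preimage coord A -> g_sigma_preimage coord (~` A).
Proof. exact: sigma_algebraC. Qed.

Let rV_bigcup (F : (set 'rV[R]_n)^nat) :
  (forall i, g_sigma_preimage coord (F i)) ->
  g_sigma_preimage coord (\bigcup_i F i).
Proof. exact: sigma_algebra_bigcup. Qed.

HB.instance Definition _ := @isMeasurable.Build rV_display
  'rV[R]_n (g_sigma_preimage coord) rV_set0 rV_setC rV_bigcup.

End measurable_rV.

Lemma measurable_coord (R : realType) n (i : 'I_n) :
  measurable_fun setT (fun x : 'rV[R]_n => x ord0 i : R).
Proof.
move=> _ Y mY; rewrite setTI; apply: sub_sigma_algebra => /=.
rewrite -bigcup_seq/=; exists i => /=; first by rewrite mem_index_enum.
by exists Y => //; rewrite setTI.
Qed.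

Lemma measurable_fun_rVP d (T : measurableType d) (R : realType) n
    (f : T -> 'rV[R]_n) :
  (forall i, measurable_fun setT (fun t => f t ord0 i : R)) ->
  measurable_fun setT f.
Proof.
move=> mf _ Y mY; rewrite setTI.
suff /(_ Y mY) : @measurable _ 'rV[R]_n `<=` [set A | measurable (f @^-1` A)].
  by [].
apply: smallest_sub.
  split => /=.
  - by rewrite preimage_set0; exact: measurable0.
  - move=> A mA; rewrite setTD preimage_setC; exact: measurableC.
  - by move=> F mF; rewrite preimage_bigcup; exact: bigcupT_measurable.
rewrite -bigcup_seq; apply: bigcup_sub => i _ A [B mB <-] /=.
by rewrite setTI -comp_preimage -[X in measurable X]setTI; exact: mf.
Qed.

Section lebesgue_step.
Variables (R : realType) (n : nat).
Variable m : {sigma_finite_measure set 'rV[R]_n -> \bar R}.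

Definition rV_cons (x : R * 'rV[R]_n) : 'rV[R]_n.+1 :=
  row_mx (x.1)%:M x.2 : 'rV[R]_(1 + n).

Definition rV_uncons (v : 'rV[R]_n.+1) : R * 'rV[R]_n :=
  (v ord0 ord0, \row_i v ord0 (lift ord0 i)).

Lemma rV_cons0 x : rV_cons x ord0 ord0 = x.1.
Proof.
rewrite (_ : @ord0 n = lshift n (@ord0 0)); last exact/val_inj.
by rewrite [LHS](row_mxEl (x.1)%:M x.2) mxE.
Qed.

Lemma rV_consS x i : rV_cons x ord0 (lift ord0 i) = x.2 ord0 i.
Proof.
rewrite (_ : lift ord0 i = rshift 1 i); last exact/val_inj.
exact: (row_mxEr (x.1)%:M x.2).
Qed.

Lemma rV_consK : cancel rV_cons rV_uncons.
Proof.
move=> [a v]; rewrite /rV_uncons rV_cons0; congr pair.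
by apply/rowP => i; rewrite mxE rV_consS.
Qed.

Lemma measurable_rV_cons : measurable_fun setT rV_cons.
Proof.
apply: measurable_fun_rVP => i; case: (unliftP ord0 i) => [j|] ->.
  rewrite (_ : (fun _ => _) =
    (fun v : 'rV[R]_n => v ord0 j : R) \o (@snd R 'rV[R]_n)).
    by apply: measurableT_comp; [exact: measurable_coord | exact: measurable_snd].
  by apply/funext => x /=; rewrite rV_consS.
rewrite (_ : (fun _ => _) = @fst R 'rV[R]_n); first exact: measurable_fst.
by apply/funext => x /=; rewrite rV_cons0.
Qed.

Lemma measurable_rV_uncons : measurable_fun setT rV_uncons.
Proof.
apply: measurable_fun_pair; first exact: measurable_coord.
apply: measurable_fun_rVP => i.
rewrite (_ : (fun _ => _) =
  (fun v : 'rV[R]_n.+1 => v ord0 (lift ord0 i) : R)).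
  exact: measurable_coord.
by apply/funext => v; rewrite mxE.
Qed.

Definition lebesgue_rVS : set 'rV[R]_n.+1 -> \bar R :=
  pushforward (lebesgue_measure \x m)%E rV_cons.

Let mpush : {measure set 'rV[R]_n.+1 -> \bar R} :=
  measure_function_pushforward__canonical__measure_function_Measure
    (lebesgue_measure \x m)%E measurable_rV_cons.

Let lebesgue_rVS0 : lebesgue_rVS set0 = 0%E.
Proof. exact: (measure0 mpush). Qed.

Let lebesgue_rVS_ge0 A : (0 <= lebesgue_rVS A)%E.
Proof. exact: (measure_ge0 mpush). Qed.

Let lebesgue_rVS_sigma_additive : semi_sigma_additive lebesgue_rVS.
Proof. exact: (@measure_semi_sigma_additive _ _ _ mpush). Qed.

HB.instance Definition _ := isMeasure.Build _ _ _ lebesgue_rVS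
  lebesgue_rVS0 lebesgue_rVS_ge0 lebesgue_rVS_sigma_additive.

Let lebesgue_rVS_sigma_finite : sigma_finite setT lebesgue_rVS.
Proof.
have /sigma_finiteP[F [FT ndF Foo]] := sigma_finiteT (@lebesgue_measure R).
have /sigma_finiteP[G [GT ndG Goo]] := sigma_finiteT m.
exists (fun k => rV_uncons @^-1` (F k `*` G k)).
  apply/esym/seteqP; split=> // v _.
  have [a _ Fa] : (\bigcup_k F k) (rV_uncons v).1 by rewrite -FT.
  have [b _ Gb] : (\bigcup_k G k) (rV_uncons v).2 by rewrite -GT.
  exists (maxn a b) => //; split.
    by move: Fa; exact/subsetPset/ndF/leq_maxl.
  by move: Gb; exact/subsetPset/ndG/leq_maxr.
move=> k; have [mF Fk] := Foo k; have [mG Gk] := Goo k; split.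
  rewrite -[X in measurable X]setTI; apply: measurable_rV_uncons => //.
  exact: measurableX.
rewrite /lebesgue_rVS /pushforward -comp_preimage.
rewrite (_ : rV_uncons \o rV_cons = id); last exact/funext/rV_consK.
by rewrite preimage_id product_measure1E// lte_mul_pinfty// ge0_fin_numE.
Qed.

HB.instance Definition _ := Measure_isSigmaFinite.Build _ _ _ lebesgue_rVS
  lebesgue_rVS_sigma_finite.

End lebesgue_step.

(* Lebesgue measure on R^n: R^0 has mass 1, and the measure on R^(n+1) is the
   product of the one on R with the one on R^n. *)
Fixpoint lebesgue_rV (R : realType) (n : nat) :
    {sigma_finite_measure set 'rV[R]_n -> \bar R} :=
  match n with
  | 0 => dirac (0 : 'rV[R]_0)
  | k.+1 => lebesgue_rVS (lebesgue_rV R k)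
  end.

Section sobolev.
Variables (R : realType) (N : nat).
Local Notation RN := 'rV[R]_N.
Local Notation mu := (lebesgue_rV R N).
Implicit Types (U K : set RN) (u phi : RN -> R) (G : RN -> RN).

Definition dot (x y : RN) : R := \sum_(i < N) x ord0 i * y ord0 i.

(* The library's norm on 'rV[R]_N is the sup norm. *)
Definition enorm (x : RN) : R := Num.sqrt (dot x x).

Definition basis_vec (i : 'I_N) : RN := delta_mx ord0 i.

Definition partial (i : 'I_N) u : RN -> R := fun x => 'D_(basis_vec i) u x.

Definition grad u : RN -> RN := fun x => \row_i partial i u x.

Definition smooth u : Prop :=
  forall l : seq 'I_N, let Dlu := foldr partial u l in
    continuous Dlu /\ forall x i, derivable Dlu x (basis_vec i).

Definition boundary U : set RN := closure U `\` interior U.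

(* Near each boundary point, after relabeling and reorienting the coordinate
   axes, the set is the region above the graph of a smooth function of the
   remaining coordinates. *)
Definition smooth_boundary U : Prop :=
  forall x0, boundary U x0 ->
  exists (r : R) (i : 'I_N) (reversed : bool) (gamma : RN -> R),
  [/\ 0 < r, smooth gamma,
      forall x t, gamma (x + t *: basis_vec i) = gamma x &
      forall x, enorm (x - x0) < r ->
        (U x <-> gamma x < (-1) ^+ reversed * x ord0 i)].

Definition bounded_domain U : Prop :=
  [/\ open U, connected U, U !=set0 & bounded_set U].

Definition compactly_contained K U : Prop :=
  compact (closure K) /\ closure K `<=` U.

(* The class C^{1,a} on the closure of U: the first derivatives extend from U
   to a-Hoelder functions on the closure. *)
Definition C1_holder_closure (a : R) U u : Prop :=
  {within closure U, continuous u} /\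
  exists (G : RN -> RN) (C : R),
    (forall x i, U x -> is_derive x (basis_vec i) u (G x ord0 i)) /\
    (forall x y i, closure U x -> closure U y ->
       `|G x ord0 i - G y ord0 i| <= C * enorm (x - y) `^ a).

Definition test_function U phi : Prop :=
  smooth phi /\ compactly_contained [set x | phi x != 0] U.

Definition Lp (p : R) U u : Prop :=
  measurable_fun U u /\ (\int[mu]_(x in U) (`|u x| `^ p)%:E < +oo)%E.

Definition Lp_loc (p : R) U u : Prop :=
  forall K, compact K -> K `<=` U -> Lp p K u.

Definition weak_gradient U u G : Prop :=
  [/\ Lp_loc 1 U u,
      forall i, Lp_loc 1 U (fun x => G x ord0 i) &
      forall phi i, test_function U phi ->
        \int[mu]_(x in U) (u x * partial i phi x) =
        - \int[mu]_(x in U) (G x ord0 i * phi x)].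

Definition W1p (p : R) U u : Prop :=
  Lp p U u /\
  exists2 G, weak_gradient U u G & forall i, Lp p U (fun x => G x ord0 i).

(* The W^{1,p}(U) norm of a function u with weak gradient G. *)
Definition W1p_norm (p : R) U u G : \bar R :=
  ((\int[mu]_(x in U) (`|u x| `^ p)%:E +
    \int[mu]_(x in U) (enorm (G x) `^ p)%:E) `^ p^-1)%E.

Definition W01p (p : R) U u : Prop :=
  [/\ {ae mu, forall x, ~ U x -> u x = 0}, W1p p U u &
      exists2 G, weak_gradient U u G &
        forall e : R, 0 < e -> exists2 phi, test_function U phi &
          (W1p_norm p U (fun x => u x - phi x)%R
             (fun x => G x - grad phi x)%R < e%:E)%E].

Definition W1p_loc (p : R) U u : Prop :=
  forall V, open V -> compactly_contained V U -> W1p p V u.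

Definition gagliardo_kernel (s q : R) (x y : RN) : R :=
  (enorm (x - y) `^ (N%:R + s * q))^-1.

Definition Wsq (s q : R) U u : Prop :=
  Lp q U u /\
  (\int[mu \x mu]_(z in U `*` U)
      (`|u z.1 - u z.2| `^ q * gagliardo_kernel s q z.1 z.2)%:E < +oo)%E.

Definition W0sq (s q : R) U u : Prop :=
  Wsq s q setT u /\ {ae mu, forall x, ~ U x -> u x = 0}.

Definition Wsq_loc (s q : R) U u : Prop :=
  forall V, open V -> compactly_contained V U -> Wsq s q V u.

Definition Lqsq (s q : R) u : Prop :=
  Lp_loc q setT u /\
  (\int[mu]_x (`|u x| `^ q / (1 + enorm x) `^ (N%:R + s * q))%:E < +oo)%E.

Definition solution_space (p s q : R) U u : Prop :=
  [/\ W1p_loc p U u, Wsq_loc s q U u & Lqsq s q u].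

(* Weak solution of -Delta_p u + (-Delta)_q^s u - lambda u^(-delta) = f in U.
   Weak gradients are unique up to null sets, so that quantifying over all
   of them, Du and Dphi, only names the gradients of u and phi. Rintegral is
   unconstrained on non-integrable functions, whence the integrability
   clauses. *)
Definition weak_solution (p q s lambda delta : R) U f u : Prop :=
  [/\ solution_space p s q U u,
      exists theta : R, [/\ 1 <= theta, W01p p U (fun x => u x `^ theta) &
        W0sq s q U (fun x => u x `^ theta)],
      forall K (mK : measurable K), compactly_contained K U ->
        (0 < ess_inf (mrestr mu mK) (EFin \o u))%E &
      forall phi, W01p p U phi -> W0sq s q U phi ->
        {ae mu, forall x, 0 <= phi x} ->
      forall Du Dphi, weak_gradient U u Du -> weak_gradient U phi Dphi ->
        let local x := enorm (Du x) `^ (p - 2) * dot (Du x) (Dphi x) in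
        let nonlocal z := `|u z.1 - u z.2| `^ (q - 2) * (u z.1 - u z.2)
          * (phi z.1 - phi z.2) * gagliardo_kernel s q z.1 z.2 in
        let rhs x := (lambda / u x `^ delta + f x) * phi x in
        [/\ mu.-integrable U (EFin \o local),
            (mu \x mu)%E.-integrable setT (EFin \o nonlocal),
            mu.-integrable U (EFin \o rhs) &
            \int[mu]_(x in U) local x + \int[(mu \x mu)%E]_z nonlocal z =
            \int[mu]_(x in U) rhs x]].

End sobolev.

(* Main.v *)
(* Weak comparison: subtract the two equations and test with ((u - v - e)^+)^2.
   The p-Laplacian, the fractional and the singular terms are all monotone, so
   that g - f > 0 forces u <= v.

   Strong comparison: suppose that w = v - u vanishes at x0 and test with
   phi_e = zeta^(m+1) (w + e)^(-M), where zeta is a cutoff near x0 and M = N + 1.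
   - Local term: the part with the gradient of w has a sign. A nonnegative
     C^{1,alpha} function satisfies |Dw| <= C w^(alpha/(1+alpha)), and
     a |-> |a|^(p-2) a is Hoelder, hence the part with the gradient of zeta is
     O(zeta^m w^kappa (w + e)^(-M)); for m large it is at most
     sg phi_e + O(1), with sg as small as one likes.
   - Nonlocal term: the pairs (x, y) with w(x) <= w(y) contribute with the wrong
     sign at most phi_e(y) w(y)^b |x - y|^(q-1-b) times the kernel. Since
     q > 1/(1-s) means sq < q - 1, for b small this kernel is integrable.
   - The singular term is O(w).
   As g - f is bounded below near x0, the integral of phi_e is bounded
   independently of e. But w is Lipschitz and w(x0) = 0, so phi_e >= c e^(-N-1)
   on a cube of side e around x0: the integral is at least c/e. *)

Require Import Defs.
From HB Require Import structures.
From mathcomp Require Import all_boot all_order all_algebra.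
From mathcomp Require Import all_classical all_reals all_analysis.
From mathcomp Require Import measurable_realfun.
From mathcomp Require Import ring lra.

Set Implicit Arguments.
Unset Strict Implicit.
Unset Printing Implicit Defensive.

Import Order.TTheory GRing.Theory Num.Theory.
Import numFieldNormedType.Exports.

Local Open Scope classical_set_scope.
Local Open Scope ring_scope.

(** * Lebesgue measure on R^N *)

(** A linearised equation for v - u may degenerate or blow up where both gradients vanish, so no
    Harnack inequality for uniformly elliptic operators is at hand when p differs from 2. The large
    negative power of w + e, played against the strict sign of g - f, takes its place; the exponent
    N + 1 is the first integer for which the power beats the volume of a cube of side e. As u and v
    are C^1, every test function can be taken C^1 with compact support in the domain. This is why
    the positive part is squared (it becomes C^1) and lowered by e (its support leaves the
    boundary). Such functions are admissible for two reasons: mollification approximates them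
    uniformly together with their gradients, and a Lipschitz function of compact support has a
    finite Gagliardo seminorm. Integration by parts rests on translation invariance of the measure,
    and the kernel estimates on the volume of cubes; no boundary integral occurs. The constants have
    to be independent of e but may depend on everything else, so crude factors such as n in place of
    its square root are harmless. *)

Section sup_norm.
Variables (R : realType) (n : nat).
Implicit Types x y : 'rV[R]_n.

Lemma coord_le_norm x i : `|x ord0 i| <= `|x|.
Proof.
rewrite [leRHS]/Num.norm /= mx_normrE; apply/bigmax_geP; right => /=.
by exists (ord0, i).
Qed.

Lemma norm_rV_le x (r : R) : 0 <= r -> (`|x| <= r) = [forall i, `|x ord0 i| <= r].
Proof.
move=> r0; apply/idP/forallP => [xr i|xr].
  exact: le_trans (coord_le_norm x i) xr.
rewrite [leLHS]/Num.norm /= mx_normrE; apply/bigmax_leP; split => // -[a i] _ /=.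
by rewrite ord1.
Qed.

Lemma norm_rV_lt x (r : R) : 0 < r -> (`|x| < r) = [forall i, `|x ord0 i| < r].
Proof.
move=> r0; apply/idP/forallP => [xr i|xr].
  exact: le_lt_trans (coord_le_norm x i) xr.
rewrite [ltLHS]/Num.norm /= mx_normrE; apply/bigmax_ltP; split => // -[a i] _ /=.
by rewrite ord1.
Qed.

End sup_norm.

Section rV_measurability.
Variables (R : realType) (n : nat).
Local Notation RN := 'rV[R]_n.

(** Boxes with rational centres are measurable because the coordinates are; they are countably many,
    and an open set is the union of those that it contains. *)
Lemma open_measurable_rV (U : set RN) : open U -> measurable U.
Proof.
move=> oU.
pose box (a : 'rV[rat]_n * nat) : set RN :=
  [set x | forall i, `|x ord0 i - ratr (a.1 ord0 i)| < a.2.+1%:R^-1].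
have mbox a : measurable (box a).
  have -> : box a = \bigcap_(i in [set: 'I_n])
      ((fun x : RN => x ord0 i : R) @^-1` [set t | `|t - ratr (a.1 ord0 i)| < a.2.+1%:R^-1]).
    by apply/seteqP; split=> x /= h i; [move=> _; exact: h|exact: (h i)].
  apply: fin_bigcap_measurable => // i _.
  rewrite -[X in measurable X]setTI; apply: measurable_coord => //.
  apply: open_measurable.
  rewrite (_ : mkset _ = ball (ratr (a.1 ord0 i) : R) a.2.+1%:R^-1).
    exact: ball_open.
  by apply/seteqP; split => t /=; rewrite -ball_normE /ball_ /= distrC.
have -> : U = \bigcup_a (if `[< box a `<=` U >] then box a else set0).
  apply/seteqP; split => [x Ux|x [a _]]; last by case: asboolP => // + bx; apply.
  have /nbhs_ballP[e /= e0 xeU] := open_nbhs_nbhs (conj oU Ux).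
  (* Twice the radius, since two points of a box are each within one radius of its centre. *)
  have [k] : exists k : nat, k.+1%:R^-1 *+ 2 < e.
    have e2 : 0 < e / 2 by rewrite divr_gt0.
    have [k _ /(_ k (leqnn k))/= ke] := near_infty_natSinv_lt (PosNum e2).
    by exists k; move: ke; set t := k.+1%:R^-1 => ?; lra.
  move=> ke.
  have hq i : exists q : rat, `|x ord0 i - ratr q| < k.+1%:R^-1.
    have [|q] := @rat_in_itvoo R (x ord0 i - k.+1%:R^-1) (x ord0 i + k.+1%:R^-1).
      by rewrite ltrD2l gtrN// invr_gt0.
    rewrite in_itv /= => /andP[q1 q2]; exists q.
    by rewrite distrC ltr_distl q1 q2.
  pose q i := xchoose (hq i).
  pose a : 'rV[rat]_n * nat := (\row_i q i, k).
  exists a => //.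
  have xa : box a x by move=> i; rewrite mxE; exact: (xchooseP (hq i)).
  case: asboolP => // -[] y ya; apply: xeU.
  rewrite -ball_normE /ball_ /= norm_rV_lt//; apply/forallP => i; rewrite !mxE.
  apply: le_lt_trans ke.
  rewrite -[X in `|X|](subrKA (ratr (a.1 ord0 i))).
  apply: le_trans (ler_normD _ _) _.
  rewrite mulr2n lerD//; first exact: ltW (xa i).
  by rewrite distrC; exact: ltW (ya i).
apply: countable_bigcupT_measurable; first exact: countableP.
by move=> a; case: asboolP => _; [exact: mbox|exact: measurable0].
Qed.

Lemma closed_measurable_rV (U : set RN) : closed U -> measurable U.
Proof.
move=> cU; rewrite -[U]setCK; apply: measurableC.
by apply: open_measurable_rV; exact: closed_openC.
Qed.

Lemma continuous_measurable_rV (f : RN -> R) :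
  continuous f -> measurable_fun setT f.
Proof.
move=> cf; apply: (measurability _ (RGenOpens.measurableE R)).
move=> _ [_ [a [b ->] <-]]; rewrite setTI; apply: open_measurable_rV.
by apply: open_comp; [move=> *; exact: cf | exact: interval_open].
Qed.

Lemma within_continuous_measurable_rV (U : set RN) (f : RN -> R) :
  open U -> {within U, continuous f} -> measurable_fun U f.
Proof.
move=> oU; rewrite continuous_open_subspace// continuous_inP// => cf.
apply: (measurability _ (RGenOpens.measurableE R)).
move=> _ [_ [a [b ->] <-]].
by apply: open_measurable_rV; apply: cf; exact: interval_open.
Qed.

End rV_measurability.

Section lebesgue_translation.
Variable R : realType.

(** The values on half-open intervals determine Lebesgue measure, and the image measure under a
    translation has the same ones. *)
Lemma lebesgue_measure_shift (a : R) (A : set R) : measurable A ->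
  lebesgue_measure ((fun t => t + a) @^-1` A) = lebesgue_measure A.
Proof.
move=> mA.
transitivity (pushforward lebesgue_measure
    ((fun t : R => t + a) : _ -> measurableTypeR R) A) => //.
apply/esym/lebesgue_measure_unique => //=.
  by apply: measurable_funD => //; exact: measurable_cst.
move=> _ _ [[x y]] _ <-; rewrite /pushforward.
rewrite (_ : _ @^-1` _ = `]x - a, y - a]%classic).
  rewrite !lebesgue_measure_itv /= !lte_fin ltrD2r.
  by rewrite -!EFinB opprB addrA subrK.
by apply/seteqP; split => t /=; rewrite !in_itv/= ltrBlDr lerBrDr.
Qed.

(** By induction on n: the product measure and its image under a translation agree on rectangles,
    which determine it. For n = 0 the only vector is 0. *)
Lemma lebesgue_rV_shift n (a : 'rV[R]_n) (A : set 'rV[R]_n) : measurable A ->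
  lebesgue_rV R n ((fun x => x + a) @^-1` A) = lebesgue_rV R n A.
Proof.
elim: n a A => [|n IH] a A mA.
  by congr (_ _); apply/funext => x /=; rewrite [a]thinmx0 addr0.
rewrite /= /lebesgue_rVS /pushforward.
pose a0 := (rV_uncons a).1; pose a1 := (rV_uncons a).2.
pose sh (z : measurableTypeR R * 'rV[R]_n) : measurableTypeR R * 'rV[R]_n :=
  (z.1 + a0, z.2 + a1).
have msh : measurable_fun setT sh.
  apply: measurable_fun_pair.
    by apply: measurable_funD; [exact: measurable_fst|exact: measurable_cst].
  apply: measurable_fun_rVP => i.
  rewrite (_ : (fun _ => _) = (fun z : R * 'rV[R]_n => z.2 ord0 i + a1 ord0 i)).
    apply: measurable_funD; last exact: measurable_cst.
    apply: measurableT_comp (measurable_coord i) _; exact: measurable_snd.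
  by apply/funext => z; rewrite mxE.
have mA' : measurable (rV_cons (n:=n) @^-1` A).
  by rewrite -[X in measurable X]setTI; exact: measurable_rV_cons.
transitivity ((lebesgue_measure \x lebesgue_rV R n)%E
    (sh @^-1` (rV_cons (n:=n) @^-1` A))).
  congr (_ _); apply/seteqP.
  have E z : rV_cons z + a = rV_cons (sh z).
    apply/rowP => i; rewrite mxE; case: (unliftP ord0 i) => [j|] ->.
      by rewrite !rV_consS /= !mxE.
    by rewrite !rV_cons0.
  by split => z /=; rewrite E.
pose m := measure_function_pushforward__canonical__measure_function_Measure
  (lebesgue_measure \x lebesgue_rV R n)%E msh.
apply/esym; apply: (@product_measure_unique _ _ _ _ R lebesgue_measure (lebesgue_rV R n) m) => // B C mB mC.
rewrite /m /= /pushforward.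
rewrite (_ : sh @^-1` _ = ((fun t => t + a0) @^-1` B) `*` ((fun x => x + a1) @^-1` C)) //.
rewrite product_measure1E.
- by congr (_ * _)%E; [exact: lebesgue_measure_shift|exact: IH].
- by rewrite -[X in measurable X]setTI; apply: measurable_funD => //; exact: measurable_cst.
- rewrite -[X in measurable X]setTI; apply: (@measurable_fun_rVP _ 'rV[R]_n) => // i.
  rewrite (_ : (fun _ => _) = (fun z : 'rV[R]_n => z ord0 i + a1 ord0 i)).
    by apply: measurable_funD; [exact: measurable_coord|exact: measurable_cst].
  by apply/funext => z; rewrite mxE.
Qed.

Lemma lebesgue_rV_box n (c : 'rV[R]_n) (r : R) : 0 <= r ->
  lebesgue_rV R n [set x | forall i, `|x ord0 i - c ord0 i| <= r] =
  ((r *+ 2) ^+ n)%:E.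
Proof.
move=> r0; elim: n c => [|n IH] c.
  by rewrite /= diracE mem_set ?expr0//= => -[].
transitivity ((lebesgue_measure \x lebesgue_rV R n)%E
  (`[c ord0 ord0 - r, c ord0 ord0 + r] `*`
  [set x : 'rV[R]_n | forall i, `|x ord0 i - (rV_uncons c).2 ord0 i| <= r])).
  rewrite /= /lebesgue_rVS /pushforward; congr (_ _); apply/seteqP; split => z /=.
    move=> h; split.
      by have := h ord0; rewrite rV_cons0 in_itv/= ler_distl.
    by move=> i; have := h (lift ord0 i); rewrite rV_consS mxE.
  move=> [h1 h2] i; case: (unliftP ord0 i) => [j|] ->.
    by have := h2 j; rewrite rV_consS mxE.
  by move: h1; rewrite rV_cons0 in_itv/= ler_distl.
rewrite product_measure1E//; last first.
  rewrite (_ : mkset _ = \bigcap_(i in [set: 'I_n]) ((fun x : 'rV[R]_n =>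
    x ord0 i : R) @^-1` [set` `[(rV_uncons c).2 ord0 i - r, (rV_uncons c).2 ord0 i + r]])).
    apply: fin_bigcap_measurable => // i _.
    by rewrite -[X in measurable X]setTI; apply: measurable_coord.
  apply/seteqP; split => x /= h i.
    by move=> _; rewrite /= in_itv/= -ler_distl; exact: h.
  by have := h i I; rewrite /= in_itv/= ler_distl.
have E : lebesgue_measure (`[c ord0 ord0 - r, c ord0 ord0 + r]%classic : set R)
    = (r *+ 2)%:E.
  rewrite lebesgue_measure_itv/= lte_fin.
  case: ifPn => [_|]; first by rewrite -EFinB; congr _%:E; ring.
  rewrite -leNgt => h; congr _%:E; apply/esym/eqP; rewrite eq_le; apply/andP; split; lra.
rewrite IH exprS EFinM; congr (_ * _)%E; exact: E.
Qed.

End lebesgue_translation.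

Section real_integrability.
Context d (T : measurableType d) (R : realType) (m : {measure set T -> \bar R}).
Variables (D : set T) (mD : measurable D).
Implicit Types f g : T -> R.

Lemma integrable_EFinD f g : m.-integrable D (EFin \o f) ->
  m.-integrable D (EFin \o g) -> m.-integrable D (EFin \o (fun x => f x + g x)).
Proof. by move=> fi gi; exact: (integrableD mD fi gi). Qed.

Lemma integrable_EFinB f g : m.-integrable D (EFin \o f) ->
  m.-integrable D (EFin \o g) -> m.-integrable D (EFin \o (fun x => f x - g x)).
Proof. by move=> fi gi; exact: (integrableB mD fi gi). Qed.

Lemma integrable_EFinZ (k : R) f : m.-integrable D (EFin \o f) ->
  m.-integrable D (EFin \o (fun x => k * f x)).
Proof. by move=> fi; exact: (integrableZl mD k fi). Qed.

Lemma restrict_EFin_comp f : EFin \o (f \_ D) = (EFin \o f) \_ D.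
Proof. by apply/funext => x /=; rewrite !patchE; case: ifP. Qed.

End real_integrability.

Section continuous_real_functions.
Variables (T : topologicalType) (R : realType).
Implicit Types f g : T -> R.

Lemma continuous_mul f g : continuous f -> continuous g ->
  continuous (fun x => f x * g x).
Proof. by move=> cf cg x; apply: continuousM; [exact: cf|exact: cg]. Qed.

Lemma continuous_sub f g : continuous f -> continuous g ->
  continuous (fun x => f x - g x).
Proof. by move=> cf cg x; apply: continuousB; [exact: cf|exact: cg]. Qed.

Lemma continuous_add f g : continuous f -> continuous g ->
  continuous (fun x => f x + g x).
Proof. by move=> cf cg x; apply: continuousD; [exact: cf|exact: cg]. Qed.

Lemma continuous_normr f : continuous f -> continuous (fun x => `|f x|).
Proof. by move=> cf x; apply: continuous_comp; [exact: cf|exact: norm_continuous]. Qed.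

End continuous_real_functions.

(** * Integration of compactly supported functions and integration by parts *)

Section integration.
Variables (R : realType) (n : nat).
Local Notation RN := 'rV[R]_n.
Local Notation mu := (lebesgue_rV R n).
Implicit Types (f g : RN -> R) (r C : R).

Definition vanishes_beyond r f := forall x : RN, r < `|x| -> f x = 0.

Lemma measurable_shift (a : RN) : measurable_fun setT (fun x : RN => x + a).
Proof.
apply: measurable_fun_rVP => i.
rewrite (_ : (fun _ => _) = (fun z : RN => z ord0 i + a ord0 i)).
  by apply: measurable_funD; [exact: measurable_coord|exact: measurable_cst].
by apply/funext => z; rewrite mxE.
Qed.

Lemma ge0_integral_shift (a : RN) (h : RN -> \bar R) :
  measurable_fun setT h -> (forall x, (0 <= h x)%E) ->
  (\int[mu]_x h (x + a)%R = \int[mu]_x h x)%E.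
Proof.
move=> mh h0; have := @ge0_integral_pushforward _ _ _ _ R _ (measurable_shift a)
  mu setT h measurableT mh (fun _ _ => h0 _).
rewrite preimage_setT => <-.
apply: eq_measure_integral; first exact: measurable_shift.
move=> ? A mA _ /=; rewrite /pushforward; exact: lebesgue_rV_shift.
Qed.

Lemma integral_shift (a : RN) (h : RN -> \bar R) :
  measurable_fun setT h ->
  (\int[mu]_x h (x + a)%R = \int[mu]_x h x)%E.
Proof.
move=> mh; rewrite integralE [RHS]integralE; congr (_ - _)%E.
  rewrite -(ge0_integral_shift a (measurable_funepos mh))//.
  by apply: eq_integral => x _; rewrite !unlock.
rewrite -(ge0_integral_shift a (measurable_funeneg mh))//.
by apply: eq_integral => x _; rewrite !unlock.
Qed.

Lemma measurable_cube (c : RN) r : measurable [set x | `|x - c| <= r].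
Proof.
apply: closed_measurable_rV.
rewrite (_ : mkset _ = (fun x : RN => `|x - c|) @^-1` [set t | t <= r]) //.
apply: (preimage_closed _ (@closed_le R r)) => x _.
apply: (@continuous_comp _ _ _ (fun x : RN => x - c) (fun y : RN => `|y|)).
  by apply: continuousB => //; exact: cst_continuous.
exact: norm_continuous.
Qed.

Lemma lebesgue_rV_cube (c : RN) r : 0 <= r ->
  mu [set x | `|x - c| <= r] = ((r *+ 2) ^+ n)%:E.
Proof.
move=> r0; rewrite -(lebesgue_rV_box c r0); congr (_ _).
apply/seteqP; split => x /=; rewrite norm_rV_le//.
  by move=> /forallP h i; have := h i; rewrite !mxE.
by move=> h; apply/forallP => i; rewrite !mxE.
Qed.

Lemma bounded_set_lty (A : set RN) : measurable A -> bounded_set A ->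
  (mu A < +oo)%E.
Proof.
move=> mA [M [_ AM]].
pose r := `|M| + 1.
have r0 : 0 <= r by rewrite addr_ge0.
apply: (@le_lt_trans _ _ (mu [set x | `|x - 0| <= r])).
  apply: le_measure; rewrite ?inE//; first exact: measurable_cube.
  move=> x Ax /=; rewrite subr0; apply: AM => //.
  by rewrite /r (le_lt_trans (ler_norm M))// ltrDl.
by rewrite lebesgue_rV_cube// ltry.
Qed.

Lemma vanishes_beyond_integrable f r C : measurable_fun setT f ->
  vanishes_beyond r f -> (forall x, `|f x| <= C) ->
  mu.-integrable setT (EFin \o f).
Proof.
move=> mf f0 fC.
pose D := [set x : RN | `|x - 0| <= r].
have mD : measurable D by exact: measurable_cube.
have -> : EFin \o f = (EFin \o f) \_ D.
  apply/funext => x; rewrite patchE; case: ifPn => // xD /=.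
  rewrite f0// ltNge; apply/negP => xr; move/negP: xD; apply.
  by rewrite inE /D /= subr0.
apply/(integrable_mkcond _ mD). apply: measurable_bounded_integrable => //.
- apply: bounded_set_lty => //; exists r; split => [|M rM x]; first exact: num_real.
  by rewrite /D /= subr0 => /le_trans; apply; exact: ltW.
- exact: measurable_funS mf.
- exists C; split => [|M CM x _]; first exact: num_real.
  exact: le_trans (ltW CM).
Qed.

Lemma vanishes_beyond_bounded f r : continuous f -> vanishes_beyond r f ->
  exists2 C, 0 <= C & forall x, `|f x| <= C.
Proof.
move=> cf f0.
pose A := [set x : RN | `|x| <= `|r|].
have cA : compact A.
  apply: bounded_closed_compact.
    by exists `|r|; split => [|M rM x /le_trans]; [exact: num_real|apply; exact: ltW].
  rewrite (_ : A = (fun x : RN => `|x|) @^-1` [set t | t <= `|r|]) //.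
  by apply: (preimage_closed _ (@closed_le R _)) => x _; exact: norm_continuous.
have [||c _ cP] := @EVT_max_rV R n (fun x => `|f x|) A _ cA.
- by exists 0; rewrite /A /= normr0.
- apply: continuous_subspaceT => x.
  by apply: continuous_comp; [exact: cf|exact: norm_continuous].
exists `|f c| => // x; have [xA|xA] := boolP (x \in A); first exact: cP.
rewrite f0 ?normr0// ltNge; apply: contra xA => xr; rewrite inE /A /=.
exact: le_trans (ler_norm _).
Qed.

Lemma cc_integrable f r : continuous f -> vanishes_beyond r f ->
  mu.-integrable setT (EFin \o f).
Proof.
move=> cf f0; have [C _ fC] := vanishes_beyond_bounded cf f0.
by apply: vanishes_beyond_integrable f0 fC; exact: continuous_measurable_rV.
Qed.

(** Restriction to a line gives access to the one-variable mean value theorem and chain rule. *)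
Lemma is_derive_line f (v x : RN) (df : RN -> R) (t : R) :
  is_derive (x + t *: v) v f (df (x + t *: v)) ->
  is_derive t 1 (fun t => f (x + t *: v)) (df (x + t *: v)).
Proof.
have E : (fun h : R => h^-1 *: (((fun t => f (x + t *: v)) \o shift t) (h *: 1) - f (x + t *: v)))
   = (fun h : R => h^-1 *: ((f \o shift (x + t *: v)) (h *: v) - f (x + t *: v))).
  apply/funext => h /=; congr (_ *: (f _ - _)).
  by rewrite /GRing.scale/= mulr1 addrCA -scalerDl.
move=> [dv vE]; split.
  by rewrite /derivable E.
by rewrite /derive E.
Qed.

(* By translation invariance, t |-> \int f (x + t e_i) dx is constant; it can be
   differentiated under the integral sign. *)
Lemma integral_partial_eq0 i f (df : RN -> R) r :
  continuous f -> vanishes_beyond r f ->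
  (forall x, is_derive x (basis_vec R i) f (df x)) ->
  continuous df -> vanishes_beyond r df ->
  \int[mu]_x df x = 0.
Proof.
move=> cf f0 fdf cdf df0.
have [C C0 dfC] := vanishes_beyond_bounded cdf df0.
pose F (t : R) (x : RN) := f (x + t *: basis_vec R i).
have dF (t : R) x : is_derive t 1 (F ^~ x) (df (x + t *: basis_vec R i)).
  exact: is_derive_line.
have nt t : `|t *: basis_vec R i| <= `|t|.
  rewrite norm_rV_le//; apply/forallP => j; rewrite !mxE /=.
  by case: eqP => _; rewrite ?mulr1 ?mulr0 ?normr0.
have big t x : -1 < t < 1 -> r + 1 < `|x| -> r < `|x + t *: basis_vec R i|.
  move=> t1 xr; have := lerB_normD x (t *: basis_vec R i).
  have := nt t; have : `|t| < 1 by rewrite ltr_norml.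
  lra.
have mline t : measurable_fun setT (F t).
  apply: continuous_measurable_rV => x; apply: continuous_comp; last exact: cf.
  by apply: continuousD => //; exact: cst_continuous.
have [Cf _ fC] := vanishes_beyond_bounded cf f0.
(* The dominating function: a shift by |t| < 1 enlarges the support of [df] by at most 1. *)
pose G x : R := C * \1_[set x : RN | `|x - 0| <= r + 1] x.
have G0 x : 0 <= G x by rewrite mulr_ge0.
have /= := @cvg_differentiation_under_integral R _ _ mu F setT measurableT 0 (-1) 1 _ _ _ G G0 _ _.
have F0 h : \int[mu]_x F h x = \int[mu]_x F 0 x.
  rewrite /Rintegral; congr fine; rewrite /F.
  under [RHS]eq_integral do rewrite scale0r addr0.
  apply: (@integral_shift _ (EFin \o f)).
  by apply/measurable_EFinP; exact: continuous_measurable_rV.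
have d1 t x : partial1of2 F t x = df (x + t *: basis_vec R i).
  by rewrite partial1of2E (derive_val (is_derive := dF t x)).
have -> : \int[mu]_y partial1of2 F 0 y = \int[mu]_x df x.
  by apply: eq_Rintegral => x _; rewrite d1 scale0r addr0.
move=> H; apply/esym.
(* By [F0] all the difference quotients are 0, hence so is their limit. *)
have {}H : 0 @[h --> (0:R)^'] --> \int[mu]_x df x.
  have := H _ _ _ _ _; rewrite (_ : (fun h : R => _) = cst 0).
    apply.
    + by rewrite in_itv /= ltr01 ltrN10.
    + move=> t t1; apply: (@vanishes_beyond_integrable _ (r + 1) Cf) => //.
        by move=> x xr; apply: f0; apply: big xr; move: t1; rewrite /= in_itv.
      by move=> x; exact: fC.
    + by move=> t x _ _; case: (dF t x).
    + apply: (@vanishes_beyond_integrable _ (r + 1) C) => //.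
      * apply: measurable_funM; first exact: measurable_cst.
        by apply: measurable_indic; exact: measurable_cube.
      * by move=> x xr; rewrite /G indicE memNset ?mulr0//= subr0; apply/negP; rewrite -ltNge.
      * by move=> x; rewrite /G indicE; case: (_ \in _); [rewrite mulr1 ger0_norm|rewrite mulr0 normr0].
    + move=> t x t1 _; rewrite d1 /G indicE; case: (boolP (x \in _)) => xr; first by rewrite mulr1.
      rewrite mulr0 df0 ?normr0//; apply: big; first by move: t1; rewrite /= in_itv.
      by rewrite ltNge; apply: contra xr => xr; rewrite inE /= subr0.
  by apply/funext => h; rewrite addr0 F0 subrr scaler0.
exact: (cvg_unique _ (cvg_cst _) H).
Qed.

End integration.

(** * Bump functions and mollification *)

Section flat_functions.
Variable R : realType.
Implicit Types (P Q : {poly R}) (t y e : R).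

(* The functions [P(1/t) exp(-1/t)] (extended by 0 to t <= 0) are closed under
   differentiation, which makes them smooth. *)
Definition flat P t : R := if 0 < t then P.[t^-1] * expR (- t^-1) else 0.

(** The exponential series gives y^i <= i! e^y for y > 0, whence the factorials in the constant. *)
Lemma horner_expR_bounded P : exists2 C, 0 <= C &
  forall y, 0 < y -> `|P.[y]| * expR (- y) <= C.
Proof.
exists (\sum_(i < size P) `|P`_i| * (i`!)%:R).
  by apply: sumr_ge0 => i _; rewrite mulr_ge0.
move=> y y0; rewrite horner_coef.
apply: (@le_trans _ _ ((\sum_(i < size P) `|P`_i| * y ^+ i) * expR (- y))).
  rewrite ler_wpM2r ?expR_ge0//; apply: le_trans (ler_norm_sum _ _ _) _.
  by apply: ler_sum => i _; rewrite normrM (ger0_norm (exprn_ge0 _ (ltW y0))).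
rewrite mulr_suml; apply: ler_sum => i _; rewrite -mulrA ler_wpM2l//.
rewrite expRN ler_pdivrMr ?expR_gt0//.
case: (nat_of_ord i) => [|k].
  by rewrite expr0 fact0 mul1r -expR0 ler_expR ltW.
have := expR_ge1Dxn k (ltW y0) => h.
rewrite mulrC -ler_pdivrMr ?ltr0n ?fact_gt0//; apply: le_trans h; lra.
Qed.

(** The previous bound, applied to [P * 'X] at 1/t, gains the factor t that gives the derivative at
    0. *)
Lemma flat_le P : exists2 C, 0 <= C & forall t, `|flat P t| <= C * `|t|.
Proof.
have [C C0 CP] := horner_expR_bounded (P * 'X).
exists C => // t; rewrite /flat; case: ifPn => t0; last by rewrite normr0 mulr_ge0.
have := CP t^-1; rewrite invr_gt0 => /(_ t0).
rewrite hornerM hornerX normrM [`|t^-1|]gtr0_norm ?invr_gt0//.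
rewrite normrM (gtr0_norm (expR_gt0 _)) (gtr0_norm t0) => h.
by rewrite -ler_pdivrMr//; apply: le_trans h; rewrite mulrAC.
Qed.

(** For t > 0 this is the chain rule: both 1/t and -1/t contribute a factor 1/t^2, which is ['X^2]
    at 1/t. At 0 the difference quotient is [flat (P * 'X)], which tends to 0. *)
Lemma is_derive_flat P t :
  is_derive t 1 (flat P) (flat ('X^2 * (P - P^`())) t).
Proof.
have [t0|t0|<-] := ltgtP 0 t.
- have dV : is_derive t 1 (fun x : R => x^-1) (- t ^- 2).
    have := @is_deriveV R id t 1 1 _ _; rewrite /GRing.scale /= mulr1; apply => //.
    by rewrite gt_eqF.
  have dN : is_derive t 1 (fun x : R => - x^-1) (t ^- 2).
    by have := is_deriveN dV; rewrite opprK.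
  have dP := is_derive1_comp (is_derive_poly P t^-1) dV.
  have dE := @is_derive1_comp R expR (fun x : R => - x^-1) t _ _
    (is_derive_expR (- t^-1)) dN.
  have dPE := is_deriveM dP dE.
  apply: (@near_eq_is_derive _ _ _ ((horner P \o (fun x => x^-1)) * (expR \o (fun x : R => - x^-1)))).
    near=> x; rewrite /flat ifT//; near: x.
    by apply: (@lt_nbhsr _ 0).
  apply: is_derive_eq dPE _.
  rewrite /flat t0 !hornerE /GRing.scale /= -!exprVn; ring.
- have -> : flat ('X^2 * (P - P^`())) t = 0 by rewrite /flat ltNge ltW.
  apply: (@near_eq_is_derive R R R (cst 0) _ t 1 0 _ (is_derive_cst 0 t 1)).
  near=> x; rewrite /flat ifF//; apply/negbTE; rewrite -leNgt ltW//; near: x.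
  exact: lt_nbhsl.
- have [C C0 CP] := flat_le (P * 'X).
  rewrite [flat _ 0]/flat ltxx.
  suff H : h^-1 *: ((flat P \o shift 0) (h *: 1) - flat P 0) @[h --> 0^'] --> (0 : R).
    by split; [apply/cvg_ex; exists 0|exact: cvg_lim].
  have E h : h != 0 -> flat (P * 'X) h = h^-1 *: ((flat P \o shift 0) (h *: 1) - flat P 0).
    move=> h0; rewrite /= addr0 [X in _ - X]/flat ltxx subr0 /flat /GRing.scale /= mulr1.
    case: ifPn => hp; last by rewrite mulr0.
    by rewrite hornerM hornerX mulrCA mulrA.
  apply/cvgr0Pnorm_le => e e0; near=> h.
  rewrite -E; last by near: h; exact: nbhs_dnbhs_neq.
  apply: le_trans (CP h) _.
  apply: (@le_trans _ _ ((C + 1) * `|h|)).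
    by rewrite ler_wpM2r// lerDl.
  rewrite -ler_pdivlMl; last by rewrite ltr_wpDl.
  near: h; apply: dnbhs0_le; rewrite mulr_gt0// invr_gt0 ltr_wpDl//.
Unshelve. all: by end_near. Qed.

(** The products vanish outside [-e, e]. Sums are included so that the Leibniz rule stays inside the
    class: smoothness follows without a formula for the higher derivatives. *)
Inductive bump1 e : (R -> R) -> Prop :=
| bump1_flat P Q : bump1 e (fun t => flat P (e + t) * flat Q (e - t))
| bump1_add f g : bump1 e f -> bump1 e g -> bump1 e (f \+ g).

Lemma bump1_derive e f : bump1 e f ->
  exists2 g, bump1 e g & forall t, is_derive t 1 f (g t).
Proof.
elim=> [P Q|f1 f2 _ [g1 bg1 fg1] _ [g2 bg2 fg2]]; last first.
  by exists (g1 \+ g2); [exact: bump1_add|move=> t; exact: is_deriveD].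
pose D P := 'X^2 * (P - P^`()) : {poly R}.
exists ((fun t => flat (D P) (e + t) * flat Q (e - t)) \+
        (fun t => flat P (e + t) * flat (- D Q) (e - t))).
  by apply: bump1_add; exact: bump1_flat.
move=> t.
have d1 : is_derive t 1 (fun t => flat P (e + t)) (flat (D P) (e + t)).
  have dS : is_derive t 1 (fun t : R => e + t) 1.
    by have := is_deriveD (is_derive_cst e t 1) (is_derive_id t 1); rewrite add0r.
  have := @is_derive1_comp R (flat P) (fun t => e + t) t _ _ (is_derive_flat P (e + t)) dS.
  by rewrite mulr1.
have d2 : is_derive t 1 (fun t => flat Q (e - t)) (flat (- D Q) (e - t)).
  have dS : is_derive t 1 (fun t : R => e - t) (-1).
    by have := is_deriveB (is_derive_cst e t 1) (is_derive_id t 1); rewrite sub0r.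
  have := @is_derive1_comp R (flat Q) (fun t => e - t) t _ _ (is_derive_flat Q (e - t)) dS.
  move=> h; apply: is_derive_eq h _.
  by rewrite /flat; case: ifPn; rewrite ?mul0r// hornerN mulrN1 mulNr.
have := is_deriveM d1 d2; move=> h; apply: is_derive_eq h _.
by rewrite /GRing.scale /= addrC [flat Q _ * _]mulrC.
Qed.

Lemma bump1_continuous e f : bump1 e f -> continuous f.
Proof.
move=> /bump1_derive[g _ fg] t.
by apply/differentiable_continuous/derivable1_diffP; case: (fg t).
Qed.

Lemma bump1_out e f t : bump1 e f -> e <= `|t| -> f t = 0.
Proof.
move=> bf et; elim: bf => [P Q|f1 f2 _ h1 _ h2] /=; last by rewrite h1 h2 addr0.
have [t0|t0] := leP 0 t.
  rewrite (ger0_norm t0) in et.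
  by rewrite [flat Q _]/flat ltNge subr_le0 et mulr0.
rewrite (ltr0_norm t0) in et.
by rewrite [flat P _]/flat ltNge -lerBrDl sub0r lerNr et mul0r.
Qed.

End flat_functions.

(** * Mollification by products of one-variable bumps *)

Section mollification.
Variables (R : realType) (n : nat).
Local Notation RN := 'rV[R]_n.
Local Notation mu := (lebesgue_rV R n).
Implicit Types (f g phi rho : RN -> R) (r C e : R).

Lemma is_derive_from_line f (v x : RN) (d : R) :
  is_derive (0 : R) 1 (fun t => f (x + t *: v)) d -> is_derive x v f d.
Proof.
have E : (fun h : R => h^-1 *: (((fun t => f (x + t *: v)) \o shift 0) (h *: 1) - f (x + 0 *: v)))
   = (fun h : R => h^-1 *: ((f \o shift x) (h *: v) - f x)).
  apply/funext => h /=; rewrite scale0r !addr0; congr (_ *: (f _ - _)).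
  by rewrite /GRing.scale/= mulr1 addrC.
move=> [dv vE]; split; first by rewrite /derivable -E.
by rewrite /derive -E.
Qed.

Lemma continuous_prod (I : Type) (s : seq I) (P : pred I) (F : I -> RN -> R) :
  (forall i, continuous (F i)) -> continuous (fun x => \prod_(i <- s | P i) F i x).
Proof.
move=> cF; elim: s => [|i s IH].
  by under eq_fun do rewrite big_nil; exact: cst_continuous.
under eq_fun do rewrite big_cons; case: (P i) => // x.
by apply: continuousM; [exact: cF|exact: IH].
Qed.

Lemma cc_unif_continuous f r : continuous f -> vanishes_beyond r f ->
  forall w, 0 < w -> exists2 d, 0 < d &
    forall x y, `|x - y| < d -> `|f x - f y| <= w.
Proof.
move=> cf f0 w w0.
(* With this margin and d < 1, a point x outside K has its neighbour y outside the support as well,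
   and both values are 0. *)
pose K := [set x : RN | `|x| <= `|r| + 1].
have cK : compact K.
  apply: bounded_closed_compact.
    exists (`|r| + 1); split => [|M rM x /le_trans]; first exact: num_real.
    by apply; exact: ltW.
  rewrite (_ : K = (fun x : RN => `|x|) @^-1` [set t | t <= `|r| + 1]) //.
  by apply: (preimage_closed _ (@closed_le R _)) => x _; exact: norm_continuous.
have near_cov := (compact_near_coveringP K).1 cK.
pose P (d : R) (x : RN) := forall y, `|x - y| < d -> `|f x - f y| <= w.
have : \forall d \near 0^'+, K `<=` P d.
  apply: near_cov => x Kx.
  have w2 : 0 < w / 2 by rewrite divr_gt0.
  have /cvgrPdist_le/(_ _ w2)/nbhs_ballP[d /= d0 xd] := cf x.
  exists (ball x (d / 2), [set d' | 0 < d' < d / 2]) => /=.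
    split; first by apply: nbhsx_ballx; rewrite divr_gt0.
    near=> d' => /=; apply/andP; split; first by near: d'; exact: nbhs_right_gt.
    by near: d'; apply: nbhs_right_lt; rewrite divr_gt0.
  move=> [x' d'] /= [xx' /andP[d'0 d'd]] y x'y.
  rewrite -(subrKA (f x)); apply: le_trans (ler_normD _ _) _.
  rewrite [leRHS]splitr lerD//.
    rewrite distrC; apply: xd; apply: le_ball xx'; lra.
  apply: xd; rewrite -ball_normE /ball_ /=.
  move: xx'; rewrite -ball_normE /ball_ /= => xx'.
  rewrite -(subrKA x'); apply: le_lt_trans (ler_normD _ _) _; lra.
move=> H.
have : \forall d \near 0^'+, [/\ 0 < d, d < 1 & K `<=` P d].
  near=> d; split; near: d => //; first exact: nbhs_right_gt.
  exact: nbhs_right_lt.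
move/filter_ex => [d [d0 d1 KP]]; exists d => // x y xy.
have [Kx|] := boolP (x \in K); first by apply: KP => //; rewrite -inE.
rewrite notin_setE /K /= => /negP; rewrite -ltNge => xr.
have h := lerB_dist x y.
have := ler_norm r => h2.
rewrite !f0 ?subrr ?normr0 ?ltW//; lra.
Unshelve. all: by end_near. Qed.

Definition tensor (b : 'I_n -> R -> R) : RN -> R := fun x => \prod_i b i (x ord0 i).

Lemma is_derive_tensor (b : 'I_n -> R -> R) j (x : RN) (d : R) :
  is_derive (x ord0 j) 1 (b j) d ->
  is_derive x (basis_vec R j) (tensor b) (d * \prod_(i | i != j) b i (x ord0 i)).
Proof.
move=> bd; apply: is_derive_from_line.
set c := \prod_(i | _) _.
have -> : (fun t => tensor b (x + t *: basis_vec R j)) =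
          (fun t => b j (x ord0 j + t) * c).
  apply/funext => t; rewrite /tensor (bigD1 j)//=; congr (b j _ * _).
    by rewrite !mxE !eqxx mulr1.
  apply: eq_bigr => i ij; rewrite !mxE eqxx /= (negbTE ij) mulr0 addr0//.
have dS : is_derive (0:R) 1 (fun t : R => x ord0 j + t) 1.
  by have := is_deriveD (is_derive_cst (x ord0 j) (0:R) 1) (is_derive_id (0:R) 1); rewrite add0r.
have bd' : is_derive (x ord0 j + 0) 1 (b j) d by rewrite addr0.
have H := @is_derive1_comp R (b j) (fun t => x ord0 j + t) 0 _ _ bd' dS.
have := is_deriveM H (is_derive_cst c (0:R) 1).
by move=> h; apply: is_derive_eq h _; rewrite scaler0 add0r mulr1 /GRing.scale/= mulrC.
Qed.

Definition bumpN e rho := exists2 b, (forall i, bump1 e (b i)) & rho = tensor b.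

(** Only the j-th factor is differentiated, so the class is stable under partial derivatives of
    every order. *)
Lemma bumpN_partial e rho j : bumpN e rho ->
  bumpN e (partial j rho) /\
  forall x, is_derive x (basis_vec R j) rho (partial j rho x).
Proof.
move=> [b bb ->]; have [g bg dg] := bump1_derive (bb j).
have H x := @is_derive_tensor b j x _ (dg (x ord0 j)).
split; last by move=> x; apply: is_derive_eq (H x) _; rewrite /partial derive_val.
exists (fun i => if i == j then g else b i); first by move=> i; case: eqP.
apply/funext => x; rewrite /partial (derive_val (is_derive := H x)).
rewrite /tensor [RHS](bigD1 j)//= eqxx; congr (_ * _).
by apply: eq_bigr => i /negbTE ->.
Qed.

Lemma bumpN_continuous e rho : bumpN e rho -> continuous rho.
Proof.
move=> [b bb ->]; apply: continuous_prod => i x.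
apply: (@continuous_comp _ _ _ (fun x : RN => x ord0 i : R) (b i)).
  exact: coord_continuous.
exact: (bump1_continuous (bb i)).
Qed.

Lemma bumpN_out e rho : 0 < e -> bumpN e rho ->
  forall x, e <= `|x| -> rho x = 0.
Proof.
move=> e0 [b bb ->] x; rewrite leNgt norm_rV_lt// => /forallPn[i]; rewrite -leNgt => h.
by rewrite /tensor (bigD1 i)//= (bump1_out (bb i) h) mul0r.
Qed.

Definition convolution phi rho : RN -> R := fun x => \int[mu]_y (phi y * rho (x - y)).

Lemma continuous_reflect rho (x : RN) : continuous rho -> continuous (fun y : RN => rho (x - y)).
Proof.
move=> cr y; apply: continuous_comp; last exact: cr.
by apply: continuousB => //; exact: cst_continuous.
Qed.

Lemma conv_integrable phi rho r (x : RN) : continuous phi -> vanishes_beyond r phi ->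
  continuous rho -> mu.-integrable setT (fun y : RN => (phi y * rho (x - y))%:E).
Proof.
move=> cp p0 cr; apply: (@cc_integrable _ _ (fun y => phi y * rho (x - y)) r).
  by move=> y; apply: continuousM; [exact: cp|exact: continuous_reflect].
by move=> y yr; rewrite p0// mul0r.
Qed.

Lemma continuous_conv phi rho r e : continuous phi -> vanishes_beyond r phi ->
  continuous rho -> vanishes_beyond e rho -> continuous (convolution phi rho).
Proof.
move=> cp p0 cr r0 x; apply/(@cvgrPdist_le R R RN (nbhs x) (nbhs_filter x)) => w w0.
have ip : mu.-integrable setT (EFin \o phi) by exact: cc_integrable p0.
pose I := \int[mu]_y `|phi y|.
have I0 : 0 <= I by apply: Rintegral_ge0.
(* The integral I may be 0, whence the 1 in the denominator. *)
have [|d d0 rd] := cc_unif_continuous cr r0 (w := w / (I + 1)).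
  by rewrite divr_gt0// ltr_wpDl.
near=> z.
rewrite /convolution -RintegralB//; try exact: conv_integrable p0 _.
apply: le_trans (le_normr_Rintegral _ _) _ => //.
  by apply: integrable_EFinB => //; exact: conv_integrable p0 _.
apply: (@le_trans _ _ (\int[mu]_y (w / (I + 1) * `|phi y|))).
  apply: le_Rintegral => //.
  - apply: (@integrable_norm _ _ _ _ _ (fun y => phi y * rho (x - y) - phi y * rho (z - y))).
    by apply: integrable_EFinB => //; exact: conv_integrable p0 _.
  - by apply: integrable_EFinZ => //; exact: (integrable_norm ip).
  move=> y _; rewrite -mulrBr normrM mulrC ler_wpM2r//; apply: rd.
  rewrite opprB addrA subrK; near: z.
  exact: (@cvgr_dist_lt _ _ _ _ _ id x).
rewrite RintegralZl//; last exact: (integrable_norm ip).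
rewrite -/I mulrAC ler_pdivrMr ?ltr_wpDl// ler_wpM2l ?ltW//; lra.
Unshelve. all: by end_near. Qed.

(** Continuity of [phi] suffices because the derivative falls on [rho]; [|phi|] times a bound on the
    partial derivative of [rho] dominates. *)
Lemma is_derive_conv phi rho r e j (x : RN) : continuous phi -> vanishes_beyond r phi ->
  0 < e -> bumpN e rho ->
  is_derive x (basis_vec R j) (convolution phi rho) (convolution phi (partial j rho) x).
Proof.
move=> cp p0 e0 br; have [bp dr] := bumpN_partial j br.
have cr := bumpN_continuous br; have cdr := bumpN_continuous bp.
have dr0 : vanishes_beyond e (partial j rho).
  by move=> z ez; apply: bumpN_out bp _ _ => //; exact: ltW.
have [C C0 rC] := vanishes_beyond_bounded cdr dr0.
pose F (t : R) (y : RN) := phi y * rho (x + t *: basis_vec R j - y).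
pose G (y : RN) := `|phi y| * C.
have dF (t : R) y : is_derive t 1 (F ^~ y) (phi y * partial j rho (x + t *: basis_vec R j - y)).
  have E s : x + s *: basis_vec R j - y = (x - y) + s *: basis_vec R j by rewrite addrAC.
  have := @is_derive_line _ _ rho (basis_vec R j) (x - y) (partial j rho) t (dr _).
  move=> /(is_deriveM (is_derive_cst (phi y) t 1)) H.
  rewrite /F; under eq_fun do rewrite E; rewrite E.
  by apply: is_derive_eq H _; rewrite scaler0 addr0.
have d1 t y : partial1of2 F t y = phi y * partial j rho (x + t *: basis_vec R j - y).
  by rewrite partial1of2E (derive_val (is_derive := dF t y)).
have G0 y : 0 <= G y by rewrite mulr_ge0.
have := @cvg_differentiation_under_integral R _ _ mu F setT measurableT 0 (-1) 1 _ _ _ G G0 _ _.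
have -> : \int[mu]_y partial1of2 F 0 y = convolution phi (partial j rho) x.
  by apply: eq_Rintegral => y _; rewrite d1 scale0r addr0.
move=> H; apply: is_derive_from_line.
suff H' : h^-1 *: (((fun t => convolution phi rho (x + t *: basis_vec R j)) \o shift 0) (h *: 1)
   - convolution phi rho (x + 0 *: basis_vec R j)) @[h --> (0:R)^'] --> convolution phi (partial j rho) x.
  by split; [apply/cvg_ex; exists (convolution phi (partial j rho) x)|exact: cvg_lim].
under eq_fun do rewrite /= [_ *: 1]mulr1.
apply: H.
- by rewrite /= in_itv /= ltr01 ltrN10.
- by move=> t _; exact: conv_integrable p0 cr.
- by move=> t y _ _; case: (dF t y).
- apply: (@cc_integrable _ _ G r).
    apply: continuous_mul; first exact: continuous_normr.
    by move=> y; exact: cst_continuous.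
  by move=> y yr; rewrite /G p0// normr0 mul0r.
- by move=> t y _ _; rewrite d1 /G normrM ler_wpM2l.
Qed.

Lemma smooth_conv phi rho r e : continuous phi -> vanishes_beyond r phi ->
  0 < e -> bumpN e rho -> smooth (convolution phi rho).
Proof.
move=> cp p0 e0 br.
have H l : foldr (@partial R n) (convolution phi rho) l = convolution phi (foldr (@partial R n) rho l)
    /\ bumpN e (foldr (@partial R n) rho l).
  elim: l => [//|j l [/= -> bl]]; split; last by have [] := bumpN_partial j bl.
  by apply/funext => x; rewrite [LHS](derive_val (is_derive := is_derive_conv j x cp p0 e0 bl)).
move=> l Dlu; rewrite /Dlu; have [-> bl] := H l; split.
  apply: (@continuous_conv _ _ r e) => //; first exact: bumpN_continuous bl.
  by move=> z ez; apply: bumpN_out bl _ _ => //; exact: ltW.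
by move=> x i; case: (is_derive_conv i x cp p0 e0 bl).
Qed.

(** The two integrands differ by the partial derivative in y of [phi y * rho (x - y)], whose
    integral is 0. Through this identity mollification approximates the gradient too. *)
Lemma conv_partial phi dphi rho r e j (x : RN) :
  continuous phi -> vanishes_beyond r phi ->
  (forall x, is_derive x (basis_vec R j) phi (dphi x)) ->
  continuous dphi -> vanishes_beyond r dphi ->
  0 < e -> bumpN e rho ->
  convolution phi (partial j rho) x = convolution dphi rho x.
Proof.
move=> cp p0 dp cdp dp0 e0 br; have [bp dr] := bumpN_partial j br.
have cr := bumpN_continuous br; have cdr := bumpN_continuous bp.
pose f y := phi y * rho (x - y).
pose df y := dphi y * rho (x - y) - phi y * partial j rho (x - y).
have := @integral_partial_eq0 R n j f df r.
rewrite {2}/df (RintegralB measurableT (conv_integrable x cdp dp0 cr)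
  (conv_integrable x cp p0 cdr)).
move=> H; apply/esym/eqP; rewrite -subr_eq0; apply/eqP/H.
- by move=> y; apply: continuousM; [exact: cp|exact: continuous_reflect].
- by move=> y yr; rewrite /f p0// mul0r.
- move=> y; apply: is_derive_from_line.
  have h1 := @is_derive_line _ _ phi (basis_vec R j) y dphi 0.
  rewrite scale0r addr0 in h1; have {}h1 := h1 (dp y).
  have h2 : is_derive (0:R) 1 (fun t : R => rho (x - (y + t *: basis_vec R j))) (- partial j rho (x - y)).
    have E t : x - (y + t *: basis_vec R j) = (x - y) + (- t) *: basis_vec R j.
      by rewrite opprD addrA scaleNr.
    under eq_fun do rewrite E.
    have hl := @is_derive_line _ _ rho (basis_vec R j) (x - y) (partial j rho) (- 0) (dr _).
    have := @is_derive1_comp R (fun t => rho (x - y + t *: basis_vec R j)) (fun t : R => - t) (0:R) _ _ hl (is_deriveNid (0:R) 1).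
    by move=> h; apply: is_derive_eq h _; rewrite oppr0 scale0r addr0 mulrN1.
  have := is_deriveM h1 h2; move=> h; apply: is_derive_eq h _.
  by rewrite scale0r addr0 /df /GRing.scale /= mulrN addrC [rho _ * _]mulrC.
- by apply: continuous_sub; apply: continuous_mul => //; exact: continuous_reflect.
- by move=> y yr; rewrite /df p0// dp0// !mul0r subrr.
Qed.

Lemma bumpN_exists e : 0 < e -> exists2 rho, bumpN e rho &
  [/\ forall x, 0 <= rho x, forall x, rho (- x) = rho x, 0 < rho 0 &
      0 < \int[mu]_y rho y].
Proof.
move=> e0; pose b (i : 'I_n) t : R := flat 1 (e + t) * flat 1 (e - t).
have flat1 t : flat 1 t = if 0 < t then expR (- t^-1) else 0 :> R.
  by rewrite /flat hornerE mul1r.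
have b0 i t : 0 <= b i t.
  by rewrite /b !flat1; do 2 case: ifP => _; rewrite ?mulr0 ?mul0r// mulr_ge0 ?expR_ge0.
have bT : bumpN e (tensor b) by exists b => // i; exact: bump1_flat.
exists (tensor b) => //.
have t0 x : 0 <= tensor b x by apply: prodr_ge0.
have ct := bumpN_continuous bT.
have tv : vanishes_beyond e (tensor b).
  by move=> z ez; apply: bumpN_out bT _ _ => //; exact: ltW.
have it := cc_integrable ct tv.
have tz : 0 < tensor b 0.
  by apply: prodr_gt0 => i _; rewrite mxE /b !flat1 subr0 addr0 e0 mulr_gt0 ?expR_gt0.
split => //.
  move=> x; apply: eq_bigr => i _; rewrite mxE /b mulrC; congr (_ * flat _ _).
  by rewrite opprK.
have t2 : 0 < tensor b 0 / 2 by rewrite divr_gt0.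
have [d d0 hd] := cc_unif_continuous ct tv t2.
pose A := [set x : RN | `|x - 0| <= d / 2].
have mA : measurable A by exact: measurable_cube.
have d20 : 0 < d / 2 by rewrite divr_gt0.
have muA : mu A = ((d / 2 *+ 2) ^+ n)%:E by rewrite lebesgue_rV_cube// ltW.
have muAoo : (mu A < +oo)%E by rewrite muA ltry.
apply: (@lt_le_trans _ _ (\int[mu]_(x in A) (tensor b 0 / 2))).
  have -> : \int[mu]_(x in A) (tensor b 0 / 2) = tensor b 0 / 2 * (d / 2 *+ 2) ^+ n.
    by rewrite Rintegral_cst//; congr (_ * _); exact: (congr1 fine muA).
  by rewrite mulr_gt0// exprn_gt0// pmulrn_lgt0.
rewrite Rintegral_mkcond; apply: le_Rintegral => //.
  rewrite restrict_EFin_comp; apply/(integrable_mkcond _ mA); apply: measurable_bounded_integrable => //.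
  by exists (tensor b 0 / 2); split => [|M CM y _]; [exact: num_real|rewrite ger0_norm ltW].
move=> y _; rewrite patchE; case: ifPn => // yA.
have : `|y - 0| < d.
  by move: yA; rewrite inE /A /= => h; apply: le_lt_trans h _; rewrite ltr_pdivrMr// ltr_pMr// ltr1n.
move/hd; rewrite ler_distl => /andP[+ _]; lra.
Qed.

(** Evenness turns the reflection into a translation, so that translation invariance of the measure
    is enough. *)
Lemma integral_reflect rho (x : RN) : continuous rho -> (forall y, rho (- y) = rho y) ->
  \int[mu]_y rho (x - y) = \int[mu]_y rho y.
Proof.
move=> cr re; rewrite /Rintegral; congr fine.
under eq_integral do rewrite -re opprB.
apply: (@integral_shift _ _ (- x) (EFin \o rho)).
by apply/measurable_EFinP; exact: continuous_measurable_rV.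
Qed.

(** The convolution at x weighs the values of [phi] within distance e; the total weight is the
    integral of [rho], which is not normalised to 1. *)
Lemma conv_close phi rho r e w (x : RN) : continuous phi -> vanishes_beyond r phi ->
  0 < e -> bumpN e rho -> (forall y, 0 <= rho y) -> (forall y, rho (- y) = rho y) ->
  (forall y, `|x - y| < e -> `|phi x - phi y| <= w) ->
  `|phi x * \int[mu]_y rho y - convolution phi rho x| <= w * \int[mu]_y rho y.
Proof.
move=> cp p0 e0 br r0 re pw.
have cr := bumpN_continuous br.
have rv : vanishes_beyond e rho.
  by move=> z ez; apply: bumpN_out br _ _ => //; exact: ltW.
have irx : mu.-integrable setT (fun y : RN => (rho (x - y))%:E).
  apply: (@cc_integrable _ _ (fun y => rho (x - y)) (`|x| + e)).
    exact: continuous_reflect.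
  by move=> y yr; apply: rv; have := lerB_dist y x; rewrite distrC; lra.
rewrite -(integral_reflect x cr re) -!RintegralZl// /convolution -RintegralB//; last first.
  - exact: conv_integrable p0 cr.
  - exact: (integrableZl measurableT (phi x) irx).
have ii : mu.-integrable setT (EFin \o (fun y => phi x * rho (x - y) - phi y * rho (x - y))).
  apply: integrable_EFinB => //; last exact: conv_integrable p0 cr.
  exact: (integrableZl measurableT (phi x) irx).
apply: le_trans (le_normr_Rintegral _ _) _ => //.
apply: le_Rintegral => //; first exact: integrable_norm ii.
  exact: (integrableZl measurableT w irx).
move=> y _; rewrite -mulrBl normrM (ger0_norm (r0 _)).
have [xy|xy] := ltP `|x - y| e; first by rewrite ler_wpM2r// pw.
by rewrite (bumpN_out e0 br xy) !mulr0.
Qed.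

Lemma conv_support phi rho e (x : RN) : 0 < e -> bumpN e rho ->
  convolution phi rho x != 0 -> exists2 y, phi y != 0 & `|x - y| < e.
Proof.
move=> e0 br; apply: contraPP => h; apply/negP; rewrite negbK; apply/eqP.
rewrite /convolution -[RHS](Rintegral_set0 mu (fun=> 0)) Rintegral_mkcond [RHS]Rintegral_mkcond.
apply: eq_Rintegral => y _; rewrite patch_setT patch_set0.
have [->|py] := eqVneq (phi y) 0; first by rewrite mul0r.
rewrite (bumpN_out e0 br) ?mulr0// leNgt; apply/negP => xy.
by apply: h; exists y.
Qed.

End mollification.

(** * Compactly supported C^1 test functions *)

Section mean_value.
Variables (R : realType) (n : nat).
Local Notation RN := 'rV[R]_n.
Implicit Types (f : RN -> R) (G : RN -> RN) (x y c : RN).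

(** The segment is parametrised by [0, 1] so that a may have either sign or be 0. *)
Lemma line_mvt f (df : RN -> R) (e x : RN) (a : R) :
  (forall t, 0 <= t <= 1 -> is_derive (x + (t * a) *: e) e f (df (x + (t * a) *: e))) ->
  exists2 t, 0 <= t <= 1 & f (x + a *: e) - f x = a * df (x + (t * a) *: e).
Proof.
move=> fdf; pose g (t : R) := f (x + (t * a) *: e).
have dg (t : R) : 0 <= t <= 1 -> is_derive t 1 g (df (x + (t * a) *: e) * a).
  move=> t01; have h1 := is_derive_line (fdf _ t01).
  have h2 : is_derive t 1 (fun t : R => t * a) a.
    have := is_deriveM (is_derive_id t 1) (is_derive_cst a t 1).
    by move=> h; apply: is_derive_eq h _; rewrite scaler0 add0r /GRing.scale /= mulr1.
  exact: (@is_derive1_comp R (fun s => f (x + s *: e)) (fun t => t * a) t _ _ h1 h2).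
have [||t t01] := @MVT R g (fun t => df (x + (t * a) *: e) * a) 0 1 ltr01.
- by move=> t; rewrite in_itv /= => /andP[t0 t1]; apply: dg; rewrite !ltW.
- apply: derivable_within_continuous => t; rewrite in_itv /= => t01.
  by case: (dg t t01).
rewrite /g mul1r mul0r scale0r addr0 subr0 mulr1 mulrC => ->.
by exists t => //; move: t01; rewrite in_itv /= => /andP[t0 t1]; rewrite !ltW.
Qed.

(** The path from x to y changes one coordinate at a time. It stays in the cube, and each of its n
    pieces has length at most |x - y|, so partial derivatives are all that it takes. *)
Lemma cube_lipschitz f G c (r L : R) : 0 <= r ->
  (forall x i, `|x - c| <= r -> is_derive x (basis_vec R i) f (G x ord0 i)) ->
  (forall x i, `|x - c| <= r -> `|G x ord0 i| <= L) ->
  forall x y, `|x - c| <= r -> `|y - c| <= r ->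
    `|f x - f y| <= n%:R * L * `|x - y|.
Proof.
move=> r0 fG GL x y; rewrite !norm_rV_le// => /forallP xc /forallP yc.
pose z k : RN := \row_i (if (i < k)%N then y ord0 i else x ord0 i).
have z0 : z 0%N = x by apply/rowP => i; rewrite mxE.
have zn : z n = y by apply/rowP => i; rewrite mxE ltn_ord.
rewrite distrC -{1}zn -{1}z0 -(telescope_sumr (fun k => f (z k)) (leq0n n)) big_mkord.
apply: le_trans (ler_norm_sum _ _ _) _.
have -> : n%:R * L * `|x - y| = \sum_(k < n) (L * `|x - y|).
  by rewrite sumr_const card_ord -mulrA mulr_natl.
apply: ler_sum => k _.
pose a := y ord0 k - x ord0 k.
have zS : z k.+1 = z k + a *: basis_vec R k.
  apply/rowP => i; rewrite !mxE eqxx /= ltnS leq_eqVlt.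
  have [->|ik] := eqVneq i k; first by rewrite eqxx ltnn mulr1 /a subrKC.
  by rewrite val_eqE (negbTE ik) /= mulr0 addr0.
have zt t : 0 <= t <= 1 -> `|z k + (t * a) *: basis_vec R k - c| <= r.
  move=> /andP[t0 t1]; rewrite norm_rV_le//; apply/forallP => i; rewrite !mxE eqxx /=.
  have := xc i; have := yc i; rewrite !mxE.
  have [->|ik] := eqVneq i k.
    rewrite ltnn mulr1 /a !ler_norml => /andP[y1 y2] /andP[x1 x2].
    by apply/andP; split; nra.
  by rewrite mulr0 addr0; case: ifP.
have [t t01] := @line_mvt f (fun x => G x ord0 k) (basis_vec R k) (z k) a (fun t t01 => fG _ k (zt t t01)).
rewrite -zS => ->; rewrite normrM mulrC ler_pM//.
  exact: GL (zt t t01).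
by have := coord_le_norm (x - y) k; rewrite !mxE distrC.
Qed.

End mean_value.

Section compactly_supported_C1.
Variables (R : realType) (n : nat).
Local Notation RN := 'rV[R]_n.
Local Notation mu := (lebesgue_rV R n).
Implicit Types (f g : RN -> R) (G H : RN -> RN) (U C K : set RN) (r : R).

(** A point outside U has a neighbourhood that misses C, on which f is 0; so only the points of U
    have to be examined. *)
Lemma continuous_glue U C f : open U -> closed C -> C `<=` U ->
  {in U, continuous f} -> (forall x, ~ C x -> f x = 0) -> continuous f.
Proof.
move=> oU cC CU cf f0 x; have [Ux|Ux] := boolP (x \in U); first exact: cf.
have xC : (~` C) x by move=> /CU Ux'; move/negP: Ux; apply; rewrite inE.
rewrite /continuous_at f0//; apply: (@cvg_near_cst _ _ 0 f (nbhs (x : RN)) (nbhs_filter (x : RN))).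
have : \forall y \near x, (~` C) y by apply: open_nbhs_nbhs; split => //; exact: closed_openC.
by apply: filterS => y /f0.
Qed.

Lemma is_derive_glue U C f (df : RN -> R) (v : RN) : open U -> closed C -> C `<=` U ->
  (forall x, U x -> is_derive x v f (df x)) ->
  (forall x, ~ C x -> f x = 0 /\ df x = 0) -> forall x, is_derive x v f (df x).
Proof.
move=> oU cC CU dfU f0 x; have [Ux|Ux] := boolP (x \in U).
  by apply: dfU; rewrite -inE.
have xC : (~` C) x by move=> /CU Ux'; move/negP: Ux; apply; rewrite inE.
rewrite (f0 x xC).2.
apply: (@near_eq_is_derive R RN R (cst 0) f x v 0 _ (is_derive_cst 0 x v)).
have : \forall y \near x, (~` C) y by apply: open_nbhs_nbhs; split => //; exact: closed_openC.
by apply: filterS => y /f0[].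
Qed.

Lemma compact_bounded_rV K : compact K -> exists2 r, 0 <= r & forall x, K x -> `|x| <= r.
Proof.
move=> /compact_bounded[M [_ KM]]; exists (`|M| + 1); first by rewrite addr_ge0.
by move=> x Kx; apply: KM => //; rewrite (le_lt_trans (ler_norm M))// ltrDl.
Qed.

Lemma compact_closed_rV K : compact K -> closed K.
Proof. by apply: compact_closed; exact: norm_hausdorff. Qed.

Lemma compact_open_margin U K : open U -> compact K -> K `<=` U ->
  exists2 d, 0 < d & forall x y, K x -> `|x - y| < d -> U y.
Proof.
move=> oU cK KU.
pose P (d : R) (x : RN) := forall y, `|x - y| < d -> U y.
have : \forall d \near 0^'+, K `<=` P d.
  apply: (compact_near_coveringP K).1 => // x Kx.
  have /nbhs_ballP[d /= d0 xd] : nbhs x U by apply: open_nbhs_nbhs; split => //; exact: KU.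
  exists (ball x (d / 2), [set d' | 0 < d' < d / 2]) => /=.
    split; first by apply: nbhsx_ballx; rewrite divr_gt0.
    near=> d' => /=; apply/andP; split; first by near: d'; exact: nbhs_right_gt.
    by near: d'; apply: nbhs_right_lt; rewrite divr_gt0.
  move=> [x' d'] /= [xx' /andP[d'0 d'd]] y x'y.
  apply: xd; move: xx'; rewrite -ball_normE /ball_ /= => xx'.
  rewrite -(subrKA x'); apply: le_lt_trans (ler_normD _ _) _; lra.
move=> H; have : \forall d \near 0^'+, 0 < d /\ K `<=` P d.
  near=> d; split; near: d => //; exact: nbhs_right_gt.
by move/filter_ex => [d [d0 KP]]; exists d => // x y /KP; apply.
Unshelve. all: by end_near. Qed.

Lemma continuous_on_compact_bounded U K f : open U -> {in U, continuous f} ->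
  compact K -> K `<=` U -> exists2 C, 0 <= C & forall x, K x -> `|f x| <= C.
Proof.
move=> oU cf cK KU; have [->|K0] := eqVneq K set0; first by exists 0.
have cfK : {within K, continuous (fun x => `|f x|)}.
  apply: (continuous_subspaceW KU).
  rewrite continuous_open_subspace// => x xU.
  by apply: continuous_comp; [exact: cf|exact: norm_continuous].
have [|c _ cP] := @EVT_max_rV R n (fun x => `|f x|) K _ cK cfK; first exact/set0P.
by exists `|f c| => // x Kx; apply: cP; rewrite inE.
Qed.

Lemma compact_lty K : compact K -> (mu K < +oo)%E.
Proof.
move=> cK; apply: bounded_set_lty; last exact: compact_bounded.
by apply: closed_measurable_rV; exact: compact_closed_rV.
Qed.

Lemma Lp_loc1_continuous U f : open U -> {in U, continuous f} -> Lp_loc 1 U f.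
Proof.
move=> oU cf K cK KU.
have mf : measurable_fun K f.
  apply: measurable_funS KU _; first exact: open_measurable_rV.
  by apply: within_continuous_measurable_rV => //; rewrite continuous_open_subspace.
split => //; have [C C0 fC] := continuous_on_compact_bounded oU cf cK KU.
have mK : measurable K by apply: closed_measurable_rV; exact: compact_closed_rV.
have /integrableP[_] : mu.-integrable K (EFin \o f).
  apply: measurable_bounded_integrable => //; first exact: compact_lty.
  by exists C; split => [|M CM x Kx]; [exact: num_real|exact: le_trans (fC x Kx) (ltW CM)].
by under eq_integral do rewrite /= -(powRr1 (normr_ge0 _)).
Qed.

Lemma closure_support_partial (phi : RN -> R) i x :
  (forall x i, derivable phi x (basis_vec R i)) ->
  ~ closure [set x | phi x != 0] x -> phi x = 0 /\ partial i phi x = 0.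
Proof.
move=> dphi xC.
have H : \forall y \near x, phi y = 0.
  have : \forall y \near x, (~` closure [set x | phi x != 0]) y.
    by apply: open_nbhs_nbhs; split => //; apply: closed_openC; exact: closed_closure.
  apply: filterS => y yC; apply/eqP; apply: contrapT => /negP yn; apply: yC.
  exact: subset_closure.
split; first exact: nbhs_singleton H.
rewrite /partial (@near_eq_derive R RN R phi (cst 0) x)//.
by rewrite derive_val.
Qed.

(** The product of f with a test function, extended by 0, is C^1 with compact support in the whole
    space, so its partial derivatives have integral 0. The boundary of U never enters. *)
Lemma weak_gradient_C1 U f G : open U -> {in U, continuous f} ->
  (forall x i, U x -> is_derive x (basis_vec R i) f (G x ord0 i)) ->
  (forall i, {in U, continuous (fun x => G x ord0 i)}) -> weak_gradient U f G.
Proof.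
move=> oU cf dfG cG; split.
- exact: Lp_loc1_continuous.
- by move=> i; exact: Lp_loc1_continuous.
move=> phi i [sphi [cC CU]].
set C := closure _ in cC CU.
have cphi : continuous phi by have [] := sphi [::].
have dphi x j : derivable phi x (basis_vec R j) by have [_] := sphi [::]; exact.
have cdphi : continuous (partial i phi) by have [] := sphi [:: i].
have C0 x : ~ C x -> phi x = 0 /\ partial i phi x = 0 by exact: closure_support_partial.
have [r r0 Cr] := compact_bounded_rV cC.
have rC x : r < `|x| -> ~ C x by move=> + /Cr; rewrite ltNge => /negP.
have clC := compact_closed_rV cC.
have c1 : continuous (fun x => f x * partial i phi x).
  apply: (continuous_glue oU clC CU) => [x xU|x /C0[_ ->]]; last by rewrite mulr0.
  by apply: continuousM; [exact: cf|exact: cdphi].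
have c2 : continuous (fun x => G x ord0 i * phi x).
  apply: (continuous_glue oU clC CU) => [x xU|x /C0[-> _]]; last by rewrite mulr0.
  by apply: continuousM; [exact: cG|exact: cphi].
have v1 : vanishes_beyond r (fun x => f x * partial i phi x).
  by move=> x /rC/C0[_ ->]; rewrite mulr0.
have v2 : vanishes_beyond r (fun x => G x ord0 i * phi x).
  by move=> x /rC/C0[-> _]; rewrite mulr0.
have tU h : (forall x, ~ C x -> h x = 0) -> \int[mu]_(x in U) h x = \int[mu]_x h x.
  move=> h0; rewrite Rintegral_mkcond; apply: eq_Rintegral => x _.
  rewrite patchE; case: ifPn => // xU; rewrite h0// => /CU xU'.
  by move/negP: xU; apply; rewrite inE.
rewrite !tU; try by move=> x /C0[h1 h2]; rewrite ?h1 ?h2 mulr0.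
apply/eqP; rewrite -addr_eq0 -RintegralD//; try exact: cc_integrable v1; try exact: cc_integrable v2.
apply/eqP; apply: (@integral_partial_eq0 _ _ i (fun x => f x * phi x) _ r).
- apply: (continuous_glue oU clC CU) => [x xU|x /C0[-> _]]; last by rewrite mulr0.
  by apply: continuousM; [exact: cf|exact: cphi].
- by move=> x /rC/C0[-> _]; rewrite mulr0.
- apply: (is_derive_glue oU clC CU) => [x xU|x /C0[-> ->]]; last by rewrite !mulr0 addr0.
  have h := is_deriveM (dfG x i xU) (DeriveDef (dphi x i) erefl).
  by apply: is_derive_eq h _; rewrite /GRing.scale/= [phi _ * _]mulrC.
- exact: continuous_add.
- by move=> x xr; rewrite v1// v2// addr0.
Qed.

(** The space of C^1 functions with compact support in U, the gradient being carried along as [G].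
    The test functions of both comparison arguments are of this kind. *)
Definition C1c U f G := [/\ continuous f,
  forall x i, is_derive x (basis_vec R i) f (G x ord0 i),
  forall i, continuous (fun x => G x ord0 i) &
  exists K, [/\ compact K, K `<=` U & forall x, ~ K x -> f x = 0 /\ G x = 0]].

Lemma C1c_weak_gradient U f G : open U -> C1c U f G -> weak_gradient U f G.
Proof.
move=> oU [cf dfG cG _]; apply: weak_gradient_C1 => //.
by move=> i x xU; exact: cG.
Qed.

Lemma Lp_cc U f (p r : R) : 0 < p -> measurable U -> continuous f -> vanishes_beyond r f ->
  Lp p U f.
Proof.
move=> p0 mU cf f0; have mf := continuous_measurable_rV cf.
split; first exact: measurable_funS mf.
have [C C0 fC] := vanishes_beyond_bounded cf f0.
have h : mu.-integrable setT (EFin \o (fun x => `|f x| `^ p)).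
  apply: (@vanishes_beyond_integrable _ _ _ r (C `^ p)).
  - apply: (measurableT_comp (measurable_powR p)).
    exact: measurableT_comp (@normr_measurable R setT) mf.
  - by move=> x xr; rewrite f0// normr0 powR0// gt_eqF.
  - by move=> x; rewrite ger0_norm ?powR_ge0// ge0_ler_powR// ?nnegrE// ltW.
have /integrableP[_] := integrableS measurableT mU (@subsetT _ U) h.
by under eq_integral do rewrite gee0_abs ?lee_fin ?powR_ge0//.
Qed.

Lemma enorm_le (x : RN) : enorm x <= n%:R * `|x|.
Proof.
rewrite /enorm -(sqr_sqrtr (mulr_ge0 (ler0n R n) (normr_ge0 x))).
rewrite -[leRHS]ger0_norm ?mulr_ge0// -sqrtr_sqr sqr_sqrtr ?mulr_ge0// ler_wsqrtr//.
rewrite /dot.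
apply: (@le_trans _ _ (\sum_(i < n) `|x| ^+ 2)).
  apply: ler_sum => i _; rewrite -expr2 -[x ord0 i ^+ 2]ger0_norm ?sqr_ge0// normrX lerXn2r ?nnegrE//.
  exact: coord_le_norm.
rewrite sumr_const card_ord exprMn -[leLHS]mulr_natl ler_wpM2r ?sqr_ge0//.
by rewrite -natrX ler_nat; case: (n) => // k; rewrite expnS leq_pmulr// expn_gt0.
Qed.

Lemma measurable_enorm d (T : measurableType d) (D : set T) (f : T -> RN) :
  (forall i, measurable_fun D (fun t => f t ord0 i)) -> 
  measurable_fun D (fun t => enorm (f t)).
Proof.
move=> mf; apply: (@measurableT_comp _ _ _ _ _ _ (@Num.sqrt R)).
  by apply: continuous_measurable_fun; exact: sqrt_continuous.
by apply: measurable_sum => i; exact: measurable_funM.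
Qed.

Lemma C1c_W1p U f G (p : R) : 0 < p -> open U -> C1c U f G -> W1p p U f.
Proof.
move=> p0 oU fG; have [cf dfG cG [K [cK KU K0]]] := fG.
have [r r0 Kr] := compact_bounded_rV cK.
have rK x : r < `|x| -> ~ K x by move=> + /Kr; rewrite ltNge => /negP.
have mU := open_measurable_rV oU.
split; first by apply: (@Lp_cc _ _ _ r) => // x /rK/K0[].
exists G; first exact: C1c_weak_gradient.
by move=> i; apply: (@Lp_cc _ _ _ r) => // x /rK/K0[_ ->]; rewrite mxE.
Qed.

(** Mollification at a scale small compared with the moduli of continuity and with the distance from
    K to the complement of U. As r is chosen before w, uniform closeness yields closeness in L^p. *)
Lemma C1c_approx U f G : open U -> C1c U f G ->
  exists2 r, 0 <= r & forall w, 0 < w -> exists2 psi, test_function U psi &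
   [/\ forall x, `|f x - psi x| <= w,
       forall x i, `|G x ord0 i - partial i psi x| <= w &
       forall x, r < `|x| -> f x = psi x /\ forall i, G x ord0 i = partial i psi x].
Proof.
move=> oU fG; have [cf dfG cG [K [cK KU K0]]] := fG.
have [r r0 Kr] := compact_bounded_rV cK.
exists (r + 1) => [|w w0]; first by rewrite addr_ge0.
have rK x : r < `|x| -> ~ K x by move=> + /Kr; rewrite ltNge => /negP.
have [d d0 dKU] := compact_open_margin oU cK KU.
have fv : vanishes_beyond r f by move=> x /rK/K0[].
have Gv i : vanishes_beyond r (fun x => G x ord0 i) by move=> x /rK/K0[_ ->]; rewrite mxE.
have [d1 d10 fd1] := cc_unif_continuous cf fv w0.
have /choice[dG dGP] (i : 'I_n) : exists dd, 0 < dd /\ forall x y, `|x - y| < dd ->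
     `|G x ord0 i - G y ord0 i| <= w.
  by have [dd dd0 h] := cc_unif_continuous (cG i) (Gv i) w0; exists dd.
pose dm := \big[Num.min/1]_i dG i.
have dm0 : 0 < dm by apply: lt_bigmin => // i _; exact: (dGP i).1.
(* 1 keeps the support within radius r + 1; d / 2 keeps its closure in U, the points of the closure
   being within 2 e of K; d1 and dm come from the uniform continuity of f and of G. *)
pose e := Num.min (Num.min 1 (d / 2)) (Num.min d1 dm).
have e0 : 0 < e by rewrite /e !lt_min ltr01 divr_gt0// d10 dm0.
have [rho br [rho0 re _ Ip]] := bumpN_exists n e0.
set I := \int[mu]_y rho y in Ip.
(* The mollifier is normalised by rescaling f, which leaves [rho] in the class [bumpN]. *)
pose h x := I^-1 * f x.
have ch : continuous h.
  by apply: continuous_mul => // x; exact: cst_continuous.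
have hv : vanishes_beyond r h by move=> x /fv fx; rewrite /h fx mulr0.
have dh x i : is_derive x (basis_vec R i) h (I^-1 * G x ord0 i).
  have := is_deriveZ I^-1 (dfG x i); exact.
have cdh i : continuous (fun x => I^-1 * G x ord0 i).
  by apply: continuous_mul => // x; exact: cst_continuous.
have hdv i : vanishes_beyond r (fun x => I^-1 * G x ord0 i).
  by move=> x /Gv ->; rewrite mulr0.
pose psi := convolution h rho.
have partialE i x : partial i psi x = convolution (fun x => I^-1 * G x ord0 i) rho x.
  rewrite -(conv_partial x ch hv (fun x => dh x i) (cdh i) (hdv i) e0 br).
  by rewrite /partial (derive_val (is_derive := is_derive_conv i x ch hv e0 br)).
have close (g : RN -> R) x : continuous g -> vanishes_beyond r g ->
    (forall y, `|x - y| < e -> `|g x - g y| <= w) ->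
    `|g x - convolution (fun x => I^-1 * g x) rho x| <= w.
  move=> cg gv gw.
  have gc : continuous (fun x => I^-1 * g x).
    by apply: continuous_mul => // y; exact: cst_continuous.
  have gv' : vanishes_beyond r (fun x => I^-1 * g x) by move=> y /gv ->; rewrite mulr0.
  have := @conv_close _ _ (fun x => I^-1 * g x) rho r e (I^-1 * w) x gc gv' e0 br rho0 re.
  rewrite -/I => H.
  have := H _; rewrite mulrAC mulVf ?gt_eqF// mul1r [X in _ <= X]mulrAC mulVf ?gt_eqF// mul1r; apply.
  move=> y xy; rewrite -mulrBr normrM gtr0_norm ?invr_gt0// ler_pM2l ?invr_gt0//.
  exact: gw.
have supp x : psi x != 0 -> exists2 y, K y & `|x - y| < e.
  move=> /(conv_support e0 br)[y hy xy]; exists y => //.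
  by apply: contrapT => /K0[fy _]; move: hy; rewrite /h fy mulr0 eqxx.
have supp' i x : convolution (fun x => I^-1 * G x ord0 i) rho x != 0 -> exists2 y, K y & `|x - y| < e.
  move=> /(conv_support e0 br)[y hy xy]; exists y => //.
  by apply: contrapT => /K0[_ Gy]; move: hy; rewrite Gy mxE mulr0 eqxx.
have e1 : e <= 1 by rewrite /e !ge_min lexx.
have ed : e <= d / 2 by rewrite /e !ge_min lexx orbT.
have eball x y : K y -> `|x - y| < e -> `|x| <= r + 1.
  by move=> /Kr yr xy; have := lerB_dist x y; lra.
exists psi.
  split; first exact: smooth_conv hv e0 br.
  have sub : closure [set x | psi x != 0] `<=` [set x | `|x| <= r + 1].
    have : closed [set x : RN | `|x| <= r + 1].
      rewrite (_ : mkset _ = (fun x : RN => `|x|) @^-1` [set t | t <= r + 1]) //.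
      by apply: (preimage_closed _ (@closed_le R _)) => x _; exact: norm_continuous.
    rewrite closure_id => ->; apply: closureS => x /supp[y Ky xy].
    exact: eball xy.
  split.
    apply: bounded_closed_compact; last exact: closed_closure.
    exists (r + 1); split => [|M rM x /sub]; first exact: num_real.
    by move=> /le_trans; apply; exact: ltW.
  move=> x /(_ (ball x e)) []; first exact: nbhsx_ballx.
  move=> z [/supp[y Ky zy]]; rewrite -ball_normE /ball_ /= => xz.
  apply: (dKU y) => //; rewrite distrC -(subrKA z); apply: le_lt_trans (ler_normD _ _) _; lra.
split.
- move=> x; apply: close => // y xy; apply: fd1; apply: lt_le_trans xy _.
  by rewrite /e !ge_min lexx !orbT.
- move=> x i; rewrite partialE; apply: (close (fun x => G x ord0 i)) => // y xy.
  apply: (dGP i).2; apply: lt_le_trans xy _.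
  rewrite /e !ge_min; apply/orP; right; apply/orP; right; exact: bigmin_le.
- move=> x xr; have zx : ~ exists2 y, K y & `|x - y| < e.
    by move=> [y Ky /(eball _ _ Ky)]; rewrite leNgt xr.
  split.
    rewrite fv; last lra.
    by apply/esym/eqP; apply: contrapT => /negP /supp.
  move=> i; rewrite (Gv i); last lra.
  by rewrite partialE; apply/esym/eqP; apply: contrapT => /negP /supp'.
Qed.

End compactly_supported_C1.

(** * Integrability of the truncated Gagliardo kernel *)

Section dyadic.
Variables (R : realType) (n : nat).
Local Notation RN := 'rV[R]_n.
Local Notation mu := (lebesgue_rV R n).

Lemma geometric_nneseries_le (c z : R) : 0 <= c -> 0 <= z < 1 ->
  (\sum_(j <oo) (c * z ^+ j)%:E <= (c / (1 - z))%:E)%E.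
Proof.
move=> c0 /andP[z0 z1]; apply: lime_le.
  by apply: is_cvg_nneseries => j _ _; rewrite lee_fin mulr_ge0// exprn_ge0.
apply: nearW => k; rewrite sumEFin lee_fin -mulr_sumr ler_wpM2l//.
rewrite big_mkord -[leRHS]mul1r ler_pdivlMr ?subr_gt0// mulrC.
have := subrX1 z k; rewrite -opprB -[z - 1]opprB mulNr => /oppr_inj <-.
by rewrite gerBl exprn_ge0.
Qed.

Lemma powRX (x b : R) j : 0 <= x -> (x ^+ j) `^ b = (x `^ b) ^+ j.
Proof.
by move=> x0; rewrite -powR_mulrn// -powRrM mulrC powRrM powR_mulrn ?powR_ge0.
Qed.

Lemma norm_le_enorm (x : RN) : `|x| <= enorm x.
Proof.
rewrite norm_rV_le ?sqrtr_ge0//; apply/forallP => i.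
rewrite /enorm -sqrtr_sqr ler_wsqrtr// /dot (bigD1 i)//= -expr2 lerDl.
by apply: sumr_ge0 => j _; rewrite -expr2 sqr_ge0.
Qed.

Lemma enormC (x y : RN) : enorm (x - y) = enorm (y - x).
Proof.
rewrite /enorm /dot; congr Num.sqrt; apply: eq_bigr => i _; rewrite !mxE.
by rewrite -[x _ _ - _]opprB mulrNN.
Qed.

Lemma measurable_rV_sub :
  measurable_fun setT (fun z : RN * RN => z.1 - z.2).
Proof.
apply: measurable_fun_rVP => i.
rewrite (_ : (fun _ => _) = (fun z : RN * RN => z.1 ord0 i - z.2 ord0 i)).
  by apply: measurable_funB; apply: measurableT_comp (measurable_coord i) _;
    [exact: measurable_fst|exact: measurable_snd].
by apply/funext => z; rewrite !mxE.
Qed.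

(* The Gagliardo kernel, with the singularity on the diagonal weakened by the
   factor |x - y|^b (sup norm) contributed by the regularity of the functions. *)
Definition trunc_kernel (s q b : R) (x y : RN) : R :=
  Num.min 1 `|x - y| `^ b * gagliardo_kernel s q x y.

Lemma gagliardo_kernel_ge0 (s q : R) (x y : RN) : 0 <= gagliardo_kernel s q x y.
Proof. by rewrite invr_ge0 powR_ge0. Qed.

Lemma gagliardo_kernelC (s q : R) (x y : RN) :
  gagliardo_kernel s q x y = gagliardo_kernel s q y x.
Proof. by rewrite /gagliardo_kernel enormC. Qed.

Lemma trunc_kernel_ge0 s q b x y : 0 <= trunc_kernel s q b x y.
Proof. by rewrite mulr_ge0 ?powR_ge0 ?gagliardo_kernel_ge0. Qed.

Lemma trunc_kernelC s q b x y : trunc_kernel s q b x y = trunc_kernel s q b y x.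
Proof. by rewrite /trunc_kernel distrC gagliardo_kernelC. Qed.

Lemma measurable_gagliardo_kernel (s q : R) :
  measurable_fun setT (fun z : RN * RN => gagliardo_kernel s q z.1 z.2).
Proof.
rewrite /gagliardo_kernel; under eq_fun do rewrite -powRN.
apply: (measurableT_comp (measurable_powR _)).
apply: (@measurableT_comp _ _ _ _ _ _ (fun x : RN => enorm x)).
  by apply: measurable_enorm => i; exact: measurable_coord.
exact: measurable_rV_sub.
Qed.

Lemma measurable_trunc_kernel (s q b : R) :
  measurable_fun setT (fun z : RN * RN => trunc_kernel s q b z.1 z.2).
Proof.
apply: measurable_funM; last exact: measurable_gagliardo_kernel.
apply: (measurableT_comp (measurable_powR b)).
apply: (@measurableT_comp _ _ _ _ _ _ (fun x : RN => Num.min 1 `|x|)).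
  apply: measurable_minr; first exact: measurable_cst.
  by apply: continuous_measurable_rV; exact: norm_continuous.
exact: measurable_rV_sub.
Qed.

Lemma pow2_dyadic (r : R) : 0 < r -> r <= 1 ->
  exists j, 2^-1 ^+ j.+1 < r <= 2^-1 ^+ j.
Proof.
move=> r0 r1; have ex : exists j, 2^-1 ^+ j.+1 < r.
  have : (fun j => 2^-1 ^+ j : R) @ \oo --> (0 : R).
    by apply: cvg_expr; rewrite ger0_norm// invf_lt1// ltr1n.
  move=> /cvgr_lt /(_ _ r0)[k _ /(_ k.+1)] /= H.
  by exists k; apply: H => /=.
exists (ex_minn ex); case: ex_minnP => -[|j] -> hj; first by rewrite expr0 r1.
by rewrite /= leNgt; apply/negP => /hj; rewrite ltnn.
Qed.

Lemma pow2_dyadic_ge1 (r : R) : 1 <= r ->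
  exists j, 2 ^+ j <= r <= 2 ^+ j.+1.
Proof.
move=> r1; have r0 : 0 < r^-1 by rewrite invr_gt0 (lt_le_trans ltr01).
have [|j] := pow2_dyadic r0; first by rewrite invf_le1// (lt_le_trans ltr01).
rewrite !exprVn ltf_pV2 ?lef_pV2 ?posrE ?exprn_gt0// ?(lt_le_trans ltr01)//.
by move=> /andP[h1 h2]; exists j; rewrite h2 ltW.
Qed.

(** A majorant of the kernel on the shell |x - y| ~ 2^-j (first summand) and on the shell |x - y| ~
    2^j (second one). The indicators are those of full cubes, whose volume is known. *)
Definition dyadic_term (s q b : R) (x : RN) (j : nat) (y : RN) : R :=
  (2^-1 ^+ j) `^ b * ((2^-1 ^+ j.+1) `^ (n%:R + s * q))^-1 *
    \1_[set y | `|y - x| <= 2^-1 ^+ j] y +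
  ((2 ^+ j) `^ (n%:R + s * q))^-1 * \1_[set y | `|y - x| <= 2 ^+ j.+1] y.

Lemma trunc_kernel_le_dyadic s q b x y : 0 < s * q -> 0 <= b -> exists j,
  trunc_kernel s q b x y <= dyadic_term s q b x j y.
Proof.
move=> sq0 b0; set r := `|x - y|.
have sg0 : 0 < n%:R + s * q by rewrite ltr_wpDl.
have t0 j : 0 <= dyadic_term s q b x j y.
  by rewrite addr_ge0 ?mulr_ge0 ?invr_ge0 ?powR_ge0.
(* On the diagonal the kernel is 0, by the convention that the inverse of 0 is 0. *)
have [r0|r0] := eqVneq r 0.
  exists 0%N; apply: le_trans (t0 _).
  have /eqP : r == 0 by exact/eqP.
  move/normr0_eq0 => xy; rewrite /trunc_kernel /gagliardo_kernel xy.
  have -> : enorm (0 : RN) = 0.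
    by rewrite /enorm /dot big1 ?sqrtr0// => i _; rewrite mxE mul0r.
  by rewrite powR0 ?gt_eqF// invr0 mulr0.
have {}r0 : 0 < r by rewrite lt_neqAle eq_sym r0 normr_ge0.
have er : 0 < enorm (x - y) by apply: lt_le_trans r0 (norm_le_enorm _).
have gk t : 0 < t -> t <= r -> gagliardo_kernel s q x y <= (t `^ (n%:R + s * q))^-1.
  move=> tp tr; rewrite lef_pV2 ?posrE ?powR_gt0//.
  apply: ge0_ler_powR; rewrite ?nnegrE; [exact: ltW|exact: ltW|exact: ltW|].
  exact: le_trans tr (norm_le_enorm _).
have [r1|r1] := leP r 1.
  have [j /andP[jr rj]] := pow2_dyadic r0 r1; exists j.
  rewrite /dyadic_term indicE mem_set/= 1?distrC// mulr1.
  apply: (@le_trans _ _ ((2^-1 ^+ j) `^ b * ((2^-1 ^+ j.+1) `^ (n%:R + s * q))^-1)); last first.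
    by rewrite lerDl mulr_ge0 ?invr_ge0 ?powR_ge0.
  rewrite /trunc_kernel -/r (min_idPr r1) ler_pM ?powR_ge0 ?gagliardo_kernel_ge0//.
    by apply: ge0_ler_powR => //; rewrite nnegrE ?exprn_ge0 ?invr_ge0// ltW.
  by apply: gk; [rewrite exprn_gt0// invr_gt0|exact: ltW].
have [j /andP[jr rj]] := pow2_dyadic_ge1 (ltW r1); exists j.
rewrite /dyadic_term [X in _ + _ * X]indicE mem_set/= 1?distrC// mulr1.
apply: (@le_trans _ _ (((2 ^+ j) `^ (n%:R + s * q))^-1)); last first.
  by rewrite lerDr !mulr_ge0 ?invr_ge0 ?powR_ge0.
rewrite /trunc_kernel -/r (min_idPl (ltW r1)) powR1 mul1r.
by apply: gk; rewrite ?exprn_gt0.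
Qed.

(** Summing the dyadic majorants, with cubes of volume (2 r)^n, gives two geometric series. Short
    distances have ratio [z1] = 2^-(b - s q), which needs s q < b; long distances have ratio [z2] =
    2^-(s q), which needs s q > 0. *)
Lemma integral_trunc_kernel s q b : 0 < s * q -> s * q < b ->
  exists2 C, 0 <= C & forall x : RN,
    (\int[mu]_y (trunc_kernel s q b x y)%:E <= C%:E)%E.
Proof.
move=> sq0 sqb; have b0 : 0 <= b by apply: ltW; exact: lt_trans sqb.
set sg := n%:R + s * q.
pose z1 : R := 2^-1 `^ (b - s * q); pose z2 : R := 2^-1 `^ (s * q).
have h01 : 0 < (2^-1 : R) < 1 by rewrite invr_gt0 ltr0n invf_lt1// ltr1n.
have z01 e : 0 < e -> 0 <= (2^-1 : R) `^ e < 1.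
  have h1 : (1 : R) `^ e = 1 by rewrite powR1.
  move=> e0; rewrite powR_ge0 /= -[ltRHS]h1 gt0_ltr_powR// ?nnegrE//; lra.
pose c1 : R := 2 `^ sg * 2 ^+ n; pose c2 : R := 4 ^+ n.
have c10 : 0 <= c1 by rewrite mulr_ge0 ?powR_ge0 ?exprn_ge0.
have c20 : 0 <= c2 by rewrite exprn_ge0.
have geo0 c z : 0 <= c -> 0 <= z < 1 -> 0 <= c / (1 - z).
  by move=> c0 /andP[_ z1']; rewrite divr_ge0// subr_ge0 ltW.
exists (c1 / (1 - z1) + c2 / (1 - z2)).
  by rewrite addr_ge0// geo0// z01// subr_gt0.
move=> x.
have mt j : measurable_fun setT (fun y => (dyadic_term s q b x j y)%:E).
  apply/measurable_EFinP; apply: measurable_funD; apply: measurable_funM;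
    try exact: measurable_cst; apply: measurable_indic; exact: measurable_cube.
have t0 j y : 0 <= dyadic_term s q b x j y.
  by rewrite addr_ge0 ?mulr_ge0 ?invr_ge0 ?powR_ge0.
have mk : measurable_fun setT (fun y => (trunc_kernel s q b x y)%:E).
  apply/measurable_EFinP.
  exact: (measurableT_comp (measurable_trunc_kernel s q b) (pair1_measurable x)).
apply: (@le_trans _ _ (\int[mu]_y (\sum_(j <oo) (dyadic_term s q b x j y)%:E))%E).
  apply: ge0_le_integral => //.
  - by move=> y _; rewrite lee_fin trunc_kernel_ge0.
  - by apply: ge0_emeasurable_sum => // j y _ _; rewrite lee_fin.
  move=> y _; have [j hj] := trunc_kernel_le_dyadic x y sq0 b0.
  apply: (@le_trans _ _ (dyadic_term s q b x j y)%:E); first by rewrite lee_fin.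
  apply: le_trans (nneseries_lim_ge j.+1 _); last by move=> k _ _; rewrite lee_fin.
  rewrite big_nat_recr//= leeDr// sume_ge0// => k _; by rewrite lee_fin.
rewrite integral_nneseries//; last by move=> j y _; rewrite lee_fin.
have tE j : (\int[mu]_y (dyadic_term s q b x j y)%:E = (c1 * z1 ^+ j + c2 * z2 ^+ j)%:E)%E.
  have box (c r : R) : 0 <= c -> 0 <= r -> 
     (\int[mu]_y (c * \1_[set y : RN | `|y - x| <= r] y)%:E = (c * (r *+ 2) ^+ n)%:E)%E.
    move=> c0 r0; under eq_integral do rewrite EFinM.
    rewrite ge0_integralZl_EFin//; last first.
    - by apply/measurable_EFinP; apply: measurable_indic; exact: measurable_cube.
    rewrite integral_indic//; last exact: measurable_cube.
    by rewrite setIT EFinM -(lebesgue_rV_cube x r0).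
  under eq_integral do rewrite EFinD.
  rewrite ge0_integralD//.
  - rewrite !box ?mulr_ge0 ?invr_ge0 ?powR_ge0 ?exprn_ge0//.
    rewrite -EFinD; congr (_ + _)%:E.
      have hs : (2^-1 : R) `^ sg = (2 `^ sg)^-1.
        by rewrite -[2^-1]powR_inv1// -powRrM mulN1r powRN.
      have z1E : z1 = (2^-1) `^ b * 2 `^ sg * 2^-1 ^+ n.
        rewrite -[2 `^ sg]invrK -hs -powRN -powR_mulrn ?invr_ge0// -!powRD;
          try by apply/implyP => _; lra.
        by rewrite /z1; congr (_ `^ _); rewrite /sg; ring.
      rewrite !powRX ?invr_ge0// hs z1E /c1 -exprVn invrK -[_ ^+ j *+ 2]mulr_natr.
      by rewrite exprS !exprMn -!exprM [(n * j)%N]mulnC; ring.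
    have hs : (2^-1 : R) `^ (s * q) = (2 `^ (s * q))^-1.
      by rewrite -[2^-1]powR_inv1// -powRrM mulN1r powRN.
    have z2E : z2 = (2 `^ sg)^-1 * 2 ^+ n.
      rewrite /z2 hs -!powRN -powR_mulrn// -powRD; last by apply/implyP => _; lra.
      by congr (_ `^ _); rewrite /sg; ring.
    rewrite !powRX// z2E /c2 -exprVn -[_ ^+ j.+1 *+ 2]mulr_natr.
    have -> : (4 : R) = 2 * 2 by ring.
    rewrite exprS !exprMn -!exprM [(n * j)%N]mulnC; ring.
  - apply/measurable_EFinP; apply: measurable_funM; first exact: measurable_cst.
    apply: measurable_indic; exact: measurable_cube.
  - apply/measurable_EFinP; apply: measurable_funM; first exact: measurable_cst.
    apply: measurable_indic; exact: measurable_cube.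
under eq_eseriesr do rewrite tE EFinD.
rewrite nneseriesD; try by move=> j _ _; rewrite lee_fin mulr_ge0// exprn_ge0// powR_ge0.
rewrite EFinD leeD//; apply: geometric_nneseries_le => //; apply: z01 => //; lra.
Qed.

End dyadic.

Lemma ge0_integral_scale d (T : measurableType d) (R : realType)
    (m : {measure set T -> \bar R}) (D : set T) (k : R) (f : T -> R) :
  measurable D -> measurable_fun D f -> (forall x, 0 <= f x) -> 0 <= k ->
  (\int[m]_(x in D) (k * f x)%:E = k%:E * \int[m]_(x in D) (f x)%:E)%E.
Proof.
move=> mD mf f0 k0; under eq_integral do rewrite EFinM.
apply: ge0_integralZl_EFin => //; first by move=> x _; rewrite lee_fin.
exact/measurable_EFinP.
Qed.

(** * Compactly supported C^1 functions are admissible test functions *)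

Section test_space.
Variables (R : realType) (n : nat).
Local Notation RN := 'rV[R]_n.
Local Notation mu := (lebesgue_rV R n).
Implicit Types (f : RN -> R) (G : RN -> RN) (U : set RN).

Lemma weighted_kernel_le1 s q b C (F : RN -> R) :
  (forall x : RN, (\int[mu]_y (trunc_kernel s q b x y)%:E <= C%:E)%E) -> 0 <= C ->
  measurable_fun setT F -> (forall x, 0 <= F x) ->
  (\int[(mu \x mu)%E]_z (F z.1 * trunc_kernel s q b z.1 z.2)%:E <=
   C%:E * \int[mu]_x (F x)%:E)%E.
Proof.
move=> kC C0 mF F0.
have mk := @measurable_trunc_kernel R n s q b.
rewrite fubini_tonelli1; first last.
- by move=> z; rewrite lee_fin mulr_ge0 ?trunc_kernel_ge0.
- apply/measurable_EFinP; apply: measurable_funM => //.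
  exact: measurableT_comp mF measurable_fst.
rewrite -ge0_integral_scale//.
apply: ge0_le_integral => //.
- move=> x _; apply: integral_ge0 => y _.
  by rewrite lee_fin mulr_ge0 ?trunc_kernel_ge0.
- apply: measurable_fun_fubini_tonelli_F => //.
  + apply/measurable_EFinP; apply: measurable_funM => //.
    exact: measurableT_comp mF measurable_fst.
  + by move=> z; rewrite lee_fin mulr_ge0 ?trunc_kernel_ge0.
- by apply/measurable_EFinP; apply: measurable_funM => //; exact: measurable_cst.
move=> x _; rewrite /fubini_F /= ge0_integral_scale//; first last.
- by move=> y; exact: trunc_kernel_ge0.
- exact: (measurableT_comp mk (pair1_measurable x)).
by rewrite EFinM muleC lee_wpmul2r ?lee_fin.
Qed.

Lemma weighted_kernel_le2 s q b C (F : RN -> R) :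
  (forall x : RN, (\int[mu]_y (trunc_kernel s q b x y)%:E <= C%:E)%E) -> 0 <= C ->
  measurable_fun setT F -> (forall x, 0 <= F x) ->
  (\int[(mu \x mu)%E]_z (F z.2 * trunc_kernel s q b z.1 z.2)%:E <=
   C%:E * \int[mu]_x (F x)%:E)%E.
Proof.
move=> kC C0 mF F0.
apply: le_trans (weighted_kernel_le1 kC C0 mF F0).
have mk := @measurable_trunc_kernel R n s q b.
rewrite fubini_tonelli2; first last.
- by move=> z; rewrite lee_fin mulr_ge0 ?trunc_kernel_ge0.
- apply/measurable_EFinP; apply: measurable_funM => //.
  exact: measurableT_comp mF measurable_snd.
rewrite fubini_tonelli1; first last.
- by move=> z; rewrite lee_fin mulr_ge0 ?trunc_kernel_ge0.
- apply/measurable_EFinP; apply: measurable_funM => //.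
  exact: measurableT_comp mF measurable_fst.
rewrite le_eqVlt; apply/orP; left; apply/eqP; apply: eq_integral => x _.
by apply: eq_integral => y _ /=; rewrite trunc_kernelC.
Qed.

(** The minimum with 1 joins the Lipschitz bound at short range to boundedness at long range, which
    is the shape of [trunc_kernel]. *)
Lemma C1c_lipschitz U f G : C1c U f G ->
  exists2 L, 0 <= L & forall x y, `|f x - f y| <= L * Num.min 1 `|x - y|.
Proof.
move=> [cf dfG cG [K [cK KU K0]]].
have [r r0 Kr] := compact_bounded_rV cK.
have rK x : r < `|x| -> ~ K x by move=> + /Kr; rewrite ltNge => /negP.
have fv : vanishes_beyond r f by move=> x /rK/K0[].
have Gv i : vanishes_beyond r (fun x => G x ord0 i) by move=> x /rK/K0[_ ->]; rewrite mxE.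
have [C C0 fC] := vanishes_beyond_bounded cf fv.
have /choice[B hB] i : exists B, 0 <= B /\ forall x, `|G x ord0 i| <= B.
  by have [B B0 h] := vanishes_beyond_bounded (cG i) (Gv i); exists B.
pose L1 := \sum_i B i.
have L10 : 0 <= L1 by apply: sumr_ge0 => i _; exact: (hB i).1.
have GL x i : `|G x ord0 i| <= L1.
  apply: le_trans ((hB i).2 x) _; rewrite /L1 (bigD1 i)//= lerDl.
  by apply: sumr_ge0 => j _; exact: (hB j).1.
exists (n%:R * L1 + (C + C)); first by rewrite !addr_ge0 ?mulr_ge0.
move=> x y; have [xy|xy] := leP 1 `|x - y|.
  rewrite mulr1; apply: le_trans (ler_normB _ _) _.
  by rewrite ler_wpDl ?mulr_ge0// lerD.
apply: (@le_trans _ _ (n%:R * L1 * `|x - y|)); last first.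
  by rewrite ler_wpM2r// lerDl addr_ge0.
by apply: (@cube_lipschitz _ _ f G 0 (`|x| + `|y|) L1);
  rewrite ?subr0 ?lerDl ?lerDr ?addr_ge0.
Qed.

(** The difference f x - f y is nonzero only if x or y lies in a fixed cube, and its q-th power
    supplies the factor min(1, |x - y|)^q. The truncated kernel with b = q > s q is integrable. *)
Lemma C1c_W0sq s q U f G : 0 < s * q -> s * q < q -> C1c U f G -> W0sq s q U f.
Proof.
move=> sq0 sqq fG; have [cf dfG cG [K [cK KU K0]]] := fG.
have q0 : 0 < q by exact: lt_trans sqq.
have [r r0 Kr] := compact_bounded_rV cK.
have rK x : r < `|x| -> ~ K x by move=> + /Kr; rewrite ltNge => /negP.
have fv : vanishes_beyond r f by move=> x /rK/K0[].
have [L L0 fL] := C1c_lipschitz fG.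
have mf := continuous_measurable_rV cf.
split; last first.
  by apply: aeW => x Ux; apply: (K0 x _).1 => /KU.
split; first exact: Lp_cc fv.
have [C C0 kC] := @integral_trunc_kernel R n s q q sq0 sqq.
pose F (x : RN) : R := L `^ q * \1_[set x : RN | `|x - 0| <= r] x.
have mF : measurable_fun setT F.
  apply: measurable_funM; first exact: measurable_cst.
  apply: measurable_indic; exact: measurable_cube.
have F0 x : 0 <= F x by rewrite mulr_ge0 ?powR_ge0.
have Fin x : `|x| <= r -> F x = L `^ q.
  by move=> xr; rewrite /F indicE mem_set ?mulr1//= subr0.
have Fout x : r < `|x| -> F x = 0.
  move=> xr; rewrite /F indicE memNset ?mulr0//= subr0.
  by apply/negP; rewrite -ltNge.
have mk := @measurable_trunc_kernel R n s q q.
have m1 : measurable_fun setT (fun z : RN * RN => F z.1 * trunc_kernel s q q z.1 z.2).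
  by apply: measurable_funM => //; exact: measurableT_comp mF measurable_fst.
have m2 : measurable_fun setT (fun z : RN * RN => F z.2 * trunc_kernel s q q z.1 z.2).
  by apply: measurable_funM => //; exact: measurableT_comp mF measurable_snd.
have Foo : (\int[mu]_x (F x)%:E < +oo)%E.
  rewrite ge0_integral_scale ?powR_ge0//; last first.
    by apply: measurable_indic; exact: measurable_cube.
  rewrite integral_indic//; last exact: measurable_cube.
  have muoo : (mu [set x : RN | (`|x - 0| <= r)%R] < +oo)%E by rewrite lebesgue_rV_cube// ltry.
  by rewrite setIT; apply: lte_mul_pinfty; rewrite ?lee_fin ?powR_ge0//; exact: muoo.
rewrite setXTT.
apply: (@le_lt_trans _ _ (\int[(mu \x mu)%E]_z
   ((F z.1 * trunc_kernel s q q z.1 z.2)%:E + (F z.2 * trunc_kernel s q q z.1 z.2)%:E))%E).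
  apply: ge0_le_integral => //.
  - by move=> z _; rewrite lee_fin mulr_ge0 ?powR_ge0 ?gagliardo_kernel_ge0.
  - apply/measurable_EFinP; apply: measurable_funM; last exact: measurable_gagliardo_kernel.
    apply: (measurableT_comp (measurable_powR q)).
    apply: measurableT_comp => //; apply: measurable_funB.
      exact: measurableT_comp mf measurable_fst.
    exact: measurableT_comp mf measurable_snd.
  - by apply: emeasurable_funD; exact/measurable_EFinP.
  move=> [x y] _ /=; rewrite -EFinD lee_fin -mulrDl /trunc_kernel mulrA.
  rewrite ler_wpM2r ?gagliardo_kernel_ge0//.
  have m0 : 0 <= Num.min 1 `|x - y| by rewrite le_min ler01 normr_ge0.
  have [xr|xr] := leP `|x| r; last first.
    have [yr|yr] := leP `|y| r; last first.
      by rewrite !fv// subrr normr0 powR0 ?gt_eqF// mulr_ge0 ?addr_ge0 ?powR_ge0.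
    rewrite Fout// Fin// add0r.
    by rewrite -powRM//; apply: ge0_ler_powR; rewrite ?nnegrE ?(ltW q0) ?mulr_ge0.
  apply: (@le_trans _ _ (L `^ q * Num.min 1 `|x - y| `^ q)).
    by rewrite -powRM//; apply: ge0_ler_powR; rewrite ?nnegrE ?(ltW q0) ?mulr_ge0.
  by rewrite ler_wpM2r ?powR_ge0// (Fin x)// lerDl.
rewrite ge0_integralD//; try exact/measurable_EFinP;
  try by move=> z _; rewrite lee_fin mulr_ge0 ?trunc_kernel_ge0.
apply: lte_add_pinfty.
  apply: le_lt_trans (weighted_kernel_le1 kC C0 mF F0) _.
  by apply: lte_mul_pinfty; rewrite ?lee_fin//.
apply: le_lt_trans (weighted_kernel_le2 kC C0 mF F0) _.
by apply: lte_mul_pinfty; rewrite ?lee_fin//.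
Qed.

Lemma integral_cube_le U (h : RN -> R) (r c : R) : measurable U -> measurable_fun setT h ->
  (forall x, 0 <= h x) -> 0 <= r -> (forall x, h x <= c) -> (forall x, r < `|x| -> h x = 0) ->
  (\int[mu]_(x in U) (h x)%:E <= (c * (r *+ 2) ^+ n)%:E)%E.
Proof.
move=> mU mh h0 r0 hc hv; have c0 : 0 <= c by exact: le_trans (h0 0) (hc 0).
apply: (@le_trans _ _ (\int[mu]_x (h x)%:E)%E).
  apply: ge0_subset_integral => //; first exact/measurable_EFinP.
  by move=> x _; rewrite lee_fin.
have mi : measurable_fun setT (\1_[set x : RN | `|x - 0| <= r] : RN -> R).
  by apply: measurable_indic; exact: measurable_cube.
apply: (@le_trans _ _ (\int[mu]_x (c * \1_[set x : RN | `|x - 0| <= r] x)%:E)%E).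
  apply: ge0_le_integral => //.
  - by move=> x _; rewrite lee_fin.
  - exact/measurable_EFinP.
  - by apply/measurable_EFinP; apply: measurable_funM => //; exact: measurable_cst.
  move=> x _; rewrite lee_fin indicE; case: (boolP (x \in _)) => [xr|xr].
    by rewrite mulr1.
  rewrite mulr0 hv// ltNge; apply: contra xr => xr; by rewrite inE /= subr0.
rewrite ge0_integral_scale//.
rewrite integral_indic//; last exact: measurable_cube.
by rewrite setIT EFinM -(lebesgue_rV_cube (0 : RN) r0).
Qed.

Lemma C1c_W01p p U f G : 1 < p -> open U -> C1c U f G -> W01p p U f.
Proof.
move=> p1 oU fG; have [cf dfG cG [K [cK KU K0]]] := fG.
have p0 : 0 < p by exact: lt_trans p1.
have mU := open_measurable_rV oU.
split.
- by apply: aeW => x Ux; apply: (K0 x _).1 => /KU.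
- exact: C1c_W1p fG.
exists G; first exact: C1c_weak_gradient.
have [r r0 approx] := C1c_approx oU fG.
move=> e e0.
(* On a cube of volume (2 r)^n the function is off by at most w and its gradient by at most n w, so
   the two integrals add up to at most w^p A. Then w is fixed by w^p (A + 1) = e^p, the 1 making the
   final inequality strict. *)
pose A : R := (1 + n%:R `^ p) * (r *+ 2) ^+ n.
have A0 : 0 <= A by rewrite mulr_ge0 ?addr_ge0 ?powR_ge0// exprn_ge0// mulrn_wge0.
have A1 : 0 < A + 1 by rewrite ltr_wpDl.
pose w := e * (A + 1) `^ (- p^-1).
have w0 : 0 < w by rewrite mulr_gt0// powR_gt0.
have wp : w `^ p * (A + 1) = e `^ p.
  rewrite /w powRM ?powR_ge0 ?ltW// -powRrM mulNr mulVf ?gt_eqF//.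
  by rewrite powR_inv1 ?ltW// -mulrA mulVf ?mulr1// gt_eqF.
clearbody w.
have [psi tpsi [fw Gw out]] := approx w w0; exists psi => //.
have cpsi : continuous psi by have [h _] := tpsi; have [] := h [::].
have cdpsi i : continuous (partial i psi) by have [h _] := tpsi; have [] := h [:: i].
have gE x i : (G x - grad psi x) ord0 i = G x ord0 i - partial i psi x.
  by rewrite !mxE.
have m1 : measurable_fun setT (fun x => `|f x - psi x| `^ p).
  apply: (measurableT_comp (measurable_powR p)); apply: continuous_measurable_rV.
  by apply: continuous_normr; exact: continuous_sub.
have m2 : measurable_fun setT (fun x => enorm (G x - grad psi x) `^ p).
  apply: (measurableT_comp (measurable_powR p)); apply: measurable_enorm => i.
  under eq_fun do rewrite gE.
  by apply: continuous_measurable_rV; exact: continuous_sub.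
have h1 : (\int[mu]_(x in U) (`|f x - psi x| `^ p)%:E <= (w `^ p * (r *+ 2) ^+ n)%:E)%E.
  apply: integral_cube_le => //.
  - by move=> x; apply: ge0_ler_powR; rewrite ?nnegrE ?(ltW p0) ?(ltW w0).
  - by move=> x /out[-> _]; rewrite subrr normr0 powR0// gt_eqF.
have h2 : (\int[mu]_(x in U) (enorm (G x - grad psi x) `^ p)%:E <=
   (n%:R `^ p * w `^ p * (r *+ 2) ^+ n)%:E)%E.
  apply: integral_cube_le => //.
  - by move=> x; exact: powR_ge0.
  - move=> x; rewrite -powRM ?(ltW w0)//; apply: ge0_ler_powR;
      rewrite ?nnegrE ?sqrtr_ge0 ?mulr_ge0 ?(ltW p0) ?(ltW w0)//.
    apply: le_trans (enorm_le _) _; rewrite ler_wpM2l// norm_rV_le ?(ltW w0)//.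
    by apply/forallP => i; rewrite gE.
  - move=> x /out[_ Gx]; have -> : G x - grad psi x = 0.
      by apply/rowP => i; rewrite gE Gx subrr mxE.
    have -> : enorm (0 : RN) = 0.
      by rewrite /enorm /dot big1 ?sqrtr0// => i _; rewrite mxE mul0r.
    by rewrite powR0// gt_eqF.
rewrite /W1p_norm.
apply: (@le_lt_trans _ _ ((w `^ p * A)%:E `^ p^-1)%E).
  apply: gt0_ler_poweR; first by rewrite invr_ge0 ltW.
  - rewrite in_itv /= leey andbT; apply: adde_ge0;
      by apply: integral_ge0 => x _; rewrite lee_fin powR_ge0.
  - by rewrite in_itv /= leey andbT lee_fin mulr_ge0 ?powR_ge0.
  apply: le_trans (leeD h1 h2) _; rewrite -EFinD lee_fin /A.
  by rewrite le_eqVlt; apply/orP; left; apply/eqP; ring.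
rewrite poweR_EFin lte_fin.
have eE : (e `^ p) `^ p^-1 = e.
  by rewrite -powRrM mulfV ?gt_eqF// powRr1// ltW.
rewrite -[ltRHS]eE.
apply: gt0_ltr_powR; rewrite ?nnegrE ?invr_gt0 ?(mulr_ge0 (powR_ge0 _ _) A0) ?powR_ge0//.
by rewrite -wp ltr_pM2l ?powR_gt0// ltrDl.
Qed.

End test_space.

(** * Monotonicity and Hoelder continuity of |a|^(p-2) a *)

Section vector_inequalities.
Variables (R : realType) (n : nat).
Local Notation RN := 'rV[R]_n.
Implicit Types x y z : RN.

Lemma dotC x y : dot x y = dot y x.
Proof. by apply: eq_bigr => i _; rewrite mulrC. Qed.

Lemma dotDl x y z : dot (x + y) z = dot x z + dot y z.
Proof. by rewrite -big_split; apply: eq_bigr => i _; rewrite mxE mulrDl. Qed.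

Lemma dotZl a x z : dot (a *: x) z = a * dot x z.
Proof. by rewrite /dot mulr_sumr; apply: eq_bigr => i _; rewrite mxE mulrA. Qed.

Lemma dotNl x z : dot (- x) z = - dot x z.
Proof. by rewrite -scaleN1r dotZl mulN1r. Qed.

Lemma dotBl x y z : dot (x - y) z = dot x z - dot y z.
Proof. by rewrite dotDl dotNl. Qed.

Lemma dotBr x y z : dot z (x - y) = dot z x - dot z y.
Proof. by rewrite dotC dotBl ![dot _ z]dotC. Qed.

Lemma dotZr a x z : dot z (a *: x) = a * dot z x.
Proof. by rewrite dotC dotZl dotC. Qed.

Lemma dotDr x y z : dot z (x + y) = dot z x + dot z y.
Proof. by rewrite dotC dotDl ![dot _ z]dotC. Qed.

Lemma dot_ge0 x : 0 <= dot x x.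
Proof. by apply: sumr_ge0 => i _; rewrite -expr2 sqr_ge0. Qed.

Lemma enorm_ge0 x : 0 <= enorm x.
Proof. exact: sqrtr_ge0. Qed.

Lemma enorm_sqr x : enorm x ^+ 2 = dot x x.
Proof. by rewrite sqr_sqrtr// dot_ge0. Qed.

Lemma enorm_eq0 x : enorm x = 0 -> x = 0.
Proof.
move=> x0; have : dot x x = 0 by rewrite -enorm_sqr x0 expr0n.
move=> h; apply/rowP => i; rewrite mxE; apply/eqP.
move: h => /eqP; rewrite /dot psumr_eq0 => [|j _]; last by rewrite -expr2 sqr_ge0.
by move=> /allP/(_ i (mem_index_enum _))/=; rewrite mulf_eq0 orbb.
Qed.

(** Cauchy-Schwarz, by expanding the square of the norm of [enorm y *: x - enorm x *: y]. *)
Lemma dot_le_enorm x y : dot x y <= enorm x * enorm y.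
Proof.
have [x0|x0] := eqVneq (enorm x) 0.
  rewrite x0 mul0r (enorm_eq0 x0) /dot big1// => i _; by rewrite mxE mul0r.
have [y0|y0] := eqVneq (enorm y) 0.
  rewrite y0 mulr0 (enorm_eq0 y0) /dot big1// => i _; by rewrite mxE mulr0.
have xp : 0 < enorm x by rewrite lt_neqAle eq_sym x0 enorm_ge0.
have yp : 0 < enorm y by rewrite lt_neqAle eq_sym y0 enorm_ge0.
have := dot_ge0 (enorm y *: x - enorm x *: y).
rewrite dotBl !dotBr !dotZl !dotZr -!enorm_sqr [dot y x]dotC => h.
have xy : 0 < enorm x * enorm y by rewrite mulr_gt0.
rewrite -(ler_pM2l xy) -subr_ge0.
have -> : enorm x * enorm y * (enorm x * enorm y) - enorm x * enorm y * dot x y =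
  (enorm y * (enorm y * enorm x ^+ 2) - enorm y * (enorm x * dot x y)
   - (enorm x * (enorm y * dot x y) - enorm x * (enorm x * enorm y ^+ 2))) / 2 by field.
by rewrite divr_ge0.
Qed.

Lemma enormZ a x : enorm (a *: x) = `|a| * enorm x.
Proof.
by rewrite /enorm dotZl dotZr mulrA -expr2 sqrtrM ?sqr_ge0// sqrtr_sqr.
Qed.

Lemma enormN x : enorm (- x) = enorm x.
Proof. by rewrite -scaleN1r enormZ normrN1 mul1r. Qed.

Lemma enormD x y : enorm (x + y) <= enorm x + enorm y.
Proof.
rewrite -(ler_pXn2r (_ : (0 < 2)%N))// ?nnegrE ?addr_ge0 ?enorm_ge0//.
rewrite enorm_sqr dotDl !dotDr -!enorm_sqr [dot y x]dotC.
have := dot_le_enorm x y; nra.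
Qed.

Lemma norm_dot_le x y : `|dot x y| <= enorm x * enorm y.
Proof.
rewrite ler_norml dot_le_enorm andbT lerNl -dotNl -(enormN x).
exact: dot_le_enorm.
Qed.

(** At r = 0, where [0 ^ 0] is 1, the factor r kills the left side and 1 < p the right one. *)
Lemma mulr_powRB2 (r p : R) : 0 <= r -> 1 < p -> r `^ (p - 2) * r = r `^ (p - 1).
Proof.
move=> r0 p1; have [->|rn] := eqVneq r 0.
  by rewrite mulr0 powR0//; rewrite subr_eq0 gt_eqF.
rewrite -{2}(powRr1 r0) -powRD; last by rewrite rn implybT.
by congr (_ `^ _); ring.
Qed.

(** With r = |x| and t = |y| the expression equals (r - t)(r^(p-1) - t^(p-1)) + (r^(p-2) +
    t^(p-2))(r t - x.y). Both terms are nonnegative, whether p is below or above 2. *)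
Lemma plaplacian_monotone (p : R) x y : 1 < p ->
  0 <= enorm x `^ (p - 2) * dot x (x - y) - enorm y `^ (p - 2) * dot y (x - y).
Proof.
move=> p1; rewrite !dotBr -!enorm_sqr [dot y x]dotC.
set r := enorm x; set t := enorm y.
have r0 : 0 <= r by exact: enorm_ge0. have t0 : 0 <= t by exact: enorm_ge0.
have dxy : dot x y <= r * t := dot_le_enorm x y.
have H : 0 <= (r - t) * (r `^ (p - 1) - t `^ (p - 1)).
  have pp : 0 <= p - 1 by rewrite subr_ge0 ltW.
  have [rt|tr] := leP r t.
    by rewrite mulr_le0// subr_le0//; apply: ge0_ler_powR => //; rewrite nnegrE.
  by rewrite mulr_ge0// subr_ge0 ?(ltW tr)//; apply: ge0_ler_powR => //; rewrite ?nnegrE// ltW.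
rewrite -!mulr_powRB2// in H.
apply: le_trans H _.
have h1 := powR_ge0 r (p - 2); have h2 := powR_ge0 t (p - 2).
rewrite -subr_ge0.
have -> : r `^ (p - 2) * (r ^+ 2 - dot x y) - t `^ (p - 2) * (dot x y - t ^+ 2) -
  (r - t) * (r `^ (p - 2) * r - t `^ (p - 2) * t) =
  (r `^ (p - 2) + t `^ (p - 2)) * (r * t - dot x y) by ring.
by apply: mulr_ge0; [exact: addr_ge0|rewrite subr_ge0].
Qed.

(** By homogeneity it is enough to show |1 - z^(p-2)| z <= m (1 - z) for z = t / r <= 1. For p >= 2
    one compares with 1 - z^m, which factors because m is an integer; for p < 2 the left side is
    z^(p-1) - z <= 1 - z. *)
Lemma powRB2_diff_le (p r t : R) (m : nat) : 1 < p -> `|p - 2| <= m%:R -> (0 < m)%N ->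
  0 < r -> 0 <= t -> t <= r ->
  `|r `^ (p - 2) - t `^ (p - 2)| * t <= m%:R * r `^ (p - 2) * (r - t).
Proof.
move=> p1 pm m0 r0 t0 tr.
have rp := powR_gt0 (p - 2) r0.
have [->|tn] := eqVneq t 0.
  by rewrite mulr0 subr0 mulr_ge0 ?(ltW r0)// mulr_ge0 ?(ltW rp).
have {t0}tp : 0 < t by rewrite lt_neqAle eq_sym tn.
pose z := t / r.
have z0 : 0 < z by rewrite divr_gt0.
have z1 : z <= 1 by rewrite ler_pdivrMr// mul1r.
have tE : t = r * z by rewrite /z mulrC divfK// gt_eqF.
rewrite tE powRM ?(ltW r0) ?(ltW z0)// -{1}[r `^ _]mulr1 -mulrBr normrM gtr0_norm//.
have -> : r `^ (p - 2) * `|1 - z `^ (p - 2)| * (r * z) = (r `^ (p - 2) * r) * (`|1 - z `^ (p - 2)| * z) by ring.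
have -> : m%:R * r `^ (p - 2) * (r - r * z) = (r `^ (p - 2) * r) * (m%:R * (1 - z)) by ring.
rewrite ler_pM2l ?mulr_gt0//.
have m1 : 1 <= m%:R :> R by rewrite ler1n.
have bern : 1 - z ^+ m <= m%:R * (1 - z).
  rewrite -{1}(expr1n R m) subrXX mulrC ler_wpM2r ?subr_ge0//.
  have -> : (m%:R : R) = \sum_(i < m) 1 by rewrite sumr_const card_ord.
  apply: ler_sum => i _; by rewrite expr1n mul1r exprn_ile1 ?(ltW z0).
have [p2|p2] := leP 2 p.
  have zp1 : z `^ (p - 2) <= 1.
    have h1 : (1 : R) `^ (p - 2) = 1 by rewrite powR1.
    by rewrite -[leRHS]h1; apply: ge0_ler_powR; rewrite ?nnegrE ?subr_ge0 ?(ltW z0) ?(ltW p1).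
  rewrite ger0_norm ?subr_ge0//.
  apply: (@le_trans _ _ (1 - z `^ (p - 2))).
    by rewrite ler_piMr ?subr_ge0.
  apply: le_trans bern; rewrite lerB// -powR_mulrn ?(ltW z0)//.
  apply: ger_powR; first by rewrite z0.
  by move: pm; rewrite ger0_norm ?subr_ge0.
have zp : z `^ (p - 1) <= 1.
  have h1 : (1 : R) `^ (p - 1) = 1 by rewrite powR1.
  by rewrite -[leRHS]h1; apply: ge0_ler_powR; rewrite ?nnegrE ?subr_ge0 ?(ltW z0) ?(ltW p1).
have zp2 : 1 <= z `^ (p - 2).
  rewrite -[leLHS](powRr0 z); apply: ger_powR; first by rewrite z0.
  by rewrite subr_le0 ltW.
rewrite ler0_norm ?subr_le0// opprB mulrBl mul1r mulr_powRB2 ?(ltW z0)//.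
apply: (@le_trans _ _ (1 - z)); first by rewrite lerB.
by rewrite ler_peMl// subr_ge0.
Qed.

(** Let r be the larger norm and d = |x - y|. The left side is at most (m + 1) r^(p-2) d, and
    r^(p-2) d = r^(p-1-b) d^b (d / r)^(1-b) with d <= 2 r. Singular and degenerate exponents are
    thus covered together. *)
Lemma plaplacian_hoelder (p b L : R) (m : nat) x y : 1 < p -> `|p - 2| <= m%:R -> (0 < m)%N ->
  0 < b -> b <= 1 -> b <= p - 1 -> enorm x <= L -> enorm y <= L ->
  enorm (enorm x `^ (p - 2) *: x - enorm y `^ (p - 2) *: y) <=
  2 * (m%:R + 1) * L `^ (p - 1 - b) * enorm (x - y) `^ b.
Proof.
move=> p1 pm m0 b0 b1 bp.
wlog yx : x y / enorm y <= enorm x => [H|] xL yL.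
  have [h|h] := leP (enorm y) (enorm x); first exact: H.
  rewrite -enormN opprB -(enormN (x - y)) opprB.
  by apply: H => //; exact: ltW.
have [x0|xn] := eqVneq (enorm x) 0.
  have y0 : enorm y = 0 by apply/eqP; rewrite eq_le enorm_ge0 andbT -x0.
  rewrite (enorm_eq0 x0) (enorm_eq0 y0) !scaler0 subrr.
  have -> : enorm (0 : RN) = 0 by rewrite -(enorm_eq0 x0).
  by rewrite !mulr_ge0 ?powR_ge0 ?addr_ge0.
set r := enorm x in xn xL yx *; set t := enorm y in yL yx *; set d := enorm (x - y).
have r0 : 0 < r by rewrite lt_neqAle eq_sym xn enorm_ge0.
have t0 : 0 <= t by exact: enorm_ge0.
have d0 : 0 <= d by exact: enorm_ge0.
have rt : r - t <= d.
  have := enormD (x - y) y; rewrite subrK -/r -/t -/d; lra.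
have d2 : d <= 2 * r.
  have := enormD x (- y); rewrite enormN -/r -/t -/d; lra.
have S1 : enorm (r `^ (p - 2) *: x - t `^ (p - 2) *: y) <= (m%:R + 1) * (r `^ (p - 2) * d).
  have -> : r `^ (p - 2) *: x - t `^ (p - 2) *: y =
     r `^ (p - 2) *: (x - y) + (r `^ (p - 2) - t `^ (p - 2)) *: y.
    by rewrite scalerBr scalerBl addrA subrK.
  apply: le_trans (enormD _ _) _; rewrite !enormZ -/t -/d ger0_norm ?powR_ge0//.
  rewrite mulrDl mul1r addrC lerD2r.
  apply: le_trans (powRB2_diff_le p1 pm m0 r0 t0 yx) _.
  by rewrite -mulrA ler_wpM2l// ler_wpM2l// powR_ge0.
apply: le_trans S1 _.
have S2 : r `^ (p - 2) * d <= 2 * (L `^ (p - 1 - b) * d `^ b); last first.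
  rewrite -!mulrA [leRHS]mulrCA ler_wpM2l ?addr_ge0//.
have [dE|dn] := eqVneq d 0.
  by rewrite dE mulr0 !mulr_ge0 ?powR_ge0.
have dp : 0 < d by rewrite lt_neqAle eq_sym dn.
have dr1 : (d / r) `^ (1 - b) <= 2.
  apply: (@le_trans _ _ (2 `^ (1 - b))).
    by apply: ge0_ler_powR; rewrite ?nnegrE ?subr_ge0 ?divr_ge0 ?(ltW r0)// ler_pdivrMr.
  apply: (@le_trans _ _ (2 `^ 1)); last by rewrite powRr1.
  by apply: ler_powR; rewrite ?ler1n//; lra.
have E : r `^ (p - 2) * d = r `^ (p - 1 - b) * d `^ b * (d / r) `^ (1 - b).
  rewrite powRM ?invr_ge0 ?(ltW r0)// -(powR_inv1 (ltW r0)) -powRrM.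
  have -> : r `^ (p - 1 - b) * d `^ b * (d `^ (1 - b) * r `^ (-1 * (1 - b))) =
    (r `^ (p - 1 - b) * r `^ (-1 * (1 - b))) * (d `^ b * d `^ (1 - b)) by ring.
  rewrite -!powRD ?(gt_eqF r0) ?(gt_eqF dp) ?implybT//.
  rewrite -{1}(powRr1 d0); congr (_ `^ _ * _ `^ _); ring.
rewrite E mulrC ler_pM ?powR_ge0 ?mulr_ge0 ?powR_ge0//.
rewrite ler_wpM2r ?powR_ge0//; apply: ge0_ler_powR => //; rewrite ?nnegrE ?subr_ge0 ?(ltW r0)//.
by rewrite (le_trans (ltW r0)).
Qed.

End vector_inequalities.

Section scalar_plaplacian.
Variable R : realType.
Implicit Types a c q b L : R.

Lemma enorm_const_mx a : enorm (const_mx a : 'rV[R]_1) = `|a|.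
Proof. by rewrite /enorm /dot big_ord1 !mxE -expr2 sqrtr_sqr. Qed.

(** The vector inequality for row vectors of length 1. *)
Lemma scalar_plaplacian_monotone q a c : 1 < q ->
  0 <= (`|a| `^ (q - 2) * a - `|c| `^ (q - 2) * c) * (a - c).
Proof.
move=> q1; have := @plaplacian_monotone R 1 q (const_mx a) (const_mx c) q1.
rewrite !enorm_const_mx /dot !big_ord1 !mxE => h.
by apply: le_trans h _; rewrite mulrBl !mulrA.
Qed.

Lemma scalar_plaplacian_hoelder q b L (m : nat) a c : 1 < q -> `|q - 2| <= m%:R -> (0 < m)%N ->
  0 < b -> b <= 1 -> b <= q - 1 -> `|a| <= L -> `|c| <= L ->
  `|(`|a| `^ (q - 2) * a - `|c| `^ (q - 2) * c)| <=
  2 * (m%:R + 1) * L `^ (q - 1 - b) * `|a - c| `^ b.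
Proof.
move=> q1 qm m0 b0 b1 bq aL cL.
have := @plaplacian_hoelder R 1 q b L m (const_mx a) (const_mx c) q1 qm m0 b0 b1 bq.
rewrite !enorm_const_mx => /(_ aL cL).
rewrite (_ : const_mx a - const_mx c = const_mx (a - c)); last by apply/rowP => i; rewrite !mxE.
rewrite enorm_const_mx.
rewrite (_ : _ - _ = const_mx (`|a| `^ (q - 2) * a - `|c| `^ (q - 2) * c)) ?enorm_const_mx//.
by apply/rowP => i; rewrite !mxE.
Qed.

End scalar_plaplacian.

(** * Weak comparison *)

Section continuous_at_real.
Variables (T : topologicalType) (R : realType).
Implicit Types (f g : T -> R) (x : T).

Lemma continuous_at_mul f g x : {for x, continuous f} -> {for x, continuous g} ->
  {for x, continuous (fun y => f y * g y)}.
Proof. exact: continuousM. Qed.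

Lemma continuous_at_sub f g x : {for x, continuous f} -> {for x, continuous g} ->
  {for x, continuous (fun y => f y - g y)}.
Proof. exact: continuousB. Qed.

Lemma continuous_at_max f g x : {for x, continuous f} -> {for x, continuous g} ->
  {for x, continuous (fun y => Num.max (f y) (g y))}.
Proof. exact: continuous_max. Qed.

End continuous_at_real.

Section cube_indicator.
Variables (R : realType) (n : nat).
Local Notation mu := (lebesgue_rV R n).

Lemma measurable_cube_indic (c : 'rV[R]_n) (r : R) :
  measurable_fun setT (\1_[set y | `|y - c| <= r] : 'rV[R]_n -> R).
Proof. by apply: measurable_indic; exact: measurable_cube. Qed.

Lemma cube_indic_integrable (c : 'rV[R]_n) (r : R) :
  mu.-integrable setT (EFin \o (\1_[set y | `|y - c| <= r] : 'rV[R]_n -> R)).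
Proof.
apply: (@vanishes_beyond_integrable _ _ _ (`|c| + r) 1).
- exact: measurable_cube_indic.
- move=> x xr; rewrite indicE memNset//=; apply/negP; rewrite -ltNge.
  by have := lerB_dist x c; lra.
- by move=> x; rewrite indicE; case: (_ \in _); rewrite ?normr1 ?normr0.
Qed.

End cube_indicator.

(** * Difference of the two weak formulations *)

Section weak_formulation.
Variables (R : realType) (n : nat) (U : set 'rV[R]_n).
Variables (p q s lambda delta : R) (f g u v : 'rV[R]_n -> R).
Local Notation RN := 'rV[R]_n.
Local Notation mu := (lebesgue_rV R n).
Hypotheses (oU : open U) (p1 : 1 < p) (sq0 : 0 < s * q) (sqq : s * q < q).
Hypothesis usol : weak_solution p q s lambda delta U f u.
Hypothesis vsol : weak_solution p q s lambda delta U g v.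

(** Both comparison arguments reduce to pointwise bounds through this lemma: a and b are the local
    and nonlocal errors, both 0 in the weak comparison. Integrability of the terms of the equations
    is part of the notion of weak solution. *)
Lemma test_inequality (Gu Gv Gphi : RN -> RN) (phi a c : RN -> R) (b : RN * RN -> R) :
  weak_gradient U u Gu -> weak_gradient U v Gv ->
  C1c U phi Gphi -> (forall x, 0 <= phi x) ->
  mu.-integrable U (EFin \o a) -> (mu \x mu)%E.-integrable setT (EFin \o b) ->
  mu.-integrable U (EFin \o c) ->
  (forall x, U x -> - a x <=
     enorm (Gu x) `^ (p - 2) * dot (Gu x) (Gphi x) -
     enorm (Gv x) `^ (p - 2) * dot (Gv x) (Gphi x)) ->
  (forall x y, - b (x, y) <=
     (`|u x - u y| `^ (q - 2) * (u x - u y) - `|v x - v y| `^ (q - 2) * (v x - v y))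
       * (phi x - phi y) * gagliardo_kernel s q x y) ->
  (forall x, U x -> (lambda / u x `^ delta - lambda / v x `^ delta + (f x - g x)) * phi x <= c x) ->
  - (\int[mu]_(x in U) a x) - (\int[(mu \x mu)%E]_z b z) <= \int[mu]_(x in U) c x.
Proof.
move=> uG vG phiC phi0 ia ib ic ha hb hc.
have mU := open_measurable_rV oU.
have [_ _ _ /(_ phi)] := usol.
move=> /(_ (C1c_W01p p1 oU phiC) (C1c_W0sq sq0 sqq phiC) (aeW _ phi0) _ _ uG
  (C1c_weak_gradient oU phiC)) [lu nu ru equ].
have [_ _ _ /(_ phi)] := vsol.
move=> /(_ (C1c_W01p p1 oU phiC) (C1c_W0sq sq0 sqq phiC) (aeW _ phi0) _ _ vG
  (C1c_weak_gradient oU phiC)) [lv nv rv eqv].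
have H1 := le_Rintegral mU (integrable_EFinZ mU (-1) ia) (integrable_EFinB mU lu lv).
have H2 := le_Rintegral measurableT (integrable_EFinZ measurableT (-1) ib)
  (integrable_EFinB measurableT nu nv).
have H3 := le_Rintegral mU (integrable_EFinB mU ru rv) ic.
rewrite !RintegralZl// !RintegralB// in H1 H2 H3.
move: equ eqv.
set LU := (X in X + _ = _); set NU := (X in _ + X = _); set RU := (X in _ = X) => equ.
set LV := (X in X + _ = _); set NV := (X in _ + X = _); set RV := (X in _ = X) => eqv.
have E1 : -1 * \int[mu]_(x in U) a x <= LU - LV.
  by apply: H1 => x Ux; rewrite mulN1r; exact: ha.
have E2 : -1 * \int[(mu \x mu)%E]_z b z <= NU - NV.
  apply: H2 => -[x y] _; rewrite mulN1r; apply: le_trans (hb x y) _.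
  by rewrite le_eqVlt; apply/orP; left; apply/eqP => /=; ring.
have E3 : RU - RV <= \int[mu]_(x in U) c x.
  apply: H3 => x Ux; apply: le_trans (hc x Ux).
  by rewrite le_eqVlt; apply/orP; left; apply/eqP; ring.
move: E1 E2 E3 equ eqv; set A := Rintegral _ _ a; set B := Rintegral _ _ b.
set C := Rintegral _ _ c; clearbody LU NU RU LV NV RV A B C => E1 E2 E3 equ eqv; lra.
Qed.

End weak_formulation.

Section C1_closure.
Variables (R : realType) (n : nat) (U : set 'rV[R]_n).
Local Notation RN := 'rV[R]_n.
Hypotheses (oU : open U) (bU : bounded_set U).
Implicit Types (u w : RN -> R).

Lemma bounded_closure_compact : compact (closure U).
Proof.
apply: bounded_closed_compact; last exact: closed_closure.
have [M [_ UM]] := bU; exists `|M|; split => [|r Mr x]; first exact: num_real.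
have cl : closed [set x : RN | `|x| <= r].
  rewrite (_ : mkset _ = (fun x : RN => `|x|) @^-1` [set t | t <= r]) //.
  by apply: (preimage_closed _ (@closed_le R _)) => y _; exact: norm_continuous.
have /(_ x) : closure U `<=` [set x : RN | `|x| <= r].
  rewrite [X in _ `<=` X](iffLR (closure_id _) cl); apply: closureS => y Uy /=.
  by apply: UM => //; apply: le_lt_trans Mr; exact: ler_norm.
exact.
Qed.

(** Points of the closure outside U have w = 0 < e. A positive level is what keeps the support of
    the test function away from the boundary. *)
Lemma closure_superlevel_compact w (e : R) : {within closure U, continuous w} ->
  0 < e -> (forall x, ~ U x -> w x = 0) ->
  compact (closure U `&` [set x | e <= w x]) /\
  closure U `&` [set x | e <= w x] `<=` U.
Proof.
move=> cw e0 w0; split.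
  apply: (subclosed_compact _ bounded_closure_compact); last by move=> x [].
  have /continuous_closedP/(_ _ (@closed_ge R e)) := cw.
  move=> /closed_subspaceP[V cV VE]; rewrite setIC -VE.
  by apply: closedI => //; exact: closed_closure.
move=> x [_ /= ex]; apply: contrapT => /w0 wx; move: ex; rewrite wx leNgt e0 //.
Qed.

Lemma holder_continuous alpha (G : RN -> RN) (C : R) : 0 < alpha ->
  (forall x y i, closure U x -> closure U y ->
     `|G x ord0 i - G y ord0 i| <= C * enorm (x - y) `^ alpha) ->
  forall i, {in U, continuous (fun x => G x ord0 i)}.
Proof.
move=> a0 hG i x; rewrite inE => Ux.
apply/(@cvgrPdist_le R R RN (nbhs x) (nbhs_filter x)) => e e0.
pose D := n%:R `^ alpha * `|C| + 1.
have D0 : 0 < D by rewrite ltr_wpDl// mulr_ge0 ?powR_ge0.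
pose d := (e / D) `^ alpha^-1.
have eD : 0 < e / D by rewrite divr_gt0.
have d0 : 0 < d by rewrite powR_gt0.
have nb : \forall y \near x, `|x - y| <= d.
  by apply: filterS (nbhsx_ballx x d d0) => y; rewrite -ball_normE => /ltW.
near=> y.
have Uy : U y by near: y; apply: open_nbhs_nbhs; split.
have xyd : `|x - y| <= d by near: y; exact: nb.
apply: le_trans (hG _ _ _ (subset_closure Ux) (subset_closure Uy)) _.
apply: (@le_trans _ _ (`|C| * enorm (x - y) `^ alpha)).
  by rewrite ler_wpM2r ?powR_ge0// ler_norm.
apply: (@le_trans _ _ (`|C| * (n%:R `^ alpha * `|x - y| `^ alpha))).
  rewrite ler_wpM2l// -powRM//; apply: ge0_ler_powR; rewrite ?nnegrE ?sqrtr_ge0 ?mulr_ge0 ?(ltW a0)//.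
  exact: enorm_le.
have xy : `|x - y| `^ alpha <= e / D.
  have -> : e / D = d `^ alpha by rewrite /d -powRrM mulVf ?gt_eqF// powRr1// ltW.
  by apply: ge0_ler_powR; rewrite ?nnegrE ?(ltW a0) ?(ltW d0).
rewrite mulrA; apply: (@le_trans _ _ (D * (e / D))); last by rewrite mulrCA mulfV ?mulr1// gt_eqF.
apply: ler_pM => //; rewrite ?mulr_ge0 ?powR_ge0// /D mulrC; lra.
Unshelve. all: by end_near. Qed.

End C1_closure.

Section weak_comparison.
Variables (R : realType) (n : nat) (U : set 'rV[R]_n).
Variables (p q s lambda delta : R) (f g u v : 'rV[R]_n -> R) (Gu Gv : 'rV[R]_n -> 'rV[R]_n).
Local Notation RN := 'rV[R]_n.
Local Notation mu := (lebesgue_rV R n).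

(** The square makes the positive part C^1 while keeping it nondecreasing. *)
Definition sqr_pos (t : R) : R := Num.max 0 t ^+ 2.

Lemma is_derive_sqr_pos (t : R) : is_derive t 1 sqr_pos (2 * Num.max 0 t).
Proof.
have [t0|t0|<-] := ltgtP 0 t.
- have h : is_derive t 1 (fun x : R => x ^+ 2) (2 * t).
    have := is_deriveM (is_derive_id t 1) (is_derive_id t 1); move=> h.
    by apply: is_derive_eq h _; rewrite /GRing.scale /= mulr1 mulr2n mulrDl mul1r.
  apply: near_eq_is_derive h; near=> x; rewrite /sqr_pos max_r//; apply: ltW; near: x.
  exact: lt_nbhsr.
- rewrite mulr0; apply: (@near_eq_is_derive R R R (cst 0) _ t 1 0 _ (is_derive_cst 0 t 1)).
  near=> x; rewrite /sqr_pos max_l ?expr0n//; apply: ltW; near: x.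
  exact: lt_nbhsl.
- rewrite mulr0.
  suff H : h^-1 *: ((sqr_pos \o shift 0) (h *: 1) - sqr_pos 0) @[h --> 0^'] --> (0 : R).
    by split; [apply/cvg_ex; exists 0|exact: cvg_lim].
  apply/cvgr0Pnorm_le => e e0; near=> h.
  have h0 : h != 0 by near: h; exact: nbhs_dnbhs_neq.
  rewrite /= addr0 /sqr_pos maxxx expr0n /= subr0 /GRing.scale /= mulr1.
  apply: (@le_trans _ _ `|h|); last by near: h; exact: dnbhs0_le.
  have [hp|hn] := leP 0 h; last by rewrite expr0n mulr0 normr0.
  by rewrite expr2 mulrA mulVf// mul1r.
Unshelve. all: by end_near. Qed.

Lemma continuous_sqr_pos : continuous sqr_pos.
Proof.
move=> t; apply/differentiable_continuous/derivable1_diffP.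
by case: (is_derive_sqr_pos t).
Qed.

Lemma sqr_pos_nd : {homo sqr_pos : a b / a <= b}.
Proof.
move=> a b ab; have m0 c : 0 <= Num.max 0 c :> R by rewrite le_max lexx.
by rewrite /sqr_pos lerXn2r ?nnegrE// ge_max m0 le_max ab orbT.
Qed.

Lemma is_derive_comp_real (F : R -> R) (w : RN -> R) (x e : RN) (d dw : R) :
  is_derive (w x) 1 F d -> is_derive x e w dw -> is_derive x e (F \o w) (d * dw).
Proof.
move=> dF dwx; apply: is_derive_from_line.
have h1 := @is_derive_line _ _ w e x (fun _ => dw) 0.
rewrite scale0r addr0 in h1; have {}h1 := h1 dwx.
apply: (@is_derive1_comp R F (fun t => w (x + t *: e)) 0 d dw _ h1).
by rewrite scale0r addr0.
Qed.

Hypotheses (oU : open U) (bU : bounded_set U) (p1 : 1 < p) (q1 : 1 < q).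
Hypotheses (sq0 : 0 < s * q) (sqq : s * q < q).
Hypotheses (delta0 : 0 < delta) (lambda0 : 0 < lambda).
Hypothesis usol : weak_solution p q s lambda delta U f u.
Hypothesis vsol : weak_solution p q s lambda delta U g v.
Hypotheses (cf : {in U, continuous f}) (cg : {in U, continuous g}).
Hypothesis fg : forall x, U x -> f x < g x.
Hypotheses (cu : {within closure U, continuous u}) (cv : {within closure U, continuous v}).
Hypothesis dGu : forall x i, U x -> is_derive x (basis_vec R i) u (Gu x ord0 i).
Hypothesis dGv : forall x i, U x -> is_derive x (basis_vec R i) v (Gv x ord0 i).
Hypothesis cGu : forall i, {in U, continuous (fun x => Gu x ord0 i)}.
Hypothesis cGv : forall i, {in U, continuous (fun x => Gv x ord0 i)}.
Hypotheses (u_gt0 : forall x, U x -> 0 < u x) (v_gt0 : forall x, U x -> 0 < v x).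
Hypotheses (u_out : forall x, ~ U x -> u x = 0) (v_out : forall x, ~ U x -> v x = 0).

Let cuU : {in U, continuous u}.
Proof.
rewrite -continuous_open_subspace//.
by apply: continuous_subspaceW cu; exact: subset_closure.
Qed.

Let cvU : {in U, continuous v}.
Proof.
rewrite -continuous_open_subspace//.
by apply: continuous_subspaceW cv; exact: subset_closure.
Qed.

Let wGu : weak_gradient U u Gu. Proof. exact: weak_gradient_C1. Qed.
Let wGv : weak_gradient U v Gv. Proof. exact: weak_gradient_C1. Qed.

Lemma weak_comparison x : u x <= v x.
Proof.
have mU := open_measurable_rV oU.
have [Ux|Ux] := pselect (U x); last by rewrite u_out// v_out.
rewrite leNgt; apply/negP => vu.
(* Half of the supposed gap: positive, for compact support, and below the gap, so that [phi] is
   positive at x. *)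
pose e := (u x - v x) / 2.
have e0 : 0 < e by rewrite divr_gt0// subr_gt0.
pose w y := u y - v y.
have cw : {within closure U, continuous w}.
  by move=> y; apply: continuousB; [exact: cu|exact: cv].
have w_out y : ~ U y -> w y = 0 by move=> yU; rewrite /w u_out// v_out// subrr.
have [cK KU] := closure_superlevel_compact bU cw e0 w_out.
set K := (X in compact X) in cK KU.
have nK y : ~ K y -> w y < e.
  move=> nKy; rewrite ltNge; apply/negP => ey; apply: nKy; split => //.
  have [Uy|/w_out w0] := pselect (U y); first exact: subset_closure.
  by move: ey; rewrite w0 leNgt e0.
pose phi y := sqr_pos (w y - e).
pose Gphi y := (2 * Num.max 0 (w y - e)) *: (Gu y - Gv y).
have wU : {in U, continuous w}.
  by move=> y yU; apply: continuousB; [exact: cuU|exact: cvU].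
have dphi y i : U y -> is_derive y (basis_vec R i) phi (Gphi y ord0 i).
  move=> Uy; have dw : is_derive y (basis_vec R i) (fun y => w y - e) ((Gu y - Gv y) ord0 i).
    have h := is_deriveB (is_deriveB (dGu i Uy) (dGv i Uy)) (is_derive_cst e y (basis_vec R i)).
    by apply: is_derive_eq h _; rewrite subr0 !mxE.
  have h := is_derive_comp_real (is_derive_sqr_pos (w y - e)) dw.
  by apply: is_derive_eq h _; rewrite /Gphi [RHS]mxE.
have clK := compact_closed_rV cK.
have phiC : C1c U phi Gphi.
  have out y : ~ K y -> phi y = 0 /\ Gphi y = 0.
    move=> /nK wy; rewrite /phi /Gphi /sqr_pos max_l ?subr_le0 ?ltW//.
    by rewrite expr0n mulr0 scale0r.
  split.
  - apply: (continuous_glue oU clK KU) => [y yU|y /out[]//].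
    apply: (@continuous_comp _ _ _ (fun y => w y - e) sqr_pos); last exact: continuous_sqr_pos.
    by apply: continuousB; [exact: wU|exact: cst_continuous].
  - move=> y i; apply: (is_derive_glue (df := fun y => Gphi y ord0 i) oU clK KU
      (fun z Uz => dphi z i Uz)).
    by move=> z /out[-> ->]; rewrite mxE.
  - move=> i.
    rewrite (_ : (fun x => _) = (fun y => 2 * Num.max 0 (w y - e) *
        (Gu y ord0 i - Gv y ord0 i))); last by apply/funext => z; rewrite !mxE.
    apply: (continuous_glue oU clK KU) => [y yU|y /nK wy]; last first.
      by rewrite max_l ?mulr0 ?mul0r// subr_le0 ltW.
    have h1 : {for y, continuous (fun y => w y - e)}.
      by apply: continuous_at_sub; [exact: wU|exact: cst_continuous].
    have h2 : {for y, continuous (fun y => Gu y ord0 i - Gv y ord0 i)}.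
      by apply: continuous_at_sub; [exact: cGu|exact: cGv].
    have h3 := continuous_at_max (@cst_continuous RN R 0 y) h1.
    have h4 := continuous_at_mul (@cst_continuous RN R 2 y) h3.
    exact: continuous_at_mul h4 h2.
  - by exists K.
have phi0 y : 0 <= phi y by rewrite /phi sqr_ge0.
have phix : 0 < phi x.
  rewrite /phi /sqr_pos max_r; last by rewrite /w /e; lra.
  by rewrite exprn_gt0// /w /e; lra.
have cphi : continuous phi by case: phiC.
(* Half of the value at x, which by continuity is a lower bound on a small cube B. *)
pose c := (g x - f x) * phi x / 2.
have c0 : 0 < c by rewrite divr_gt0// mulr_gt0// subr_gt0 fg.
have cgf : {for x, continuous (fun y => (g y - f y) * phi y)}.
  have h1 : {for x, continuous (fun y => g y - f y)}.
    by apply: continuous_at_sub; [apply: cg; rewrite inE|apply: cf; rewrite inE].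
  exact: continuous_at_mul h1 (cphi x).
have [d d0 hd] : exists2 d, 0 < d & forall y, `|y - x| <= d -> U y /\ c <= (g y - f y) * phi y.
  have : \forall y \near x, U y /\ c <= (g y - f y) * phi y.
    have h1 : \forall y \near x, U y by apply: open_nbhs_nbhs; split.
    have h2 : \forall y \near x, c < (g y - f y) * phi y.
      apply: (@cvgr_gt _ _ (nbhs x) (nbhs_filter x) _ _ cgf).
      by rewrite /c ltr_pdivrMr// ltr_pMr ?ltr1n// mulr_gt0// subr_gt0 fg.
    by apply: filterS2 h1 h2 => y h3 h4; split => //; exact: ltW.
  move=> /nbhs_ballP[d /= d0 hd]; exists (d / 2); first by rewrite divr_gt0.
  move=> y yx; apply: hd; rewrite -ball_normE /ball_ /= distrC.
  by apply: le_lt_trans yx _; rewrite ltr_pdivrMr// ltr_pMr// ltr1n.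
pose B := [set y | `|y - x| <= d].
have mB : measurable B by exact: measurable_cube.
have BU : B `<=` U by move=> y /hd[].
have muB : mu B = ((d *+ 2) ^+ n)%:E by rewrite lebesgue_rV_cube// ltW.
have muBoo : (mu B < +oo)%E by rewrite muB ltry.
have ic : mu.-integrable U (EFin \o (fun y => - c * \1_B y)).
  apply: integrable_EFinZ => //.
  apply: integrableS (@subsetT _ U) _ => //.
  exact: cube_indic_integrable.
have i0 d' (T : measurableType d') (m : {measure set T -> \bar R}) (D : set T) :
    m.-integrable D (EFin \o (fun=> 0)).
  exact: integrable0.
have := @test_inequality R n U p q s lambda delta f g u v oU p1 sq0 sqq usol vsol
  Gu Gv Gphi phi (fun=> 0) (fun y => - c * \1_B y) (fun=> 0) wGu wGv phiC phi0
  (i0 _ _ _ _) (i0 _ _ _ _) ic.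
rewrite oppr0 !Rintegral_cst// ?mul0r ?oppr0 ?addr0 => H.
have : 0 <= \int[mu]_(y in U) (- c * \1_B y).
  apply: H => [y Uy|y z|y Uy].
  (* The gradient of [phi] is a nonnegative multiple of [Gu y - Gv y], so monotonicity of the
     p-Laplacian applies. *)
  - rewrite !dotZr ![_ `^ _ * (_ * _)]mulrCA -mulrBr mulr_ge0//.
      by rewrite mulr_ge0// le_max lexx.
    exact: plaplacian_monotone.
  (* As [phi] is a nondecreasing function of w, both factors have the sign of w y - w z. *)
  - rewrite mulr_ge0 ?gagliardo_kernel_ge0//.
    have := scalar_plaplacian_monotone (u y - u z) (v y - v z) q1.
    set X := (X in 0 <= X * _ -> _).
    have -> : u y - u z - (v y - v z) = w y - w z by rewrite /w; ring.
    have [wyz|wyz|wyz] := ltgtP (w y) (w z); last by rewrite /phi wyz !subrr !mulr0.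
      rewrite nmulr_lge0 ?subr_lt0// => X0.
      by rewrite mulr_le0// subr_le0 sqr_pos_nd// lerB// ltW.
    rewrite pmulr_lge0 ?subr_gt0// => X0.
    by rewrite mulr_ge0// subr_ge0 sqr_pos_nd// lerB// ltW.
  - rewrite mulrDl.
    (* [phi] is positive only where v < u, and there the singular term of u is the smaller one. *)
    have t1 : (lambda / u y `^ delta - lambda / v y `^ delta) * phi y <= 0.
      have [uv|vu'] := leP (u y) (v y).
        rewrite /phi /sqr_pos max_l ?expr0n ?mulr0//.
        by rewrite /w lerBlDr add0r (le_trans _ (ltW e0))// subr_le0.
      rewrite mulr_le0_ge0// subr_le0 ler_pM2l// lef_pV2 ?posrE ?powR_gt0 ?u_gt0 ?v_gt0//.
      by apply: ge0_ler_powR; rewrite ?nnegrE ?(ltW delta0) ?(ltW (u_gt0 Uy)) ?(ltW (v_gt0 Uy)) ?(ltW vu').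
    have t2 : (f y - g y) * phi y <= - c * \1_B y.
      rewrite indicE; have [yB|yB] := boolP (y \in B).
        rewrite mulr1 lerNr -mulNr opprB; move: yB; rewrite inE => /hd[_].
        exact.
      by rewrite mulr0 mulr_le0_ge0// subr_le0 ltW// fg.
    by rewrite -[leRHS]add0r lerD.
rewrite RintegralZl//; last first.
  by apply: integrableS (@subsetT _ U) _ => //; exact: cube_indic_integrable.
have -> : \int[mu]_(y in U) \1_B y = (d *+ 2) ^+ n.
  rewrite /Rintegral integral_indic//.
  have BUB : B `&` U = B by apply/setIidPl.
  by rewrite BUB; exact: (congr1 fine muB).
by rewrite mulNr leNgt oppr_lt0 mulr_gt0// exprn_gt0// pmulrn_lgt0.
Qed.

End weak_comparison.

(** * Strong comparison *)

Section gradient_interpolation.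
Variables (R : realType) (n : nat).
Local Notation RN := 'rV[R]_n.

Lemma enorm_scale_basis (a : R) (i : 'I_n) : enorm (a *: basis_vec R i) = `|a|.
Proof.
rewrite enormZ /enorm /dot (bigD1 i)//= big1 => [|j ji].
  by rewrite !mxE !eqxx mulr1 addr0 sqrtr1 mulr1.
by rewrite !mxE eqxx /= (negbTE ji) mulr0.
Qed.

(* A nonnegative C^{1,alpha} function stays nonnegative at distance tau, which
   bounds its gradient by w/tau + tau^alpha; tau = w^(1/(1+alpha)) is optimal. *)
Lemma gradient_interpolation (w : RN -> R) (G : RN -> RN) (x0 : RN) (r H alpha Wm : R) :
  0 < r -> 0 < alpha -> 0 <= H -> 0 < Wm ->
  (forall x i, `|x - x0| <= 2 * r -> is_derive x (basis_vec R i) w (G x ord0 i)) ->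
  (forall x, `|x - x0| <= 2 * r -> 0 <= w x) ->
  (forall x y i, `|x - x0| <= 2 * r -> `|y - x0| <= 2 * r ->
     `|G x ord0 i - G y ord0 i| <= H * enorm (x - y) `^ alpha) ->
  exists2 C, 0 <= C & forall x i e, `|x - x0| <= r -> 0 < e -> w x + e <= Wm ->
    `|G x ord0 i| <= C * (w x + e) `^ (alpha / (1 + alpha)).
Proof.
move=> r0 a0 H0 Wm0 dw w0 hG.
have a1 : 0 < 1 + alpha by rewrite addr_gt0.
pose k := (1 + alpha)^-1.
have k0 : 0 < k by rewrite invr_gt0.
(* Normalised so that [tau] = th W^k is at most r as long as W <= Wm; the displaced point then stays
   in the cube of radius 2 r. *)
pose th := r / Wm `^ k.
have th0 : 0 < th by rewrite divr_gt0// powR_gt0.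
exists (th^-1 + H * th `^ alpha).
  by rewrite addr_ge0 ?mulr_ge0 ?powR_ge0 ?invr_ge0 ?(ltW th0).
move=> x i e xr e0 We; set W := w x + e.
have w0x : 0 <= w x by apply: w0; lra.
have W0 : 0 < W by rewrite /W ltr_wpDl.
pose tau := th * W `^ k.
have tau0 : 0 < tau by rewrite mulr_gt0// powR_gt0.
have taur : tau <= r.
  rewrite /tau /th mulrAC ler_pdivrMr ?powR_gt0// ler_wpM2l ?(ltW r0)//.
  by apply: ge0_ler_powR; rewrite ?nnegrE ?(ltW k0) ?(ltW W0) ?(ltW Wm0).
set Gx := G x ord0 i.
(* A step against the sign of the derivative: w decreases to first order but remains nonnegative. *)
pose a := - tau * Num.sg Gx.
have aa : `|a| <= tau.
  rewrite normrM normrN (gtr0_norm tau0) ler_piMr ?(ltW tau0)// normr_sg.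
  by case: (_ != _).
have inc t : 0 <= t <= 1 -> `|x + (t * a) *: basis_vec R i - x0| <= 2 * r.
  move=> /andP[t0 t1]; rewrite addrAC; apply: le_trans (ler_normD _ _) _.
  have : `|(t * a) *: basis_vec R i| <= r.
    apply: le_trans (norm_le_enorm _) _; rewrite enorm_scale_basis normrM (ger0_norm t0).
    apply: le_trans taur; apply: le_trans aa.
    by rewrite ler_piMl.
  lra.
have [t t01 tE] := @line_mvt _ _ w (fun y => G y ord0 i) (basis_vec R i) x a
  (fun t t01 => dw _ i (inc t t01)).
have wa : 0 <= w (x + a *: basis_vec R i).
  apply: w0; have := inc 1; rewrite mul1r; apply; by rewrite ler01 lexx.
have x2r : `|x - x0| <= 2 * r by lra.
have Gd : `|G (x + (t * a) *: basis_vec R i) ord0 i - Gx| <= H * tau `^ alpha.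
  apply: le_trans (hG _ _ _ (inc t t01) x2r) _.
  rewrite ler_wpM2l// addrAC subrr add0r enorm_scale_basis.
  apply: ge0_ler_powR; rewrite ?nnegrE ?(ltW a0) ?(ltW tau0)//.
  move/andP: t01 => [t0 t1]; rewrite normrM (ger0_norm t0).
  by apply: le_trans aa; rewrite ler_piMl.
have key : tau * `|Gx| <= w x + tau * (H * tau `^ alpha).
  have E : a * Gx = - (tau * `|Gx|) by rewrite /a mulNr mulNr -mulrA -normrEsg.
  have h1 : a * (G (x + (t * a) *: basis_vec R i) ord0 i - Gx) <= tau * (H * tau `^ alpha).
    apply: le_trans (ler_norm _) _; rewrite normrM; exact: ler_pM.
  have h2 : 0 <= w x + a * G (x + (t * a) *: basis_vec R i) ord0 i.
    by rewrite -tE addrC subrK.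
  move: h1; rewrite mulrBr E => h1; lra.
have kE : alpha / (1 + alpha) = alpha * k by [].
have kE1 : 1 - k = alpha * k by rewrite /k; field; rewrite gt_eqF.
have wtau : w x / tau <= th^-1 * W `^ (alpha * k).
  rewrite /tau invfM mulrCA ler_wpM2l ?invr_ge0 ?(ltW th0)//.
  apply: (@le_trans _ _ (W / W `^ k)).
    by rewrite ler_wpM2r ?invr_ge0 ?powR_ge0// /W lerDl ltW.
  rewrite -{1}(powRr1 (ltW W0)) -powRN -powRD ?kE1//.
  by rewrite (gt_eqF W0) implybT.
have taua : tau `^ alpha = th `^ alpha * W `^ (alpha * k).
  by rewrite /tau powRM ?(ltW th0) ?powR_ge0// -powRrM mulrC [k * _]mulrC mulrC.
rewrite kE mulrDl -mulrA -taua.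
apply: le_trans (lerD wtau (lexx _)).
rewrite -(ler_pM2l tau0); apply: le_trans key _.
by rewrite mulrDr [tau * (w x / tau)]mulrCA mulfV ?gt_eqF// mulr1.
Qed.

End gradient_interpolation.

(** * Absorption of error terms *)

Section absorption.
Variable R : realType.
Implicit Types (A sg W Wm z k M b : R).

(* Either A W^k <= sg z, or z is at most a multiple of W^k, in which case the left
   hand side is O(W^(k (m+1))). *)
Lemma absorb_cutoff A sg k M Wm (m : nat) : 0 < A -> 0 < sg -> 0 < Wm -> 0 < k ->
  M <= k * m.+1%:R ->
  exists2 D, 0 <= D & forall z W, 0 <= z -> 0 < W -> W <= Wm ->
    A * z ^+ m * W `^ k <= sg * z ^+ m.+1 + D * W `^ M.
Proof.
move=> A0 s0 Wm0 k0 kM.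
have As0 : 0 <= A / sg by rewrite ltW// divr_gt0.
have c0 : 0 <= A * (A / sg) ^+ m by rewrite mulr_ge0 ?(ltW A0) ?exprn_ge0.
(* In the second case W^(k (m + 1)) is split into W^M and a power of nonnegative exponent, bounded
   by the same power of Wm. *)
exists (A * (A / sg) ^+ m * Wm `^ (k * m.+1%:R - M)).
  by rewrite mulr_ge0 ?powR_ge0.
move=> z W z0 W0 WWm.
have [h|h] := leP (A * W `^ k) (sg * z).
  apply: (@le_trans _ _ (sg * z ^+ m.+1)).
    by rewrite exprS mulrA mulrAC ler_wpM2r ?exprn_ge0.
  by rewrite lerDl mulr_ge0 ?powR_ge0// mulr_ge0 ?powR_ge0.
apply: (@le_trans _ _ (A * (A / sg) ^+ m * Wm `^ (k * m.+1%:R - M) * W `^ M)); last first.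
  by rewrite lerDr mulr_ge0 ?exprn_ge0// (ltW s0).
have zW : z <= A / sg * W `^ k.
  by rewrite mulrAC ler_pdivlMr// mulrC ltW.
apply: (@le_trans _ _ (A * (A / sg * W `^ k) ^+ m * W `^ k)).
  rewrite ler_wpM2r ?powR_ge0// ler_wpM2l ?(ltW A0)//.
  by rewrite lerXn2r// nnegrE mulr_ge0 ?powR_ge0.
have -> : A * (A / sg * W `^ k) ^+ m * W `^ k = A * (A / sg) ^+ m * (W `^ k) ^+ m.+1.
  by rewrite exprMn exprS; ring.
rewrite -[leRHS]mulrA ler_wpM2l//.
rewrite -powR_mulrn ?powR_ge0// -powRrM.
have {1}-> : k * m.+1%:R = (k * m.+1%:R - M) + M by rewrite subrK.
rewrite powRD ?(gt_eqF W0) ?implybT// ler_wpM2r ?powR_ge0//.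
by apply: ge0_ler_powR; rewrite ?nnegrE ?subr_ge0 ?(ltW W0) ?(ltW Wm0).
Qed.

(** Either A W^b <= sg, or W is bounded below by (sg / A)^(1/b) and W^(-M) is bounded. *)
Lemma absorb_power A sg b M Wm : 0 < A -> 0 < sg -> 0 < Wm -> 0 < b -> 0 <= M ->
  exists2 D, 0 <= D & forall W, 0 < W -> W <= Wm ->
    A * W `^ b * W `^ (- M) <= sg * W `^ (- M) + D.
Proof.
move=> A0 s0 Wm0 b0 M0.
have c0 x y : 0 <= A * Wm `^ x * y `^ (- (M / b)).
  by rewrite mulr_ge0 ?powR_ge0// mulr_ge0 ?powR_ge0 ?(ltW A0).
exists (A * Wm `^ b * (sg / A) `^ (- (M / b))).
  exact: c0.
move=> W W0 WWm; have sA : 0 < sg / A by rewrite divr_gt0.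
have [h|h] := leP (A * W `^ b) sg.
  apply: (@le_trans _ _ (sg * W `^ (- M))); first by rewrite ler_wpM2r ?powR_ge0.
  by rewrite lerDl.
apply: (@le_trans _ _ (A * Wm `^ b * (sg / A) `^ (- (M / b)))); last first.
  by rewrite lerDr mulr_ge0 ?powR_ge0 ?(ltW s0).
apply: ler_pM; rewrite ?mulr_ge0 ?powR_ge0 ?(ltW A0)//.
  rewrite ler_wpM2l ?(ltW A0)//.
  by apply: ge0_ler_powR; rewrite ?nnegrE ?(ltW W0) ?(ltW Wm0) ?(ltW b0).
have sW : sg / A <= W `^ b by rewrite ler_pdivrMr// mulrC ltW.
rewrite !powRN lef_pV2 ?posrE ?powR_gt0//.
have -> : W `^ M = (W `^ b) `^ (M / b) by rewrite -powRrM mulrCA mulfV ?mulr1// gt_eqF.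
by apply: ge0_ler_powR; rewrite ?nnegrE ?(divr_ge0 M0 (ltW b0)) ?powR_ge0 ?(ltW sA).
Qed.

End absorption.

Section local_lipschitz.
Variables (R : realType) (n : nat).
Local Notation RN := 'rV[R]_n.

(** Only x has to be near x0, as the nonlocal term sees every y. The three parts of the constant
    serve |x - y| <= r, |x - y| >= 1, and the distances between r and 1. *)
Lemma lipschitz_from_cube (u : RN -> R) (G : RN -> RN) (x0 : RN) (r L M : R) :
  0 < r -> 0 <= L -> 0 <= M ->
  (forall x i, `|x - x0| <= 2 * r -> is_derive x (basis_vec R i) u (G x ord0 i)) ->
  (forall x i, `|x - x0| <= 2 * r -> `|G x ord0 i| <= L) ->
  (forall x, `|u x| <= M) ->
  exists2 C, 0 <= C & forall x y, `|x - x0| <= r ->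
    `|u x - u y| <= C * Num.min 1 `|x - y|.
Proof.
move=> r0 L0 M0 du GL uM.
pose C := n%:R * L + (M + M) + (M + M) / r.
have MM0 : 0 <= M + M by rewrite addr_ge0.
have Mr0 : 0 <= (M + M) / r by rewrite divr_ge0// ltW.
have nL0 : 0 <= n%:R * L by rewrite mulr_ge0.
have C1 : n%:R * L <= C by rewrite /C; lra.
have C2 : M + M <= C by rewrite /C; lra.
have C3 : (M + M) / r <= C by rewrite /C; lra.
have C0 : 0 <= C by exact: le_trans C2.
exists C => // x y xr.
have uMM : `|u x - u y| <= M + M by apply: le_trans (ler_normB _ _) _; exact: lerD.
have [xy|xy] := leP 1 `|x - y|.
  by rewrite mulr1; exact: le_trans uMM C2.
have [xyr|xyr] := leP `|x - y| r.
  have r20 : 0 <= 2 * r by rewrite mulr_ge0 ?ltW.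
  apply: (@le_trans _ _ (n%:R * L * `|x - y|)); last by rewrite ler_wpM2r.
  apply: (@cube_lipschitz _ _ u G x0 (2 * r) L) => //; first lra.
  rewrite -(subrKA x); apply: le_trans (ler_normD _ _) _.
  by rewrite distrC; lra.
apply: le_trans uMM _; apply: (@le_trans _ _ ((M + M) / r * `|x - y|)).
  rewrite mulrAC ler_pdivlMr// ler_wpM2l ?addr_ge0// ltW//.
by rewrite ler_wpM2r.
Qed.

End local_lipschitz.

Section nonlocal_error.
Variables (R : realType) (n : nat).
Local Notation RN := 'rV[R]_n.
Local Notation mu := (lebesgue_rV R n).

(** By Tonelli and the symmetry of the kernel each summand costs a factor C. The double integral is
    thereby controlled by the integral of F alone. *)
Lemma nonlocal_error_integral (s q b C : R) (F : RN -> R) :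
  (forall x : RN, (\int[mu]_y (trunc_kernel s q b x y)%:E <= C%:E)%E) -> 0 <= C ->
  measurable_fun setT F -> (forall x, 0 <= F x) -> mu.-integrable setT (EFin \o F) ->
  (mu \x mu)%E.-integrable setT
    (EFin \o (fun z => (F z.1 + F z.2) * trunc_kernel s q b z.1 z.2)) /\
  \int[(mu \x mu)%E]_z ((F z.1 + F z.2) * trunc_kernel s q b z.1 z.2) <=
    2 * C * \int[mu]_x F x.
Proof.
move=> kC C0 mF F0 iF.
have mk := @measurable_trunc_kernel R n s q b.
have m1 : measurable_fun setT (fun z : RN * RN => F z.1 * trunc_kernel s q b z.1 z.2).
  by apply: measurable_funM => //; exact: measurableT_comp mF measurable_fst.
have m2 : measurable_fun setT (fun z : RN * RN => F z.2 * trunc_kernel s q b z.1 z.2).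
  by apply: measurable_funM => //; exact: measurableT_comp mF measurable_snd.
have k0 z : 0 <= trunc_kernel s q b z.1 z.2 :> R := trunc_kernel_ge0 _ _ _ z.1 z.2.
set h := (fun z => (F z.1 + F z.2) * trunc_kernel s q b z.1 z.2).
have h0 z : 0 <= h z by rewrite /h mulr_ge0 ?addr_ge0.
have mh : measurable_fun setT h.
  rewrite (_ : h = (fun z => F z.1 * trunc_kernel s q b z.1 z.2 +
     F z.2 * trunc_kernel s q b z.1 z.2)); first exact: measurable_funD.
  by apply/funext => z; rewrite /h mulrDl.
have I0 : 0 <= \int[mu]_x F x by apply: Rintegral_ge0.
have FE : (\int[mu]_x (F x)%:E = (\int[mu]_x F x)%:E)%E.
  by rewrite /Rintegral fineK//; apply: (integrable_fin_num measurableT iF).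
have hle : (\int[(mu \x mu)%E]_z (h z)%:E <= (2 * C * \int[mu]_x F x)%:E)%E.
  under eq_integral do rewrite /h mulrDl EFinD.
  rewrite ge0_integralD//; try exact/measurable_EFinP;
    try by move=> z _; rewrite lee_fin mulr_ge0.
  apply: (@le_trans _ _ (C%:E * (\int[mu]_x (F x)%:E) + C%:E * (\int[mu]_x (F x)%:E))%E).
    by apply: leeD; [exact: weighted_kernel_le1|exact: weighted_kernel_le2].
  by rewrite FE -EFinM -EFinD lee_fin le_eqVlt; apply/orP; left; apply/eqP; ring.
have ih : (mu \x mu)%E.-integrable setT (EFin \o h).
  apply/integrableP; split; first exact/measurable_EFinP.
  under eq_integral do rewrite /= ger0_norm//.
  by apply: le_lt_trans hle _; exact: ltry.
split => //; rewrite /Rintegral -lee_fin fineK//.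
exact: (integrable_fin_num measurableT ih).
Qed.

End nonlocal_error.

Section one_variable.
Variable R : realType.

Lemma nat_upper_bound (x : R) : exists2 m, (0 < m)%N & x <= m%:R.
Proof.
exists (Num.bound `|x|).+1 => //; apply: le_trans (ler_norm x) _.
apply: ltW; apply: lt_le_trans (archi_boundP (normr_ge0 x)) _.
by rewrite ler_nat.
Qed.

Lemma is_derive_exprS (m : nat) (t : R) :
  is_derive t 1 (fun t : R => t ^+ m.+1) (m.+1%:R * t ^+ m).
Proof.
rewrite (_ : (fun t => _) = horner 'X^(m.+1)); last by apply/funext => y; rewrite hornerXn.
have := is_derive_poly ('X^(m.+1) : {poly R}) t.
by rewrite derivXn hornerMn hornerXn mulr_natl.
Qed.

Lemma is_derive_powR (a t : R) : 0 < t ->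
  is_derive t 1 (fun t : R => t `^ a) (a * t `^ (a - 1)).
Proof. by move=> t0; exact: is_derive1_powR. Qed.

Lemma continuous_powR (a t : R) : 0 < t -> {for t, continuous (fun t : R => t `^ a)}.
Proof.
move=> t0; apply/differentiable_continuous/derivable1_diffP.
by case: (is_derive_powR a t0).
Qed.

(** Factoring out a^(-delta) leaves 1 - (a/b)^delta. As a/b <= 1 and delta <= 1, this is at most 1 -
    a/b, which is linear in b - a. *)
Lemma singular_term_diff (lambda delta a b c : R) : 0 < lambda -> 0 < delta -> delta <= 1 ->
  0 < c -> c <= a -> a <= b ->
  lambda / a `^ delta - lambda / b `^ delta <= lambda / c `^ delta / c * (b - a).
Proof.
move=> l0 d0 d1 c0 ca ab.
have a0 : 0 < a by exact: lt_le_trans ca.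
have b0 : 0 < b by exact: lt_le_trans ab.
have ab1 : 0 < a / b <= 1 by rewrite divr_gt0//= ler_pdivrMr// mul1r.
have h1 : a / b <= (a / b) `^ delta.
  rewrite -{1}(powRr1 (ltW (divr_gt0 a0 b0))); exact: ger_powR.
have E : b `^ delta = a `^ delta / (a / b) `^ delta.
  rewrite powRM ?invr_ge0 ?(ltW a0) ?(ltW b0)//.
  have -> : b^-1 `^ delta = (b `^ delta)^-1.
    by rewrite -(powR_inv1 (ltW b0)) -powRrM mulN1r powRN.
  by rewrite invfM invrK mulrA mulfV ?mul1r// gt_eqF// powR_gt0.
rewrite E invfM invrK mulrA -[X in X - _]mulr1 -mulrBr.
have ad : 0 < a `^ delta by rewrite powR_gt0.
have cd : 0 < c `^ delta by rewrite powR_gt0.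
have k1 : lambda / a `^ delta <= lambda / c `^ delta.
  rewrite ler_pM2l// lef_pV2 ?posrE//.
  by apply: ge0_ler_powR; rewrite ?nnegrE ?(ltW d0) ?(ltW c0) ?(ltW a0).
have k2 : 1 - (a / b) `^ delta <= (b - a) / c.
  apply: (@le_trans _ _ (1 - a / b)); first by rewrite lerB.
  have -> : 1 - a / b = (b - a) / b by field; rewrite gt_eqF.
  by rewrite ler_wpM2l ?subr_ge0// lef_pV2 ?posrE// (le_trans ca).
have k3 : 0 <= 1 - (a / b) `^ delta.
  rewrite subr_ge0 -[leRHS](_ : 1 `^ delta = 1); last by rewrite powR1.
  move/andP: ab1 => [h2 h3].
  by apply: ge0_ler_powR; rewrite ?nnegrE ?(ltW d0) ?(ltW h2).
apply: (@le_trans _ _ (lambda / c `^ delta * ((b - a) / c))); last first.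
  by rewrite le_eqVlt; apply/orP; left; apply/eqP; ring.
by apply: ler_pM => //; rewrite divr_ge0 ?(ltW l0) ?(ltW ad).
Qed.

End one_variable.

Section strong_comparison.
Variables (R : realType) (n : nat) (U : set 'rV[R]_n).
Variables (p q s lambda delta alpha : R) (f g u v : 'rV[R]_n -> R).
Variables (Gu Gv : 'rV[R]_n -> 'rV[R]_n) (x0 : 'rV[R]_n) (r H Mb Lg c0 u0 : R).
Variables (zeta : 'rV[R]_n -> R) (Gzeta : 'rV[R]_n -> 'rV[R]_n) (Zm Zg : R) (m : nat).
Local Notation RN := 'rV[R]_n.
Local Notation mu := (lebesgue_rV R n).
Hypotheses (oU : open U) (p1 : 1 < p) (q1 : 1 < q) (alpha0 : 0 < alpha).
Hypotheses (sq0 : 0 < s * q) (sqq1 : s * q < q - 1).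
Hypotheses (delta0 : 0 < delta) (delta1 : delta <= 1) (lambda0 : 0 < lambda).
Hypothesis usol : weak_solution p q s lambda delta U f u.
Hypothesis vsol : weak_solution p q s lambda delta U g v.
Hypotheses (cu : {in U, continuous u}) (cv : {in U, continuous v}).
Hypothesis dGu : forall x i, U x -> is_derive x (basis_vec R i) u (Gu x ord0 i).
Hypothesis dGv : forall x i, U x -> is_derive x (basis_vec R i) v (Gv x ord0 i).
Hypothesis cGu : forall i, {in U, continuous (fun x => Gu x ord0 i)}.
Hypothesis cGv : forall i, {in U, continuous (fun x => Gv x ord0 i)}.
Hypotheses (u_ge0 : forall x, 0 <= u x) (uv : forall x, u x <= v x).
Hypotheses (Mb0 : 0 <= Mb) (vM : forall x, v x <= Mb).
Hypotheses (r0 : 0 < r) (QU : forall x, `|x - x0| <= 2 * r -> U x).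
Hypotheses (H0 : 0 <= H)
  (hGu : forall x y i, U x -> U y ->
     `|Gu x ord0 i - Gu y ord0 i| <= H * enorm (x - y) `^ alpha)
  (hGv : forall x y i, U x -> U y ->
     `|Gv x ord0 i - Gv y ord0 i| <= H * enorm (x - y) `^ alpha).
Hypotheses (Lg0 : 0 <= Lg)
  (LGu : forall x i, `|x - x0| <= 2 * r -> `|Gu x ord0 i| <= Lg)
  (LGv : forall x i, `|x - x0| <= 2 * r -> `|Gv x ord0 i| <= Lg).
Hypotheses (c00 : 0 < c0) (fgc : forall x, `|x - x0| <= r -> c0 <= g x - f x).
Hypotheses (u00 : 0 < u0) (uu0 : forall x, `|x - x0| <= r -> u0 <= u x).
Hypotheses (czeta : continuous zeta)
  (dzeta : forall x i, is_derive x (basis_vec R i) zeta (Gzeta x ord0 i))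
  (cGzeta : forall i, continuous (fun x => Gzeta x ord0 i)).
Hypotheses (zeta0 : forall x, 0 <= zeta x) (zetaZ : forall x, zeta x <= Zm)
  (Zg0 : 0 <= Zg) (GzetaZ : forall x, enorm (Gzeta x) <= Zg)
  (zeta_out : forall x, r < `|x - x0| -> zeta x = 0).
Hypothesis m0 : (0 < m)%N.

Let w x := v x - u x.
Let M : R := n.+1%:R.
Let B : set RN := [set x | `|x - x0| <= r].
Let Wm := Mb + 1.

(* M is the exponent N + 1. The two parts of F are an error that the right hand
   side absorbs (for sg small) and one with an integral independent of e. *)
Let phi e x := zeta x ^+ m.+1 * (w x + e) `^ (- M).
Let Gphi e x := (m.+1%:R * zeta x ^+ m * (w x + e) `^ (- M)) *: Gzeta x +
  (M * zeta x ^+ m.+1 * (w x + e) `^ (- M - 1)) *: (Gu x - Gv x).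
Let F e sg D x := sg * phi e x + D * \1_B x.

Let w_ge0 x : 0 <= w x. Proof. by rewrite subr_ge0. Qed.

Let W_gt0 e x : 0 < e -> 0 < w x + e.
Proof. by move=> e0; rewrite ltr_wpDl. Qed.

Let W_le e x : e <= 1 -> w x + e <= Wm.
Proof.
by move=> e1; rewrite lerD// /w lerBlDr (le_trans (vM x))// lerDl.
Qed.

Let Wm_gt0 : 0 < Wm. Proof. by rewrite ltr_wpDl. Qed.

Let M_gt0 : 0 < M. Proof. by rewrite ltr0n. Qed.

Let phi_ge0 e x : 0 <= phi e x.
Proof. by rewrite mulr_ge0 ?powR_ge0 ?exprn_ge0. Qed.

Let phi_out e x : r < `|x - x0| -> phi e x = 0.
Proof. by move=> /zeta_out zx; rewrite /phi zx expr0n mul0r. Qed.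

Let Gphi_out e x : r < `|x - x0| -> Gphi e x = 0.
Proof.
move=> /zeta_out zx; rewrite /Gphi zx !expr0n /=.
by rewrite eqn0Ngt m0 /= !mulr0 !mul0r !scale0r addr0.
Qed.

Let B_in x : `|x - x0| <= r -> \1_B x = 1 :> R.
Proof. by move=> xr; rewrite indicE mem_set. Qed.

Let F_ge0 e sg D x : 0 <= sg -> 0 <= D -> 0 <= F e sg D x.
Proof.
by move=> s0 D0; apply: addr_ge0; apply: mulr_ge0.
Qed.

Let phi_C1c e : 0 < e -> C1c U (phi e) (Gphi e).
Proof.
move=> e0.
have cB : compact B.
  apply: bounded_closed_compact.
    exists (`|x0| + r); split => [|t xt x]; first exact: num_real.
    rewrite /B /= => xr; apply: le_trans (ltW xt).
    by have := lerB_dist x x0; lra.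
  rewrite (_ : B = (fun x : RN => `|x - x0|) @^-1` [set t | t <= r]) //.
  apply: (preimage_closed _ (@closed_le R _)) => x _.
  apply: (@continuous_comp _ _ _ (fun x : RN => x - x0) (fun y : RN => `|y|)).
    by apply: continuousB => //; exact: cst_continuous.
  exact: norm_continuous.
have BU : B `<=` U by move=> x; rewrite /B /= => xr; apply: QU; have := r0; lra.
have clB := compact_closed_rV cB.
have nB x : ~ B x -> r < `|x - x0| by move=> nb; rewrite ltNge; apply/negP.
have cw x : x \in U -> {for x, continuous (fun y => w y + e)}.
  move=> xU; apply: continuousD; last exact: cst_continuous.
  by apply: continuous_at_sub; [exact: cv|exact: cu].
have cW a x : x \in U -> {for x, continuous (fun y => (w y + e) `^ a)}.
  move=> xU; apply: (@continuous_comp _ _ _ (fun y => w y + e) (fun t => t `^ a)).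
    exact: cw.
  by apply: continuous_powR; exact: W_gt0.
have cz k : continuous (fun x => zeta x ^+ k).
  move=> x; apply: (@continuous_comp _ _ _ zeta (fun t => t ^+ k)); first exact: czeta.
  exact: exprn_continuous.
split.
- apply: (continuous_glue oU clB BU) => [x xU|x /nB]; last exact: phi_out.
  exact: (continuous_at_mul (cz m.+1 x) (cW (- M) x xU)).
- move=> x i; apply: (is_derive_glue (df := fun y => Gphi e y ord0 i) oU clB BU); last first.
    by move=> y /nB yB; rewrite phi_out// Gphi_out// mxE.
  move=> y Uy.
  have dw : is_derive y (basis_vec R i) (fun y => w y + e) (Gv y ord0 i - Gu y ord0 i).
    have h := is_deriveD (is_deriveB (dGv i Uy) (dGu i Uy)) (is_derive_cst e y (basis_vec R i)).
    by apply: is_derive_eq h _; rewrite addr0.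
  have dW := is_derive_comp_real (is_derive_powR (- M) (W_gt0 y e0)) dw.
  have dz := is_derive_comp_real (is_derive_exprS m (zeta y)) (dzeta y i).
  have h := is_deriveM dz dW.
  apply: is_derive_eq h _; rewrite /Gphi !mxE /GRing.scale /=; ring.
- move=> i.
  rewrite (_ : (fun x => _) = (fun x => m.+1%:R * zeta x ^+ m * (w x + e) `^ (- M) * Gzeta x ord0 i +
    M * zeta x ^+ m.+1 * (w x + e) `^ (- M - 1) * (Gu x ord0 i - Gv x ord0 i))); last first.
    by apply/funext => x; rewrite /Gphi !mxE.
  apply: (continuous_glue oU clB BU) => [x xU|x /nB xB]; last first.
    have := Gphi_out e xB => /(congr1 (fun z : RN => z ord0 i)).
    by rewrite /Gphi !mxE.
  have cst (a : R) y : {for y, continuous (fun _ : RN => a)} by exact: cst_continuous.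
  have h1 := continuous_at_mul (continuous_at_mul (continuous_at_mul
    (cst m.+1%:R x) (cz m x)) (cW (- M) x xU)) (@cGzeta i x).
  have h2 := continuous_at_mul (continuous_at_mul (continuous_at_mul
    (cst M x) (cz m.+1 x)) (cW (- M - 1) x xU))
    (continuous_at_sub (@cGu i x xU) (@cGv i x xU)).
  exact: (continuousD h1 h2).
- by exists B; split => // x /nB xB; rewrite phi_out// Gphi_out.
Qed.

(** [bp] is the Hoelder exponent of |a|^(p-2) a, and [kappa] the power of w + e left when the
    gradient bound, of exponent alpha / (1 + alpha), is raised to it. *)
Let bp := Num.min 1 (p - 1).
Let kappa := alpha / (1 + alpha) * bp.

Let bp_gt0 : 0 < bp. Proof. by rewrite lt_min ltr01 subr_gt0. Qed.

Let kappa_gt0 : 0 < kappa.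
Proof. by rewrite mulr_gt0// divr_gt0// addr_gt0. Qed.

Let local_bound sg : 0 < sg -> M <= kappa * m.+1%:R ->
  exists2 D, 0 <= D & forall e, 0 < e <= 1 -> forall x, U x ->
    - F e sg D x <= enorm (Gu x) `^ (p - 2) * dot (Gu x) (Gphi e x) -
                    enorm (Gv x) `^ (p - 2) * dot (Gv x) (Gphi e x).
Proof.
move=> s0 kM.
have [mp mp0 mpP] := nat_upper_bound `|p - 2|.
have [|||C1 C10 gi] := @gradient_interpolation R n w (fun x => Gv x - Gu x) x0 r (H + H) alpha Wm
  r0 alpha0 (addr_ge0 H0 H0) Wm_gt0.
- move=> x i xr; have h := is_deriveB (dGv i (QU xr)) (dGu i (QU xr)).
  by apply: is_derive_eq h _; rewrite !mxE.
- by move=> x _; exact: w_ge0.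
- move=> x y i xr yr; rewrite !mxE mulrDl.
  rewrite (_ : _ - _ = (Gv x ord0 i - Gv y ord0 i) - (Gu x ord0 i - Gu y ord0 i)); last by ring.
  apply: le_trans (ler_normB _ _) _.
  by apply: lerD; [apply: hGv; exact: QU|apply: hGu; exact: QU].
(* The Hoelder constant on vectors of norm at most n Lg, times the constant of the bound on the
   gradient of w, raised to [bp]. *)
pose A1 := 2 * (mp%:R + 1) * (n%:R * Lg) `^ (p - 1 - bp) * (n%:R * C1) `^ bp.
have A10 : 0 <= A1 by rewrite !mulr_ge0 ?powR_ge0 ?addr_ge0.
pose A := m.+1%:R * Zg * A1 + 1.
have A0 : 0 < A by rewrite ltr_wpDl// mulr_ge0// mulr_ge0.
have [D D0 DP] := @absorb_cutoff R A sg kappa M Wm m A0 s0 Wm_gt0 kappa_gt0 kM.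
exists D => // e /andP[e0 e1] x Ux.
have [xr|xr] := leP `|x - x0| r; last first.
  rewrite Gphi_out// /dot; under eq_bigr do rewrite mxE mulr0.
  under [X in _ <= _ - _ * X]eq_bigr do rewrite mxE mulr0.
  by rewrite !big1// !mulr0 subrr oppr_le0 F_ge0// ltW.
set W := w x + e; have W0 : 0 < W by exact: W_gt0.
have WW : W <= Wm by exact: W_le.
have x2r : `|x - x0| <= 2 * r by have := r0; lra.
set X := enorm (Gu x) `^ (p - 2) *: Gu x - enorm (Gv x) `^ (p - 2) *: Gv x.
have -> : enorm (Gu x) `^ (p - 2) * dot (Gu x) (Gphi e x) -
          enorm (Gv x) `^ (p - 2) * dot (Gv x) (Gphi e x) = dot X (Gphi e x).
  by rewrite /X dotBl !dotZl.
have enG (G : RN -> RN) : (forall i, `|G x ord0 i| <= Lg) -> enorm (G x) <= n%:R * Lg.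
  move=> hG; apply: le_trans (enorm_le _) _; rewrite ler_wpM2l// norm_rV_le//.
  exact/forallP.
have Xle : enorm X <= A1 * W `^ kappa.
  apply: le_trans (plaplacian_hoelder p1 mpP mp0 bp_gt0 _ _ (enG Gu _) (enG Gv _)) _.
  - by rewrite /bp ge_min lexx.
  - by rewrite /bp ge_min lexx orbT.
  - by move=> i; exact: LGu.
  - by move=> i; exact: LGv.
  rewrite /A1 -!mulrA; do 2 (rewrite ler_wpM2l ?addr_ge0//).
  rewrite ler_wpM2l ?powR_ge0// /kappa powRrM -powRM ?mulr_ge0 ?powR_ge0//.
  apply: ge0_ler_powR; rewrite ?nnegrE ?(ltW bp_gt0) ?enorm_ge0 ?mulr_ge0 ?powR_ge0//.
  apply: le_trans (enorm_le _) _; rewrite -mulrA ler_wpM2l// norm_rV_le ?mulr_ge0 ?powR_ge0//.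
  apply/forallP => i; rewrite -normrN.
  rewrite (_ : - _ = (Gv x - Gu x) ord0 i); last by rewrite !mxE opprB.
  exact: gi.
rewrite /Gphi dotDr !dotZr -/W.
set k1 := _ * _ * W `^ (- M); set k2 := M * _ * _.
have k10 : 0 <= k1 by rewrite !mulr_ge0 ?powR_ge0 ?exprn_ge0.
have k20 : 0 <= k2 by rewrite !mulr_ge0 ?powR_ge0 ?exprn_ge0 ?(ltW M_gt0).
(* [Gu x - Gv x] is minus the gradient of w, the sign coming from the derivative of the negative
   power; monotonicity makes this part nonnegative. *)
have d2 : 0 <= dot X (Gu x - Gv x).
  by rewrite /X dotBl !dotZl; exact: plaplacian_monotone.
have d1 : - (A1 * W `^ kappa * Zg) <= dot X (Gzeta x).
  rewrite lerNl; apply: le_trans (ler_norm _) _; rewrite normrN.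
  by apply: le_trans (norm_dot_le _ _) _; apply: ler_pM; rewrite ?enorm_ge0.
apply: (@le_trans _ _ (k1 * dot X (Gzeta x))); last by rewrite lerDl mulr_ge0.
apply: (@le_trans _ _ (- (k1 * (A1 * W `^ kappa * Zg)))); last first.
  by rewrite -mulrN ler_wpM2l.
rewrite lerN2 /F B_in// mulr1.
have WM : W `^ M * W `^ (- M) = 1 by rewrite powRN mulfV// gt_eqF// powR_gt0.
(* Multiplication by W^(-M) turns the error D W^M into D, which does not depend on e. *)
have h := ler_wpM2r (powR_ge0 W (- M)) (DP (zeta x) W (zeta0 x) W0 WW).
apply: (@le_trans _ _ ((sg * zeta x ^+ m.+1 + D * W `^ M) * W `^ (- M))); last first.
  by rewrite mulrDl -[D * _ * _]mulrA WM mulr1 /phi -/W mulrA.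
apply: le_trans h.
have -> : k1 * (A1 * W `^ kappa * Zg) =
  (m.+1%:R * Zg * A1) * (zeta x ^+ m * W `^ kappa * W `^ (- M)) by rewrite /k1; ring.
have -> : A * zeta x ^+ m * W `^ kappa * W `^ (- M) =
  A * (zeta x ^+ m * W `^ kappa * W `^ (- M)) by ring.
by rewrite ler_wpM2r ?mulr_ge0 ?powR_ge0 ?exprn_ge0// /A lerDl.
Qed.

Let rhs_bound sg : 0 < sg ->
  exists2 D, 0 <= D & forall e, 0 < e <= 1 -> forall x, U x ->
    (lambda / u x `^ delta - lambda / v x `^ delta + (f x - g x)) * phi e x <=
    F e sg D x - c0 * phi e x.
Proof.
move=> s0; pose A := lambda / u0 `^ delta / u0 + 1.
have A1 : 0 <= lambda / u0 `^ delta / u0.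
  by rewrite !divr_ge0 ?powR_ge0 ?(ltW lambda0) ?(ltW u00).
have A0 : 0 < A by rewrite ltr_wpDl.
have [D D0 DP] := @absorb_power R A sg 1 M Wm A0 s0 Wm_gt0 ltr01 (ltW M_gt0).
have Z0 : 0 <= Zm by exact: le_trans (zeta0 x0) (zetaZ x0).
(* The remainder D carries the factor [zeta ^ (m + 1)] of [phi e], at most [Zm ^ (m + 1)]. *)
exists (D * Zm ^+ m.+1); first by rewrite mulr_ge0 ?exprn_ge0.
move=> e /andP[e0 e1] x Ux.
have [xr|xr] := leP `|x - x0| r; last first.
  by rewrite phi_out// !mulr0 subr0 F_ge0 ?mulr_ge0 ?exprn_ge0 ?(ltW s0).
set W := w x + e; have W0 : 0 < W by exact: W_gt0.
have WW : W <= Wm by exact: W_le.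
have st := singular_term_diff lambda0 delta0 delta1 u00 (uu0 xr) (uv x).
have h1 : lambda / u x `^ delta - lambda / v x `^ delta <= A * W.
  apply: le_trans st _; apply: ler_pM => //; first exact: w_ge0.
    by rewrite /A lerDl.
  by rewrite /W lerDl ltW.
apply: (@le_trans _ _ ((A * W - c0) * phi e x)).
  by rewrite ler_wpM2r// lerD// -opprB lerN2 fgc.
rewrite mulrBl lerD2r /F B_in// mulr1 /phi -/W.
have := DP W W0 WW; rewrite powRr1 ?(ltW W0)// => h.
apply: (@le_trans _ _ (zeta x ^+ m.+1 * (sg * W `^ (- M) + D))).
  by rewrite mulrCA ler_wpM2l ?exprn_ge0.
rewrite mulrDr lerD//; first by rewrite mulrCA.
by rewrite mulrC ler_wpM2l// lerXn2r// nnegrE.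
Qed.

(** Half of the gap between s q and q - 1: then q - 1 - bq > s q and the kernel is integrable, while
    a positive power of w is left to be absorbed. The bound 1 makes it a Hoelder exponent. *)
Let bq := Num.min 1 ((q - 1 - s * q) / 2).

Let bq_gt0 : 0 < bq.
Proof. by rewrite lt_min ltr01/= divr_gt0// subr_gt0. Qed.

Let bq_le : bq <= (q - 1 - s * q) / 2.
Proof. by rewrite /bq ge_min lexx orbT. Qed.

Let bq_le1 : bq <= q - 1.
Proof. by have := bq_le; have := sq0; have := sqq1; lra. Qed.

Let J a := `|a| `^ (q - 2) * a.

Let nonlocal_bound sg : 0 < sg ->
  exists2 D, 0 <= D & forall e, 0 < e <= 1 -> forall x y,
    - ((F e sg D x + F e sg D y) * trunc_kernel s q (q - 1 - bq) x y) <=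
    (J (u x - u y) - J (v x - v y)) * (phi e x - phi e y) * gagliardo_kernel s q x y.
Proof.
move=> s0; have Z0 : 0 <= Zm by exact: le_trans (zeta0 x0) (zetaZ x0).
have [mq mq0 mqP] := nat_upper_bound `|q - 2|.
have [|||Lu Lu0 LuP] := @lipschitz_from_cube R n u Gu x0 r Lg Mb r0 Lg0 Mb0.
- by move=> x i xr; exact: dGu (QU xr).
- by move=> x i; exact: LGu.
- by move=> x; rewrite ger0_norm//; exact: le_trans (uv x) (vM x).
have [|||Lv Lv0 LvP] := @lipschitz_from_cube R n v Gv x0 r Lg Mb r0 Lg0 Mb0.
- by move=> x i xr; exact: dGv (QU xr).
- by move=> x i; exact: LGv.
- by move=> x; rewrite ger0_norm//; exact: le_trans (u_ge0 x) (uv x).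
pose L := Lu + Lv; have L0 : 0 <= L by rewrite addr_ge0.
pose A1 := 2 * (mq%:R + 1) * L `^ (q - 1 - bq).
have A10 : 0 <= A1 by rewrite mulr_ge0 ?powR_ge0// mulr_ge0// addr_ge0.
have A0 : 0 < A1 + 1 by rewrite ltr_wpDl.
have [D D0 DP] := @absorb_power R (A1 + 1) sg bq M Wm A0 s0 Wm_gt0 bq_gt0 (ltW M_gt0).
have DZ0 : 0 <= D * Zm ^+ m.+1 by rewrite mulr_ge0 ?exprn_ge0.
exists (D * Zm ^+ m.+1) => // e /andP[e0 e1].
have F0 x : 0 <= F e sg (D * Zm ^+ m.+1) x by rewrite F_ge0// ltW.
(* For w x <= w y the difference of the two scalar q-Laplacians is nonnegative, so
   that only the term with phi e y has the wrong sign. *)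
have one_sided x y : w x <= w y ->
    - (F e sg (D * Zm ^+ m.+1) y * trunc_kernel s q (q - 1 - bq) x y) <=
    (J (u x - u y) - J (v x - v y)) * (phi e x - phi e y) * gagliardo_kernel s q x y.
  move=> wxy; set DJ := J _ - J _.
  have dE : (u x - u y) - (v x - v y) = w y - w x by rewrite /w; ring.
  have DJ0 : 0 <= DJ.
    have := scalar_plaplacian_monotone (u x - u y) (v x - v y) q1.
    rewrite dE -/(J _) -/(J _) -/DJ.
    (* For w x = w y monotonicity gives no sign, but then both arguments of J coincide. *)
    move: wxy; rewrite le_eqVlt => /orP[/eqP wE _|wlt].
      have E : u x - u y = v x - v y.
        by apply/eqP; rewrite -subr_eq0 dE wE subrr.
      by rewrite /DJ E subrr.
    by rewrite pmulr_lge0// subr_gt0.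
  have k0 := gagliardo_kernel_ge0 s q x y.
  apply: (@le_trans _ _ (- (DJ * phi e y * gagliardo_kernel s q x y))); last first.
    by rewrite -mulNr ler_wpM2r// -mulrN ler_wpM2l// -[X in X <= _]add0r lerD2r phi_ge0.
  rewrite lerN2.
  have [yr|yr] := leP `|y - x0| r; last first.
    by rewrite phi_out// mulr0 mul0r mulr_ge0 ?trunc_kernel_ge0.
  set W := w y + e; have W0 : 0 < W by exact: W_gt0.
  have WW : W <= Wm by exact: W_le.
  set mn := Num.min 1 `|x - y|.
  have mn0 : 0 <= mn by rewrite le_min ler01 normr_ge0.
  have ub : `|u x - u y| <= L * mn.
    rewrite distrC; apply: le_trans (LuP y x yr) _.
    by rewrite distrC -/mn ler_wpM2r// lerDl.
  have vb : `|v x - v y| <= L * mn.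
    rewrite distrC; apply: le_trans (LvP y x yr) _.
    by rewrite distrC -/mn ler_wpM2r// lerDr.
  have bq1 : bq <= 1 by rewrite /bq ge_min lexx.
  (* The arguments of J are at most L mn in size and differ by w y - w x <= W: the Hoelder bound
     shares the powers between mn and W. *)
  have DJle : DJ <= A1 * mn `^ (q - 1 - bq) * W `^ bq.
    apply: le_trans (ler_norm _) _.
    apply: le_trans (scalar_plaplacian_hoelder q1 mqP mq0 bq_gt0 bq1 bq_le1 ub vb) _.
    rewrite powRM// !mulrA -/A1 ler_wpM2l ?mulr_ge0 ?powR_ge0//.
    apply: ge0_ler_powR; rewrite ?nnegrE ?(ltW bq_gt0) ?(ltW W0)//.
    rewrite dE ger0_norm ?subr_ge0// /W; have := w_ge0 x; lra.
  have h1 : A1 * W `^ bq * phi e y <= F e sg (D * Zm ^+ m.+1) y.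
    apply: (@le_trans _ _ (zeta y ^+ m.+1 * ((A1 + 1) * W `^ bq * W `^ (- M)))).
      rewrite /phi -/W [leLHS]mulrCA ler_wpM2l ?exprn_ge0//.
      by rewrite ler_wpM2r ?powR_ge0// ler_wpM2r ?powR_ge0// lerDl.
    apply: (@le_trans _ _ (zeta y ^+ m.+1 * (sg * W `^ (- M) + D))).
      by rewrite ler_wpM2l ?exprn_ge0//; exact: DP.
    rewrite mulrDr /F B_in// mulr1 lerD//; first by rewrite mulrCA.
    by rewrite mulrC ler_wpM2l// lerXn2r// nnegrE.
  rewrite /trunc_kernel -/mn mulrA ler_wpM2r//.
  apply: (@le_trans _ _ (A1 * mn `^ (q - 1 - bq) * W `^ bq * phi e y)).
    by rewrite ler_wpM2r.
  rewrite (_ : A1 * _ * _ * _ = A1 * W `^ bq * phi e y * mn `^ (q - 1 - bq)); last by ring.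
  by rewrite ler_wpM2r ?powR_ge0.
move=> x y.
have t0 := trunc_kernel_ge0 s q (q - 1 - bq) x y.
(* Exchanging x and y does not change the expression, because J is odd and the kernel symmetric. *)
have JN a : J (- a) = - J a by rewrite /J normrN mulrN.
have [wxy|wyx] := leP (w x) (w y).
  apply: le_trans (one_sided x y wxy).
  by rewrite lerN2 ler_wpM2r// lerDr.
have := one_sided y x (ltW wyx).
rewrite trunc_kernelC gagliardo_kernelC -(opprB (u x)) -(opprB (v x)) !JN => h.
apply: (@le_trans _ _ (- (F e sg (D * Zm ^+ m.+1) x * trunc_kernel s q (q - 1 - bq) x y))).
  by rewrite lerN2 ler_wpM2r// lerDl.
apply: le_trans h _.
by rewrite le_eqVlt; apply/orP; left; apply/eqP; ring.
Qed.

Let integral_bound : M <= kappa * m.+1%:R ->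
  exists K, forall e, 0 < e <= 1 -> \int[mu]_x phi e x <= K.
Proof.
move=> kM.
have sqb : s * q < q - 1 - bq by have := bq_le; have := sqq1; lra.
have [Ck Ck0 CkP] := @integral_trunc_kernel R n s q (q - 1 - bq) sq0 sqb.
(* The errors enter 1 time from the local term, 2 Ck times from the nonlocal one and 1 time from the
   right hand side. With this choice sg (2 + 2 Ck) = c0 / 2, and half of c0 survives. *)
pose sg := c0 / (4 * (1 + Ck)).
have Ck1 : 0 < 1 + Ck by rewrite ltr_pwDl.
have s0 : 0 < sg by rewrite divr_gt0// mulr_gt0.
have [D1 D10 D1P] := local_bound s0 kM.
have [D2 D20 D2P] := nonlocal_bound s0.
have [D3 D30 D3P] := rhs_bound s0.
(* One constant for the three bounds, as F is nondecreasing in D. *)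
pose D := D1 + D2 + D3.
pose V := \int[mu]_x \1_B x.
exists ((2 + 2 * Ck) * D * V * (2 / c0)) => e e01; have [e0 e1] := andP e01.
have D0 : 0 <= D by rewrite !addr_ge0.
have FD D' x : D' <= D -> F e sg D' x <= F e sg D x.
  by move=> h; rewrite /F lerD2l ler_wpM2r// /indic ler0n.
have D1D : D1 <= D by rewrite /D; lra.
have D2D : D2 <= D by rewrite /D; lra.
have D3D : D3 <= D by rewrite /D; lra.
have phiC := phi_C1c e0.
have iphi : mu.-integrable setT (EFin \o phi e).
  apply: (@cc_integrable _ _ _ (`|x0| + r)); first by case: phiC.
  by move=> x xr; apply: phi_out; have := lerB_dist x x0; lra.
have iB : mu.-integrable setT (EFin \o (\1_B : RN -> R)) by exact: cube_indic_integrable.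
have iF : mu.-integrable setT (EFin \o F e sg D).
  by apply: integrable_EFinD => //; apply: integrable_EFinZ.
have mF : measurable_fun setT (F e sg D).
  by apply/measurable_EFinP; exact: (measurable_int _ iF).
have F0 x : 0 <= F e sg D x by rewrite F_ge0// ltW.
have mU := open_measurable_rV oU.
have out x : ~ U x -> r < `|x - x0|.
  by move=> nU; rewrite ltNge; apply/negP => h; apply: nU; apply: QU; have := r0; lra.
have UT (h : RN -> R) : (forall x, ~ U x -> h x = 0) -> \int[mu]_(x in U) h x = \int[mu]_x h x.
  move=> hU; rewrite Rintegral_mkcond; congr Rintegral.
  by apply/funext => x; rewrite patchE; case: ifPn => // /negP; rewrite inE => /hU.
have Fout x : ~ U x -> F e sg D x = 0.
  by move=> /out xr; rewrite /F phi_out// mulr0 add0r indicE memNset ?mulr0// /B /= leNgt xr.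
have phiU x : ~ U x -> phi e x = 0 by move=> /out; exact: phi_out.
have [ib hb] := nonlocal_error_integral CkP Ck0 mF F0 iF.
have iU (h : RN -> R) : mu.-integrable setT (EFin \o h) -> mu.-integrable U (EFin \o h).
  by apply: integrableS.
have iFU := iU _ iF; have iphiU := iU _ iphi.
have iphiUc : mu.-integrable U (EFin \o (fun x => c0 * phi e x)) by exact: integrable_EFinZ.
have ic : mu.-integrable U (EFin \o (fun x => F e sg D x - c0 * phi e x)).
  exact: integrable_EFinB.
have wGu : weak_gradient U u Gu by exact: weak_gradient_C1.
have wGv : weak_gradient U v Gv by exact: weak_gradient_C1.
have sqq : s * q < q by have := sqq1; lra.
have := @test_inequality R n U p q s lambda delta f g u v oU p1 sq0 sqq usol vsol
  Gu Gv (Gphi e) (phi e) (F e sg D) (fun x => F e sg D x - c0 * phi e x)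
  (fun z => (F e sg D z.1 + F e sg D z.2) * trunc_kernel s q (q - 1 - bq) z.1 z.2)
  wGu wGv phiC (phi_ge0 e) iFU ib ic.
have ha x : U x -> - F e sg D x <= enorm (Gu x) `^ (p - 2) * dot (Gu x) (Gphi e x) -
    enorm (Gv x) `^ (p - 2) * dot (Gv x) (Gphi e x).
  by move=> Ux; apply: le_trans (D1P e e01 x Ux); rewrite lerN2 FD.
have hbb x y : - ((F e sg D x + F e sg D y) * trunc_kernel s q (q - 1 - bq) x y) <=
    (J (u x - u y) - J (v x - v y)) * (phi e x - phi e y) * gagliardo_kernel s q x y.
  apply: le_trans (D2P e e01 x y); rewrite lerN2 ler_wpM2r ?trunc_kernel_ge0//.
  by rewrite lerD// FD.
have hc x : U x -> (lambda / u x `^ delta - lambda / v x `^ delta + (f x - g x)) * phi e x <=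
    F e sg D x - c0 * phi e x.
  by move=> Ux; apply: le_trans (D3P e e01 x Ux) _; rewrite lerD2r FD.
move=> /(_ ha hbb hc); rewrite RintegralB// RintegralZl// !UT// => T.
have FE : \int[mu]_x F e sg D x = sg * \int[mu]_x phi e x + D * V.
  by rewrite RintegralD ?RintegralZl//; exact: integrable_EFinZ.
move: T hb; rewrite FE.
set I := \int[mu]_x phi e x; set Ib := (X in _ - X <= _); move=> T hb.
have sgE : sg * (2 + 2 * Ck) = c0 / 2 by rewrite /sg; field; rewrite gt_eqF.
have key : c0 / 2 * I <= (2 + 2 * Ck) * D * V.
  have E : (2 + 2 * Ck) * (sg * I + D * V) = c0 / 2 * I + (2 + 2 * Ck) * D * V.
    by rewrite -sgE; ring.
  have hb' : Ib <= 2 * Ck * (sg * I + D * V) := hb.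
  lra.
rewrite -(ler_pM2l c00) [leRHS](_ : _ = 2 * ((2 + 2 * Ck) * D * V)); last first.
  by field; rewrite gt_eqF.
lra.
Qed.

Lemma strong_comparison_at : M <= kappa * m.+1%:R -> 0 < zeta x0 -> u x0 < v x0.
Proof.
move=> kM z0; rewrite lt_neqAle uv andbT; apply/eqP => uvx0.
have [K KP] := integral_bound kM.
have [|||Lu Lu0 LuP] := @lipschitz_from_cube R n u Gu x0 r Lg Mb r0 Lg0 Mb0.
- by move=> x i xr; exact: dGu (QU xr).
- by move=> x i; exact: LGu.
- by move=> x; rewrite ger0_norm//; exact: le_trans (uv x) (vM x).
have [|||Lv Lv0 LvP] := @lipschitz_from_cube R n v Gv x0 r Lg Mb r0 Lg0 Mb0.
- by move=> x i xr; exact: dGv (QU xr).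
- by move=> x i; exact: LGv.
- by move=> x; rewrite ger0_norm//; exact: le_trans (u_ge0 x) (uv x).
(* Since w x0 = 0, w is at most (Lu + Lv) e on the cube of radius e; the 1 accounts for the shift by
   e. *)
pose L := Lu + Lv + 1; have L0 : 0 < L by rewrite ltr_wpDl// addr_ge0.
have x0r : `|x0 - x0| <= r by rewrite subrr normr0 ltW.
have wL e x : `|x - x0| <= e -> w x + e <= L * e.
  move=> xe; have mn : Num.min 1 `|x0 - x| <= e by rewrite ge_min distrC xe orbT.
  have hu := le_trans (LuP x0 x x0r) (ler_wpM2l Lu0 mn).
  have hv := le_trans (LvP x0 x x0r) (ler_wpM2l Lv0 mn).
  have wE : w x = (u x0 - u x) - (v x0 - v x) by rewrite /w uvx0; ring.
  have : w x <= Lu * e + Lv * e.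
    by rewrite wE; apply: le_trans (ler_norm _) _; apply: le_trans (ler_normB _ _) _; exact: lerD.
  rewrite /L; lra.
pose z := zeta x0 / 2; have zz0 : 0 < z by rewrite divr_gt0.
have [d d0 hd] : exists2 d, 0 < d & forall y, `|y - x0| <= d -> z <= zeta y.
  have : \forall y \near x0, z < zeta y.
    have cz : {for x0, continuous zeta} by exact: czeta.
    apply: (@cvgr_gt _ _ (nbhs x0) (nbhs_filter x0) zeta (zeta x0) cz z).
    by rewrite /z ltr_pdivrMr// ltr_pMr ?ltr1n.
  move=> /nbhs_ballP[d /= d0 hd]; exists (d / 2); first by rewrite divr_gt0.
  move=> y yx; apply: ltW; apply: hd; rewrite -ball_normE /ball_ /= distrC.
  by apply: le_lt_trans yx _; rewrite ltr_pdivrMr// ltr_pMr// ltr1n.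
(* The lower bound for [phi e] contains (L e)^(-n-1), and the cube has volume (2 e)^n: the product
   is c / e. *)
pose c := z ^+ m.+1 * 2 ^+ n / L ^+ n.+1.
have cc0 : 0 < c by rewrite divr_gt0 ?mulr_gt0 ?exprn_gt0.
have K0 : 0 < `|K| + 1 by rewrite ltr_wpDl.
(* The last bound makes c / e at least |K| + 1, which exceeds K. *)
pose e := Num.min (Num.min 1 d) (c / (`|K| + 1)).
have e0 : 0 < e by rewrite !lt_min ltr01 d0 divr_gt0.
have e1 : e <= 1 by rewrite /e !ge_min lexx.
have ed : e <= d by rewrite /e !ge_min lexx orbT.
have ec : e <= c / (`|K| + 1) by rewrite /e ge_min lexx orbT.
pose Q : set RN := [set x | `|x - x0| <= e].
pose k := z ^+ m.+1 / (L * e) ^+ n.+1.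
have k0 : 0 <= k by rewrite ltW// divr_gt0 ?exprn_gt0// mulr_gt0.
have kphi x : k * \1_Q x <= phi e x.
  rewrite indicE; have [xQ|xQ] := boolP (x \in Q); last by rewrite mulr0 phi_ge0.
  move: xQ; rewrite inE /Q /= => xQ; rewrite mulr1 /phi.
  apply: ler_pM; rewrite ?exprn_ge0 ?invr_ge0 ?exprn_ge0 ?mulr_ge0 ?(ltW L0) ?(ltW e0) ?(ltW zz0)//.
    rewrite lerXn2r ?nnegrE ?(ltW zz0)//.
    by apply: hd; exact: le_trans ed.
  have W0 := W_gt0 x e0.
  rewrite powRN /M powR_mulrn ?(ltW W0)// lef_pV2 ?posrE ?exprn_gt0 ?mulr_gt0//.
  by rewrite lerXn2r ?nnegrE ?(ltW W0) ?mulr_ge0 ?(ltW L0) ?(ltW e0)// wL.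
have iphi : mu.-integrable setT (EFin \o phi e).
  apply: (@cc_integrable _ _ _ (`|x0| + r)); first by case: (phi_C1c e0).
  by move=> x xr; apply: phi_out; have := lerB_dist x x0; lra.
have iQ : mu.-integrable setT (EFin \o (\1_Q : RN -> R)) by exact: cube_indic_integrable.
have mQ : measurable Q by exact: measurable_cube.
have QE : \int[mu]_x \1_Q x = (e *+ 2) ^+ n.
  rewrite /Rintegral integral_indic// setIT.
  by have := lebesgue_rV_cube x0 (ltW e0) => /(congr1 fine).
have : k * (e *+ 2) ^+ n <= K.
  apply: le_trans (KP e _); last by rewrite e0.
  rewrite -QE -RintegralZl//; apply: le_Rintegral => //.
  exact: integrable_EFinZ.
have -> : k * (e *+ 2) ^+ n = c / e.
  rewrite /k /c -[e *+ 2]mulr_natl !exprMn [e ^+ n.+1]exprS.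
  by field; rewrite !expf_neq0 ?gt_eqF.
rewrite ler_pdivrMr// leNgt => /negP; apply.
apply: (@le_lt_trans _ _ (`|K| * e)); first by rewrite ler_wpM2r ?(ltW e0)// ler_norm.
move: ec; rewrite ler_pdivlMr// => ec; apply: lt_le_trans ec.
by rewrite mulrC ltr_pM2l// ltrDl.
Qed.

End strong_comparison.

Section cutoff.
Variables (R : realType) (n : nat).
Local Notation RN := 'rV[R]_n.

Lemma is_derive_translate (f : RN -> R) (a x e : RN) (d : R) :
  is_derive (x - a) e f d -> is_derive x e (fun y => f (y - a)) d.
Proof.
move=> [df dE].
have F : (fun h : R => h^-1 *: (((fun y => f (y - a)) \o shift x) (h *: e) - f (x - a))) =
    (fun h => h^-1 *: ((f \o shift (x - a)) (h *: e) - f (x - a))).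
  by apply/funext => h /=; rewrite addrA.
by split; rewrite ?/derivable ?/derive F.
Qed.

(** A translated mollifier serves as cutoff: it has to be positive at a, not equal to 1 near a,
    whence the bound [Zm]. *)
Lemma cutoff_exists (a : RN) (r : R) : 0 < r ->
  exists (zeta : RN -> R) (G : RN -> RN) (Zm Zg : R),
  [/\ continuous zeta, forall x i, is_derive x (basis_vec R i) zeta (G x ord0 i),
      forall i, continuous (fun x => G x ord0 i), 0 < zeta a &
      [/\ forall x, 0 <= zeta x, forall x, zeta x <= Zm, 0 <= Zg,
          forall x, enorm (G x) <= Zg & forall x, r < `|x - a| -> zeta x = 0]].
Proof.
move=> r0; have [rho rb [rho0 _ rho00 _]] := bumpN_exists n r0.
have csub : continuous (fun x : RN => x - a).
  by move=> x; apply: continuousB => //; exact: cst_continuous.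
have ctr (h : RN -> R) : continuous h -> continuous (fun x : RN => h (x - a)).
  by move=> ch x; apply: (@continuous_comp _ _ _ (fun x : RN => x - a) h); [exact: csub|exact: ch].
have bnd (h : RN -> R) : bumpN r h -> exists C : R, forall x, `|h x| <= C.
  move=> hb; have [C _ hC] := @vanishes_beyond_bounded R n h r (bumpN_continuous hb)
    (fun x xr => bumpN_out r0 hb (ltW xr)).
  by exists C.
have [Zm hZm] := bnd _ rb.
have [C hC] := choice (fun i => bnd _ (bumpN_partial i rb).1).
exists (fun x => rho (x - a)), (fun x => \row_i partial i rho (x - a)), Zm,
  (n%:R * \sum_i `|C i|); split.
- exact: ctr (bumpN_continuous rb).
- move=> x i; rewrite mxE; apply: is_derive_translate.
  exact: (bumpN_partial i rb).2.
- move=> i; rewrite (_ : (fun x => _) = (fun x => partial i rho (x - a))).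
    exact: ctr (bumpN_continuous (bumpN_partial i rb).1).
  by apply/funext => x; rewrite mxE.
- by rewrite subrr.
split.
- by move=> x; exact: rho0.
- by move=> x; apply: le_trans (ler_norm _) _.
- by rewrite mulr_ge0// sumr_ge0.
- move=> x; apply: le_trans (enorm_le _) _; rewrite ler_wpM2l// norm_rV_le ?sumr_ge0//.
  apply/forallP => i; rewrite mxE (bigD1 i)//=.
  apply: le_trans (le_trans (hC i (x - a)) (ler_norm _)) _.
  by rewrite lerDl sumr_ge0.
- by move=> x xr; apply: (bumpN_out r0 rb); exact: ltW.
Qed.

End cutoff.

Theorem theorem2p8 (R : realType) (N : nat) (Omega : set 'rV[R]_N)
    (s p q alpha delta lambda : R) (f g u v : 'rV[R]_N -> R)
    (N_gt0 : (0 < N)%N)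
    (domOmega : bounded_domain Omega) (smoothOmega : smooth_boundary Omega)
    (s_gt0 : 0 < s) (s_lt1 : s < 1) (p_gt1 : 1 < p) (q_gt1 : 1 < q)
    (sq_lt_p : s * q < p) (alpha_gt0 : 0 < alpha) (alpha_lt1 : alpha < 1)
    (delta_gt0 : 0 < delta) (delta_lt1 : delta < 1) (lambda_gt0 : 0 < lambda)
    (q_large : (1 - s)^-1 < q)
    (cf : {within Omega, continuous f}) (cg : {within Omega, continuous g})
    (f_ge0 : forall x, Omega x -> 0 <= f x)
    (fg : forall x, Omega x -> f x < g x)
    (uC1 : C1_holder_closure alpha Omega u)
    (vC1 : C1_holder_closure alpha Omega v)
    (usol : weak_solution p q s lambda delta Omega f u)
    (u_gt0 : forall x, Omega x -> 0 < u x)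
    (u_out : forall x, ~ Omega x -> u x = 0)
    (vsol : weak_solution p q s lambda delta Omega g v)
    (v_gt0 : forall x, Omega x -> 0 < v x)
    (v_out : forall x, ~ Omega x -> v x = 0) :
  forall x, Omega x -> 0 < u x /\ u x < v x.
Proof.
have [oU _ _ bU] := domOmega.
have [cu [Gu [Cu [dGu hGu]]]] := uC1.
have [cv [Gv [Cv [dGv hGv]]]] := vC1.
have inU (h : 'rV[R]_N -> R) : {within Omega, continuous h} -> {in Omega, continuous h}.
  by rewrite continuous_open_subspace.
have inC (h : 'rV[R]_N -> R) : {within closure Omega, continuous h} -> {in Omega, continuous h}.
  by move=> ch; apply: inU; apply: continuous_subspaceW ch; exact: subset_closure.
have cGu := holder_continuous oU alpha_gt0 hGu.
have cGv := holder_continuous oU alpha_gt0 hGv.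
have sq0 : 0 < s * q by rewrite mulr_gt0// (lt_trans ltr01).
(* This is (1 - s) q > 1, the form in which [q_large] enters the nonlocal estimate. *)
have sqq1 : s * q < q - 1.
  have s1 : 0 < 1 - s by rewrite subr_gt0.
  by move: q_large; rewrite -(ltr_pM2l s1) mulfV ?gt_eqF//; lra.
have sqq : s * q < q by lra.
have uv := weak_comparison oU bU p_gt1 q_gt1 sq0 sqq delta_gt0 lambda_gt0 usol vsol
  (inU _ cf) (inU _ cg) fg cu cv dGu dGv cGu cGv u_gt0 v_gt0 u_out v_out.
move=> a Oa; split; first exact: u_gt0.
have u_ge0 x : 0 <= u x.
  by have [/u_gt0/ltW|/u_out->] := pselect (Omega x).
(* Half of the values at a, so that the bounds persist near a by continuity. *)
pose c0 := (g a - f a) / 2; pose u0 := u a / 2.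
have c00 : 0 < c0 by rewrite divr_gt0// subr_gt0 fg.
have u00 : 0 < u0 by rewrite divr_gt0// u_gt0.
have [r r0 rP] : exists2 r, 0 < r & forall x, `|x - a| <= 2 * r ->
    [/\ Omega x, c0 <= g x - f x & u0 <= u x].
  have : \forall x \near a, [/\ Omega x, c0 <= g x - f x & u0 <= u x].
    have h1 : \forall x \near a, Omega x by apply: open_nbhs_nbhs; split.
    have aO : a \in Omega by rewrite inE.
    have gf : {for a, continuous (fun x => g x - f x)}.
      exact: continuous_at_sub (inU _ cg a aO) (inU _ cf a aO).
    have h2 : \forall x \near a, c0 < g x - f x.
      apply: (@cvgr_gt _ _ (nbhs a) (nbhs_filter a) _ _ gf).
      by rewrite /c0 ltr_pdivrMr// ltr_pMr ?ltr1n// subr_gt0 fg.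
    have h3 : \forall x \near a, u0 < u x.
      apply: (@cvgr_gt _ _ (nbhs a) (nbhs_filter a) _ _ (inC _ cu a aO)).
      by rewrite /u0 ltr_pdivrMr// ltr_pMr ?ltr1n// u_gt0.
    by apply: filterS3 h1 h2 h3 => x ? /ltW ? /ltW.
  move=> /nbhs_ballP[d /= d0 hd]; exists (d / 4); first by rewrite divr_gt0.
  move=> x xd; apply: hd; rewrite -ball_normE /ball_ /= distrC.
  apply: le_lt_trans xd _; lra.
have [Mb Mb0 vM] : exists2 M, 0 <= M & forall x, v x <= M.
  have [|c _ vc] := @EVT_max_rV R N v (closure Omega) _ (bounded_closure_compact bU) cv.
    by exists a; exact: subset_closure.
  have vcl x : Omega x -> v x <= v c by move=> Ox; apply: vc; rewrite inE; exact: subset_closure.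
  have vc0 : 0 <= v c by apply: le_trans (vcl a Oa); exact: ltW (v_gt0 _ Oa).
  by exists (v c) => // x; have [/vcl|/v_out->] := pselect (Omega x).
(* A common Hoelder constant; absolute values, as nothing is assumed on the signs of [Cu] and
   [Cv]. *)
pose H := `|Cu| + `|Cv|; have H0 : 0 <= H by rewrite addr_ge0.
have holder (G : 'rV[R]_N -> 'rV[R]_N) C : C <= H ->
    (forall x y i, closure Omega x -> closure Omega y ->
       `|G x ord0 i - G y ord0 i| <= C * enorm (x - y) `^ alpha) ->
    forall x y i, Omega x -> Omega y -> `|G x ord0 i - G y ord0 i| <= H * enorm (x - y) `^ alpha.
  move=> CH hG x y i Ox Oy; apply: le_trans (hG x y i _ _) _; try exact: subset_closure.
  by rewrite ler_wpM2r ?powR_ge0.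
have CuH : Cu <= H by rewrite (le_trans (ler_norm Cu))// lerDl.
have CvH : Cv <= H by rewrite (le_trans (ler_norm Cv))// lerDr.
have {}hGu := holder _ _ CuH hGu; have {}hGv := holder _ _ CvH hGv.
(* The gradients at a plus their oscillation over the cube of radius 2 r, whose points are within
   Euclidean distance 2 r N of a. *)
pose Lg := `|Gu a| + `|Gv a| + H * (N%:R * (2 * r)) `^ alpha.
have Lg0 : 0 <= Lg by rewrite addr_ge0 ?mulr_ge0 ?powR_ge0// addr_ge0.
have GL (G : 'rV[R]_N -> 'rV[R]_N) :
    (forall x y i, Omega x -> Omega y ->
       `|G x ord0 i - G y ord0 i| <= H * enorm (x - y) `^ alpha) -> `|G a| <= `|Gu a| + `|Gv a| ->
    forall x i, `|x - a| <= 2 * r -> `|G x ord0 i| <= Lg.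
  move=> hG Ga x i xr; have [Ox _ _] := rP _ xr.
  rewrite -[G x ord0 i](subrK (G a ord0 i)); apply: le_trans (ler_normD _ _) _.
  rewrite addrC lerD//; first exact: le_trans (coord_le_norm _ _) Ga.
  apply: le_trans (hG _ _ _ Ox Oa) _; rewrite ler_wpM2l//.
  apply: ge0_ler_powR; rewrite ?nnegrE ?(ltW alpha_gt0) ?enorm_ge0 ?mulr_ge0 ?(ltW r0)//.
  by apply: le_trans (enorm_le _) _; rewrite ler_wpM2l.
have LGu := GL _ hGu; have LGv := GL _ hGv.
have [zeta [Gz [Zm [Zg [cz dz cGz za [z0 zZ Zg0 GZ zout]]]]]] := cutoff_exists a r0.
have k0 : 0 < alpha / (1 + alpha) * Num.min 1 (p - 1).
  by rewrite mulr_gt0 ?divr_gt0 ?addr_gt0// lt_min ltr01 subr_gt0.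
(* The power of the cutoff is taken so large that N + 1 <= kappa m, which gives the inequality with
   m + 1 that absorption requires. *)
have [m m0 mP] := nat_upper_bound (N.+1%:R / (alpha / (1 + alpha) * Num.min 1 (p - 1))).
have xr2 x : `|x - a| <= r -> `|x - a| <= 2 * r by lra.
apply: (strong_comparison_at oU p_gt1 q_gt1 alpha_gt0 sq0 sqq1 delta_gt0 (ltW delta_lt1)
  lambda_gt0 usol vsol (inC _ cu) (inC _ cv) dGu dGv cGu cGv u_ge0 uv Mb0 vM r0 _ H0
  hGu hGv Lg0 (LGu _) (LGv _) c00 _ u00 _ cz dz cGz z0 zZ Zg0 GZ zout m0 _ za).
- by move=> x /rP[].
- by rewrite lerDl.
- by rewrite lerDr.
- by move=> x /xr2/rP[].
- by move=> x /xr2/rP[].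
- move: mP; rewrite ler_pdivrMr// => mP; apply: le_trans mP _.
  by rewrite mulrC ler_wpM2l ?(ltW k0)// ler_nat.
Qed.
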